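(* Let $\alpha$ be a badly approximable real number. Then for any monotonically decreasing $\psi:\mathbb{N}\to[0,\infty)$, $$\lambda(\{\gamma\in[0,1):\lVert n\alpha+\gamma\rVert\le\psi(n)\text{ for infinitely many }n\in\mathbb{S}_2\})=\begin{cases}0&\text{if }\sum_{n\in\mathbb{S}_2}\psi(n)<\infty,\\ 1&\text{if }\sum_{n\in\mathbb{S}_2}\psi(n)=\infty.\end{cases}$$ However, for every real $\alpha$ satisfying $\liminf_{n\to\infty}n\lVert n\alpha\rVert\sqrt{\log n}=0$, there exists a monotonically decreasing $\psi=\psi_\alpha:\mathbb{N}\to[0,\infty)$ with $\sum_{n\in\mathbb{S}_2}\psi(n)=\infty$ but $$\lambda(\{\gamma\in[0,1):\lVert n\alpha+\gamma\rVert\le\psi(n)\text{ for infinitely many }n\in\mathbb{S}_2\})=0.$$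
   Context: $\mathbb{N}$ is the set of positive integers, $\mathbb{N}_0=\mathbb{N}\cup\{0\}$, and $\mathbb{S}_2:=\{n\in\mathbb{N}:\exists k,\ell\in\mathbb{N}_0:\ n=k^2+\ell^2\}$. $\lVert x\rVert$ is the distance from $x$ to the nearest integer, $\lambda$ the Lebesgue measure. A real $\alpha$ is badly approximable if $\liminf_{n\to\infty}n\lVert n\alpha\rVert>0$. ''Monotonically decreasing'' means non-increasing. *)

(* Defs.v *)
From HB Require Import structures.
From mathcomp Require Import all_boot all_order all_algebra.
From mathcomp Require Import all_classical all_reals all_analysis.
Set Implicit Arguments.
Unset Strict Implicit.
Unset Printing Implicit Defensive.
Import Order.TTheory GRing.Theory Num.Theory.
Import numFieldNormedType.Exports.
Local Open Scope classical_set_scope.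
Local Open Scope ring_scope.

Definition nint_dist (R : realType) (x : R) : R :=
  inf (range (fun m : int => `|x - m%:~R|)).

Definition sums_two_squares : set nat :=
  [set n | (0 < n)%N /\ exists k l : nat, n = (k ^ 2 + l ^ 2)%N].

(* The liminf is taken in the extended reals because [limn_inf] carries no
   information when the sequence of tail infima diverges; the spurious term at
   n = 0 does not affect it. *)
Definition badly_approximable (R : realType) (alpha : R) : Prop :=
  (0 < limn_einf (fun n : nat =>
         (n%:R * nint_dist (n%:R * alpha))%:E : \bar R))%E.

(* A map on the positive integers is encoded by its values at n > 0; the value
   at 0 is unconstrained and never used. *)
Definition nonincreasing_nonneg (R : realType) (psi : nat -> R) : Prop :=
  (forall n, (0 < n)%N -> 0 <= psi n) /\
  (forall m n, (0 < m)%N -> (m <= n)%N -> psi n <= psi m).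

Definition inhom_approx_set (R : realType) (alpha : R) (psi : nat -> R)
    : set R :=
  [set gamma | 0 <= gamma < 1 /\
     infinite_set [set n | sums_two_squares n /\
                           nint_dist (n%:R * alpha + gamma) <= psi n]].

(* Main.v *)
Require Import Defs.
From HB Require Import structures.
From mathcomp Require Import all_boot all_order all_algebra.
From mathcomp Require Import all_classical all_reals all_analysis.
From mathcomp Require Import zify ring lra.

(** Write S for the set of sums of two squares, N for a large integer and call
    [crad N = sqrt (ln N) / N] the critical radius: since S has about
    [N / sqrt (ln N)] elements up to N, arcs of this radius around the points
    [- n alpha], n in S and [n <= N], have total length of order 1.

    The convergence half is the Borel-Cantelli lemma ([approx_null]).

    For the divergence half one needs the arcs not to pile up.  The arithmetic
    input is [exists_well_spaced]: when alpha is badly approximable, a positive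
    proportion of the elements of S up to N can be selected so that the points
    [n alpha] are [crad N]-separated modulo 1.  This is a second moment
    statement.  The number of pairs m < n composed of primes 1 mod 4 with
    [n - m = d] is at most a constant times [N / ln N] times a local factor of
    d, by Selberg's sieve ([selberg_sieve], [pair_sieve]); there are only about
    [sqrt (ln N)] shifts d with [d alpha] within [crad N] of an integer, and the
    local factor is bounded on average over them because alpha is badly
    approximable ([bohr_multiples], [shift_factor_critical_sum]).  So there are
    O(N / sqrt (ln N)) close pairs ([close_pairs]), while the set itself has at
    least a constant times [N / sqrt (ln N)] elements ([ncount_pnat_ge]); a
    greedy choice removes the conflicts.  The two counts of order
    [N / sqrt (ln N)] come from Mertens' theorems in the classes 1 and 3
    modulo 4 ([mertens4_bound]), so that no contour integration is involved.

    Along the scales [N = B ^ k] the divergence of the series says that the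
    total length of the arcs diverges ([block_divergence]).  Separation makes
    the arcs of different scales quasi-independent, hence the limsup set has
    measure at least a constant v that depends on alpha only
    ([approx_positive]).  The same bound holds for each function
    [n |-> psi (B ^ k n) / B ^ k], and if gamma belongs to the limsup sets of
    all of them then [B ^ k gamma] modulo 1 belongs to that of psi for every k,
    because B is a square and S is stable under multiplication by squares.  So
    the magnifications of a set of positive measure all lie in the limsup set of
    psi, and Lebesgue's density theorem gives it full measure ([approx_full]).

    In the other direction, if [q * ||q alpha|| * sqrt (ln q)] is tiny for some
    large q, then for N a large multiple of [q * sqrt (ln q)] the points
    [n alpha], [n <= N], stick to the q points [b alpha], [b < q], at the scale
    [crad N]: all the arcs of radius [crad N] are covered by q arcs of small
    total length ([small_cover]), although their own total length over S is
    bounded below.  Taking psi constant equal to [crad N] on blocks between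
    successive such N gives the counterexample ([exists_null_divergent]). *)

Set Implicit Arguments.
Unset Strict Implicit.
Unset Printing Implicit Defensive.
Import Order.TTheory GRing.Theory Num.Theory.
Import numFieldNormedType.Exports.
Local Open Scope classical_set_scope.
Local Open Scope ring_scope.

(** * Chebyshev's and Mertens' estimates *)

Lemma big_nat_recr_cond (T : Type) (idx : T) (op : Monoid.law idx) (a b : nat)
    (P : pred nat) (F : nat -> T) : (a <= b)%N ->
  \big[op/idx]_(a <= i < b.+1 | P i) F i =
  op (\big[op/idx]_(a <= i < b | P i) F i) (if P b then F b else idx).
Proof. by move=> ab; rewrite big_mkcond big_nat_recr// -big_mkcond. Qed.

Lemma prod_primes_dvd (a b X : nat) :
  (forall p, (a <= p < b)%N -> prime p -> (p %| X)%N) ->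
  (\prod_(a <= p < b | prime p) p %| X)%N.
Proof.
elim: b => [|b IH] h; first by rewrite big_geq ?dvd1n.
have [ab|ab] := leqP a b; last by rewrite big_geq ?dvd1n.
rewrite big_nat_recr_cond//=.
have IH' : (\prod_(a <= p < b | prime p) p %| X)%N.
  by apply: IH => p /andP[p1 p2]; apply: h; rewrite p1 ltnW.
case: ifPn => pb; last by rewrite muln1.
rewrite Gauss_dvd ?IH' ?h ?ab ?leqnn//.
rewrite coprime_sym prime_coprime// big_nat_cond Euclid_dvd_prod//.
rewrite big_has_cond -all_predC; apply/allP => p _ /=.
case: (boolP (a <= p < b)%N) => //= /andP[_ pltb].
case: (boolP (prime p)) => //= pp; rewrite gtnNdvd// prime_gt0//.
Qed.

(** [C(2m+1, m)] and [C(2m+1, m+1)] are equal and both occur in [(1 + 1) ^ (2m+1)]. *)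
Lemma bin_half_le m : ('C(m.*2.+1, m) <= 4 ^ m)%N.
Proof.
have h := expnDn 1 1 m.*2.+1.
have m1 : (m < m.*2.+2)%N by lia.
have m2 : (m.+1 < m.*2.+2)%N by lia.
have e : 'C(m.*2.+1, m.+1) = 'C(m.*2.+1, m).
  by rewrite -[in RHS]bin_sub; [congr 'C(_, _); lia|lia].
have : ('C(m.*2.+1, m) + 'C(m.*2.+1, m.+1) <= 2 ^ m.*2.+1)%N.
  rewrite -[2%N]/(1 + 1)%N h.
  rewrite (bigD1 (Ordinal m1))//= (bigD1 (Ordinal m2))//=; last first.
    by apply/eqP => -[]; lia.
  rewrite !exp1n !muln1 addnA leq_addr//.
by rewrite e expnS -mul2n expnM (_ : 2 ^ 2 = 4)%N//; lia.
Qed.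

(** Every prime in (m+1, 2m+1] divides the binomial coefficient
    C(2m+1, m) <= 4^m, so the bound follows by strong induction. *)
Lemma primorial_le n : (\prod_(1 <= p < n.+1 | prime p) p <= 4 ^ n)%N.
Proof.
elim/ltn_ind: n => n IH.
have [n2|n2] := leqP n 2.
  by case: n n2 {IH} => [|[|[|//]]] _; rewrite unlock.
have [[m nE]|[m nE]] : (exists m, n = m.*2.+1) \/ (exists m, n = m.*2.+2).
  case: (boolP (odd n)) => o; [left; exists n./2|right; exists n./2.-1]; lia.
- have mn : (m.+1 < n)%N by lia.
  rewrite (@big_cat_nat _ _ _ m.+2)//=; last by lia.
  have := IH _ mn; set A := (\prod_(1 <= p < m.+2 | _) _)%N => hA.
  have hB : (\prod_(m.+2 <= p < n.+1 | prime p) p <= 'C(m.*2.+1, m))%N.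
    apply: dvdn_leq; first by rewrite bin_gt0; lia.
    apply: prod_primes_dvd => p hp pp.
    have := bin_fact (_ : (m <= m.*2.+1)%N) => /(_ ltac:(lia)) hf.
    have hd : (p %| (m.*2.+1)`!)%N by apply/dvdn_fact/andP; split; [exact: prime_gt0|lia].
    have nd k : (k < p)%N -> ~~ (p %| k`!)%N.
      elim: k => [|k IHk] kp; first by rewrite fact0 dvdn1; case: p pp {hd hp kp} => [|[|]].
      rewrite factS Euclid_dvdM// negb_or IHk ?(ltnW kp)// andbT.
      by rewrite gtnNdvd.
    move: hd; rewrite -hf !Euclid_dvdM// => /orP[//|/orP[|]].
      by move=> h; have := nd m ltac:(lia); rewrite h.
    by move=> h; have := nd (m.*2.+1 - m)%N ltac:(lia); rewrite h.
  have := bin_half_le m; set B := (\prod_(m.+2 <= p < n.+1 | _) _)%N in hB *.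
  move=> hm; rewrite nE.
  have -> : (4 ^ m.*2.+1 = 4 ^ m.+1 * 4 ^ m)%N by rewrite -expnD; congr (_ ^ _)%N; lia.
  by apply: leq_mul => //; exact: leq_trans hm.
- rewrite big_nat_recr_cond//=; last lia.

  rewrite ifF; last first.
    apply/negP => /even_prime[|]; rewrite nE; first lia.
    by rewrite /= odd_double.
  rewrite muln1 nE -nE; apply: leq_trans (_ : (4 ^ n.-1 <= _)%N); last by rewrite leq_exp2l// leq_pred.
  have := IH n.-1; rewrite prednK; last lia.
  by apply; lia.
Qed.

Lemma ln_nat_ge0 (R : realType) (n : nat) : 0 <= ln (n%:R : R).
Proof.
case: n => [|n]; first by rewrite ln0.
by apply: ln_ge0; rewrite ler1n.
Qed.

Lemma ln2_le1 (R : realType) : ln (2 : R) <= 1.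
Proof.
have -> : 2 = 1 + 1 :> R by lra.
by apply: le_ln1Dx; lra.
Qed.

Lemma ln_prod_nat (R : realType) (r : seq nat) (P : pred nat) (F : nat -> nat) :
  (forall i, P i -> (0 < F i)%N) ->
  ln ((\prod_(i <- r | P i) F i)%N%:R : R) = \sum_(i <- r | P i) ln (F i)%:R.
Proof.
move=> h; suff : ln ((\prod_(i <- r | P i) F i)%N%:R : R) = \sum_(i <- r | P i) ln (F i)%:R
   /\ (0 < \prod_(i <- r | P i) F i)%N by case.
elim: r => [|i r [IH IH2]]; first by rewrite !big_nil ln1.
rewrite !big_cons; case: ifP => // Pi; rewrite muln_gt0 h// IH2; split=> //.
by rewrite natrM lnM ?IH// posrE ltr0n// h.
Qed.

Lemma theta_le (R : realType) (n : nat) :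
  \sum_(1 <= p < n.+1 | prime p) ln p%:R <= 2 * n%:R :> R.
Proof.
rewrite -ln_prod_nat; last by move=> p; exact: prime_gt0.
apply: (@le_trans _ _ (ln ((4 ^ n)%:R))).
  rewrite ler_ln ?posrE ?ltr0n ?expn_gt0//; last by rewrite prodn_cond_gt0// => i; exact: prime_gt0.
  by rewrite ler_nat primorial_le.
rewrite natrX lnXn//.
have -> : 4%:R = 2 ^+ 2 :> R by rewrite -natrX.
rewrite lnXn// -[_ *+ n]mulr_natr ler_wpM2r//.
by have := ln2_le1 R; rewrite -mulr_natr; lra.
Qed.

Lemma sum_multiples (V : nmodType) (f : nat -> V) (d N : nat) : (0 < d)%N ->
  \sum_(1 <= n < N.+1 | (d %| n)%N) f n =
  \sum_(1 <= m < (N %/ d).+1) f (d * m)%N.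
Proof.
move=> d0; elim: N => [|N IH]; first by rewrite div0n !big_geq.
rewrite big_nat_recr_cond//= IH divnS//.
case: ifPn => h; last by rewrite add0n addr0.
rewrite add1n [in RHS]big_nat_recr//=; congr (_ + f _).
by rewrite -[LHS](divnK h) divnS// h add1n mulnC.
Qed.

Lemma ln_factor (R : realType) (n N : nat) : (0 < n <= N)%N ->
  ln (n%:R : R) =
  \sum_(1 <= p < N.+1 | prime p) \sum_(1 <= k < N.+1 | (p ^ k %| n)%N) ln p%:R.
Proof.
move=> /andP[n0 nN].
have nE : n = (\prod_(1 <= p < N.+1 | prime p) p ^ logn p n)%N.
  rewrite -[LHS]partnT// (widen_partn _ nN) big_ltn//= lognE/= expn0 mul1n.
  rewrite [RHS]big_mkcond [LHS]big_mkcond /=; apply: eq_bigr => p _.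
  by case: ifPn => //= pp; rewrite lognE (negbTE pp).
rewrite {1}nE ln_prod_nat; last by move=> p pp; rewrite expn_gt0 prime_gt0.
apply: eq_bigr => p pp; rewrite natrX lnXn ?ltr0n ?prime_gt0//.
have -> : \sum_(1 <= k < N.+1 | (p ^ k %| n)%N) ln (p%:R : R) =
          \sum_(1 <= k < (logn p n).+1) ln p%:R.
  rewrite [RHS](@big_nat_widen _ _ _ _ _ N.+1).
    by apply: eq_bigl => k /=; rewrite pfactor_dvdn.
  rewrite ltnS; apply: leq_trans nN; apply: ltnW.
  have h : (p ^ logn p n %| n)%N by exact: pfactor_dvdnn.
  apply: leq_trans (dvdn_leq n0 h); exact: ltn_expl (prime_gt1 pp).
by rewrite sumr_const_nat subn1.
Qed.

(** The Chebyshev-type identity behind all the estimates below: expand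
    [ln n] over the prime powers dividing [n] and exchange the sums. *)
Lemma sum_mul_ln (R : realType) (f : nat -> R) (N : nat) :
  \sum_(1 <= n < N.+1) f n * ln n%:R =
  \sum_(1 <= p < N.+1 | prime p) \sum_(1 <= k < N.+1)
     ln p%:R * \sum_(1 <= m < (N %/ p ^ k).+1) f (p ^ k * m)%N.
Proof.
transitivity (\sum_(1 <= n < N.+1) \sum_(1 <= p < N.+1 | prime p)
   \sum_(1 <= k < N.+1) (if (p ^ k %| n)%N then ln p%:R * f n else 0)).
  apply: eq_big_nat => n nN; rewrite (@ln_factor R n N)// mulr_sumr.
  apply: eq_bigr => p _; rewrite mulr_sumr big_mkcond /=.
  by apply: eq_bigr => k _; rewrite mulrC.
rewrite exchange_big /=; apply: eq_bigr => p pp.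
rewrite exchange_big /=; apply: eq_bigr => k _.
rewrite -(@sum_multiples _ f) ?expn_gt0 ?prime_gt0// mulr_sumr.
by rewrite [RHS]big_mkcond.
Qed.

Lemma ln_succ_le (R : realType) (x : R) : 0 < x -> ln (x + 1) - ln x <= x^-1.
Proof.
move=> x0; rewrite -ln_div ?posrE; [|lra|lra].
have -> : (x + 1) / x = 1 + x^-1 by field; lra.
have xV : 0 < x^-1 by rewrite invr_gt0.
by apply: le_ln1Dx; lra.
Qed.

(** Telescoping against [(ln n + 2) / n]. *)
Lemma sum_ln_div_sqr (R : realType) (N : nat) :
  \sum_(2 <= n < N) ln n%:R / (n%:R * (n%:R - 1)) <= 2 :> R.
Proof.
pose g n : R := (ln n%:R + 2) / n%:R.
have step n : (1 <= n)%N -> ln n.+1%:R / (n.+1%:R * (n.+1%:R - 1)) <= g n - g n.+1.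
  move=> n1; rewrite /g; set x : R := n%:R.
  have x1 : 1 <= x by rewrite ler1n.
  have -> : n.+1%:R = x + 1 by rewrite -natr1.
  have l : ln (x + 1) - ln x <= x^-1 by apply: ln_succ_le; lra.
  have -> : x + 1 - 1 = x by lra.
  rewrite -subr_ge0.
  have -> : (ln x + 2) / x - (ln (x + 1) + 2) / (x + 1) - ln (x + 1) / ((x + 1) * x)
     = (2 - (x + 1) * (ln (x + 1) - ln x)) / ((x + 1) * x) by field; lra.
  apply: divr_ge0; last by nra.
  have : (x + 1) * x^-1 = 1 + x^-1 by field; lra.
  have : x^-1 <= 1 by rewrite invf_le1; lra.
  by nra.
have h M : \sum_(2 <= n < M.+2) ln n%:R / (n%:R * (n%:R - 1)) <= 2 - g M.+1 :> R.
  elim: M => [|M IH]; first by rewrite big_geq// /g ln1; lra.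
  rewrite big_nat_recr//=; apply: le_trans (lerD IH (step M.+1 isT)) _.
  by rewrite addrA subrK.
case: N => [|[|N]]; try by rewrite big_geq// ler0n.
apply: le_trans (h N) _; rewrite gerBl /g divr_ge0// addr_ge0 ?ln_nat_ge0//.
Qed.

Lemma sum_geometric_tail (R : realType) (x : R) (N : nat) : 0 <= x < 1 ->
  \sum_(2 <= k < N) x ^+ k <= x ^+ 2 / (1 - x).
Proof.
move=> /andP[x0 x1].
have h M : \sum_(2 <= k < M.+2) x ^+ k = (x ^+ 2 - x ^+ M.+2) / (1 - x).
  elim: M => [|M IH]; first by rewrite big_geq// subrr mul0r.
  by rewrite big_nat_recr//= IH [x ^+ M.+3]exprS; field; lra.
have p : 0 <= x ^+ 2 / (1 - x) by rewrite divr_ge0 ?exprn_ge0//; lra.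
case: N => [|[|N]]; try by rewrite big_geq.
rewrite h ler_wpM2r ?invr_ge0; [by []|lra|].
by rewrite gerBl exprn_ge0.
Qed.

(** Higher prime powers contribute O(1) to every Mertens-type sum: a geometric
    series in [k], then [sum_ln_div_sqr]. *)
Lemma sum_prime_powers (R : realType) (N M : nat) :
  \sum_(1 <= p < N | prime p) \sum_(2 <= k < M) ln p%:R / p%:R ^+ k <= 2 :> R.
Proof.
apply: le_trans (sum_ln_div_sqr R N).
rewrite big_mkcond /=.
case: N => [|[|N]]; try by rewrite !big_geq.
rewrite big_ltn//= add0r; apply: ler_sum_nat => p /andP[p2 _].
have p1 : 1 < p%:R :> R by rewrite ltr1n.
case: ifPn => pp; last first.
  by apply: divr_ge0; [exact: ln_nat_ge0|apply: mulr_ge0; lra].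
rewrite -mulr_sumr; apply: ler_wpM2l; first exact: ln_nat_ge0.
have := @sum_geometric_tail R p%:R^-1 M.
have -> : p%:R^-1 ^+ 2 / (1 - p%:R^-1) = (p%:R * (p%:R - 1))^-1 :> R.
  by field; apply/andP; split; lra.
move=> h; apply: le_trans (h _).
  by rewrite le_eqVlt; apply/orP; left; apply/eqP/eq_bigr => k _; rewrite exprVn.
by rewrite invr_ge0 ltW ?invf_lt1//; lra.
Qed.

Lemma sum_ln_ge (R : realType) (N : nat) :
  N%:R * ln N%:R - N%:R <= \sum_(1 <= n < N.+1) ln n%:R :> R.
Proof.
elim: N => [|N IH]; first by rewrite big_geq// mul0r subrr.
rewrite big_nat_recr//=.
case: N IH => [|N] IH; first by rewrite big_geq// ln1 mulr0; lra.
set x : R := N.+1%:R; have x1 : 1 <= x by rewrite ler1n.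
have -> : N.+2%:R = x + 1 by rewrite -natr1.
rewrite -/x in IH.
clearbody x; have l : ln (x + 1) - ln x <= x^-1 by apply: ln_succ_le; lra.
have e : x * x^-1 = 1 by field; lra.
by set s := \sum_(_ <= _ < _) _ in IH *; nra.
Qed.

Lemma sum_ln_le (R : realType) (N : nat) :
  \sum_(1 <= n < N.+1) ln n%:R <= N%:R * ln N%:R :> R.
Proof.
apply: le_trans (_ : \sum_(1 <= n < N.+1) ln (N%:R : R) <= _).
  apply: ler_sum_nat => n /andP[n0 nN].
  by rewrite ler_ln ?posrE ?ltr0n ?ler_nat//; lia.
by rewrite sumr_const_nat subn1 mulr_natl.
Qed.

Lemma natr_divn_le (R : realType) (m d : nat) :
  (m %/ d)%:R <= m%:R / d%:R :> R.
Proof.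
case: d => [|d]; first by rewrite divn0 invr0 mulr0.
by rewrite ler_pdivlMr ?ltr0n// -natrM ler_nat leq_divM.
Qed.

Lemma natr_divn_gt (R : realType) (m d : nat) : (0 < d)%N ->
  m%:R / d%:R - 1 < (m %/ d)%:R :> R.
Proof.
move=> d0; rewrite ltrBlDr natr1 ltr_pdivrMr ?ltr0n// -natrM ltr_nat.
by rewrite {1}(divn_eq m d) mulSn addnC ltn_add2r ltn_mod.
Qed.

Definition mertens (R : realType) (n : nat) : R :=
  \sum_(1 <= p < n.+1 | prime p) ln p%:R / p%:R.

Lemma sum_ln_floor (R : realType) (N : nat) :
  \sum_(1 <= n < N.+1) ln n%:R =
  \sum_(1 <= p < N.+1 | prime p) \sum_(1 <= k < N.+1)
     ln p%:R * (N %/ p ^ k)%:R :> R.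
Proof.
transitivity (\sum_(1 <= n < N.+1) 1 * ln n%:R : R).
  by apply: eq_bigr => n _; rewrite mul1r.
rewrite sum_mul_ln; apply: eq_bigr => p _; apply: eq_bigr => k _.
by rewrite sumr_const_nat subn1.
Qed.

(** Divide [ln N! <= N ln N] by [N] after keeping only [k = 1] in [sum_ln_floor];
    the rounding costs [theta_le]. *)
Lemma mertens_le (R : realType) (N : nat) : mertens R N <= ln N%:R + 2.
Proof.
case: N => [|N]; first by rewrite /mertens big_geq// ln0//; lra.
set n := N.+1; have n0 : 0 < n%:R :> R by rewrite ltr0n.
suff : n%:R * mertens R n <= n%:R * ln n%:R + 2 * n%:R.
  by rewrite -[2 * _]mulrC -mulrDr ler_pM2l.
apply: le_trans (lerD (sum_ln_le R n) (theta_le R n)).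
rewrite sum_ln_floor -big_split /= mulr_sumr; apply: ler_sum => p pp.
rewrite [leRHS]addrC big_ltn//= expn1 addrA ler_wpDr//.
  by apply: sumr_ge0 => k _; rewrite mulr_ge0 ?ln_nat_ge0.
have := natr_divn_gt R n (prime_gt0 pp).
have -> : n%:R * (ln p%:R / p%:R) = ln p%:R * (n%:R / p%:R) :> R by rewrite mulrCA.
have := ln_nat_ge0 R p; set a := ln _; set b := _ / _; set c := _%:R.
by move=> *; nra.
Qed.

(** Same identity, now with [ln N! >= N ln N - N] and the higher powers bounded by
    [sum_prime_powers]. *)
Lemma mertens_ge (R : realType) (N : nat) : ln N%:R - 3 <= mertens R N.
Proof.
case: N => [|N]; first by rewrite /mertens big_geq// ln0//; lra.
set n := N.+1; have n0 : 0 < n%:R :> R by rewrite ltr0n.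
suff : n%:R * ln n%:R - n%:R <= n%:R * (mertens R n + 2).
  rewrite (_ : _ - n%:R = n%:R * (ln n%:R - 1)); last by rewrite mulrBr mulr1.
  by rewrite ler_pM2l//; lra.
apply: le_trans (sum_ln_ge R n) _; rewrite sum_ln_floor.
apply: le_trans (_ : n%:R * (mertens R n + \sum_(1 <= p < n.+1 | prime p)
   \sum_(2 <= k < n.+1) ln p%:R / p%:R ^+ k) <= _); last first.
  by apply: ler_wpM2l; [exact: ltW|rewrite lerD2l sum_prime_powers].
rewrite /mertens -big_split /= mulr_sumr; apply: ler_sum => p pp.
rewrite big_ltn//= mulrDr; apply: lerD.
  by rewrite expn1 mulrCA; apply: ler_wpM2l; rewrite ?ln_nat_ge0 ?natr_divn_le.
rewrite mulr_sumr; apply: ler_sum => k _; rewrite mulrCA -natrX.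
by apply: ler_wpM2l; rewrite ?ln_nat_ge0 ?natr_divn_le.
Qed.

(** * Mertens' estimates in the residue classes 1 and 3 modulo 4 *)

(** Abel summation transfers bounded character sums, and bounded errors in
    Mertens' estimates, to other weights. *)
Lemma abel_bound (R : realType) (u f : nat -> R) (C : R) (a b : nat) :
  (forall m, `|\sum_(a <= n < m) u n| <= C) ->
  (forall n, (a <= n)%N -> 0 <= f n) ->
  (forall n, (a <= n)%N -> f n.+1 <= f n) ->
  `|\sum_(a <= n < b) u n * f n| <= C * f a.
Proof.
move=> hU f0 fd; have C0 : 0 <= C by apply: le_trans (hU 0%N).
have [ab|ba] := leqP a b; last by rewrite big_geq ?(ltnW ba)// normr0 mulr_ge0 ?f0.
have key : `|\sum_(a <= n < b) u n * f n - (\sum_(a <= n < b) u n) * f b| <=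
    C * (f a - f b).
  elim: b ab => [|b IH].
    by rewrite leqn0 => /eqP->; rewrite !big_geq// mul0r !subrr normr0 mulr0.
  rewrite leq_eqVlt => /orP[/eqP <-|]; last rewrite ltnS => ab.
    by rewrite !big_geq// mul0r !subrr normr0 mulr0.
  have := hU b.+1; rewrite !big_nat_recr//=.
  have := IH ab; set X := \sum_(a <= n < b) u n * f n; set Y := \sum_(a <= n < b) u n.
  move=> h1 h2.
  have -> : X + u b * f b - (Y + u b) * f b.+1 =
     (X - Y * f b) + (Y + u b) * (f b - f b.+1) by ring.
  apply: le_trans (ler_normD _ _) _; rewrite normrM.
  have d := fd b ab; rewrite [`|f b - _|]ger0_norm ?subr_ge0//.
  have -> : C * (f a - f b.+1) = C * (f a - f b) + C * (f b - f b.+1) by ring.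
  by apply: lerD => //; apply: ler_wpM2r; rewrite ?subr_ge0.
have -> : \sum_(a <= n < b) u n * f n = (\sum_(a <= n < b) u n * f n -
   (\sum_(a <= n < b) u n) * f b) + (\sum_(a <= n < b) u n) * f b by ring.
apply: le_trans (ler_normD _ _) _; rewrite normrM [`|f b|]ger0_norm ?f0//.
have -> : C * f a = C * (f a - f b) + C * f b by ring.
by apply: lerD => //; apply: ler_wpM2r; rewrite ?f0.
Qed.

(** The nontrivial Dirichlet character modulo 4. *)
Definition chi (R : realType) (n : nat) : R :=
  (n %% 4 == 1)%N%:R - (n %% 4 == 3)%N%:R.

Lemma chiM (R : realType) (m n : nat) : chi R (m * n) = chi R m * chi R n.
Proof.
rewrite /chi -modnMm.
have := ltn_pmod m (isT : (0 < 4)%N); have := ltn_pmod n (isT : (0 < 4)%N).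
move: (m %% 4)%N (n %% 4)%N => [|[|[|[|//]]]] [|[|[|[|//]]]] _ _ /=; ring.
Qed.

Lemma chi_norm (R : realType) (n : nat) : `|chi R n| <= 1.
Proof.
rewrite /chi; have := ltn_pmod n (isT : (0 < 4)%N).
by move: (n %% 4)%N => [|[|[|[|//]]]] _ /=; rewrite ?subrr ?subr0 ?sub0r ?normrN ?normr0 ?normr1.
Qed.

Lemma chi_sum (R : realType) (a b : nat) : `|\sum_(a <= n < b) chi R n| <= 1.
Proof.
have h m : \sum_(0 <= n < m) chi R n = ((m %% 4 == 2) || (m %% 4 == 3))%N%:R.
  elim: m => [|m IH]; first by rewrite big_geq.
  rewrite big_nat_recr//= IH /chi -[m.+1]addn1 -modnDml.
  have := ltn_pmod m (isT : (0 < 4)%N).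
  by move: (m %% 4)%N => [|[|[|[|//]]]] _ /=; lra.
have [ab|ba] := leqP a b; last by rewrite big_geq ?(ltnW ba)// normr0.
have e := @big_cat_nat _ _ _ a 0 b xpredT (chi R) isT ab.
have -> : \sum_(a <= n < b) chi R n = \sum_(0 <= n < b) chi R n - \sum_(0 <= n < a) chi R n.
  by rewrite e /= addrAC subrr add0r.
rewrite !h; do 2 case: (_ || _); rewrite ?subrr ?subr0 ?sub0r ?normrN ?normr0 ?normr1//.
Qed.

(** Partial sums of the series of L(1, chi). *)
Definition chi_harmonic (R : realType) (N : nat) : R :=
  \sum_(1 <= n < N.+1) chi R n / n%:R.

Lemma chi_harmonic_tail (R : realType) (a b : nat) : (0 < a)%N ->
  `|\sum_(a <= n < b) chi R n / n%:R| <= a%:R^-1.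
Proof.
move=> a0; rewrite -[leRHS]mul1r.
apply: (@abel_bound R (chi R) (fun n => n%:R^-1)) => [m|n an|n an].
- exact: chi_sum.
- by rewrite invr_ge0.
- by rewrite lef_pV2 ?posrE ?ltr0n ?ler_nat//; lia.
Qed.

(** The series alternates: [1 - 1/3 + ...].  This replaces the nonvanishing of
    L(1, chi). *)
Lemma chi_harmonic_ge (R : realType) (N : nat) : (0 < N)%N ->
  2 / 3 <= chi_harmonic R N.
Proof.
have e1 : chi R 1 = 1 by rewrite /chi /= subr0.
have e2 : chi R 2 = 0 by rewrite /chi /= subr0.
case: N => [|[|N]]// _; rewrite /chi_harmonic big_ltn// e1.
  by rewrite big_geq// divr1; lra.
rewrite big_ltn// e2 mul0r add0r divr1.
have := @chi_harmonic_tail R 3 N.+3 isT; rewrite ler_norml => /andP[h _].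
by set s := \sum_(_ <= _ < _) _ in h *; lra.
Qed.

Lemma chi_harmonic_norm (R : realType) (N : nat) : `|chi_harmonic R N| <= 1.
Proof. by have := @chi_harmonic_tail R 1 N.+1 isT; rewrite invr1. Qed.

Lemma chi_harmonic_sub (R : realType) (M N : nat) : (M <= N)%N ->
  `|chi_harmonic R N - chi_harmonic R M| <= M.+1%:R^-1.
Proof.
move=> MN; rewrite /chi_harmonic (@big_cat_nat _ _ _ M.+1 1 N.+1)//=.
by rewrite addrAC subrr add0r chi_harmonic_tail.
Qed.

Lemma ln2_ge (R : realType) : 2^-1 <= ln (2 : R).
Proof.
have : ln (1 + (- 2^-1)) <= - 2^-1 :> R by apply: le_ln1Dx; lra.
have -> : 1 + - 2^-1 = 2^-1 :> R by field.
by rewrite lnV ?posrE//; lra.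
Qed.

Lemma ln4_ge1 (R : realType) (x : R) : 4 <= x -> 1 <= ln x.
Proof.
move=> x4; have h : ln (4 : R) <= ln x by rewrite ler_ln ?posrE//; lra.
apply: le_trans h; have -> : 4 = 2 ^+ 2 :> R by rewrite -natrX.
by rewrite lnXn//; have := ln2_ge R; lra.
Qed.

(** The first terms are split off because [ln n / n] decreases only from [n = 3]
    on. *)
Lemma chi_ln_sum (R : realType) (N : nat) :
  `|\sum_(1 <= n < N) chi R n / n%:R * ln n%:R| <= 2.
Proof.
have l3 : 0 <= ln (3 : R) <= 3.
  by rewrite ln_ge0 ?ltW ?ln_sublinear//; lra.
have l4 : 0 <= ln (4 : R) <= 4.
  by rewrite ln_ge0 ?ltW ?ln_sublinear//; lra.
have e3 : chi R 3 = -1 by rewrite /chi /= sub0r.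
have e2 : chi R 2 = 0 by rewrite /chi /= subr0.
case: N => [|[|[|[|N]]]]; try by rewrite big_geq ?normr0.
- by rewrite big_ltn// ln1 mulr0 big_geq// addr0 normr0.
- by rewrite big_ltn// ln1 mulr0 big_ltn// e2 !mul0r big_geq// !addr0 normr0.
rewrite big_ltn// ln1 mulr0 big_ltn// e2 !mul0r !add0r.
rewrite big_ltn// e3; apply: le_trans (ler_normD _ _) _.
have : `|-1 / 3 * ln (3 : R)| <= 1 by rewrite ler_norml; lra.
have : `|\sum_(4 <= n < N.+4) chi R n * (ln n%:R / n%:R)| <= 1 * (ln 4 / 4).
  apply: (@abel_bound R (chi R) (fun n => ln n%:R / n%:R)) => [m|n an|n an].
  - exact: chi_sum.
  - by rewrite divr_ge0// ln_nat_ge0.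
  - have n4 : 4 <= n%:R :> R by rewrite ler_nat.
    rewrite -natr1; move: (n%:R : R) n4 => x x4.
    have l : ln (x + 1) - ln x <= x^-1 by apply: ln_succ_le; lra.
    have e : x * x^-1 = 1 by field; lra.
    have := ln4_ge1 x4.
    rewrite ler_pdivrMr; last lra.
    rewrite mulrAC ler_pdivlMr; last lra.
    by move: (ln (x + 1)) (ln x) l => A B; nra.
have -> : \sum_(4 <= i < N.+4) chi R i / i%:R * ln i%:R =
   \sum_(4 <= n < N.+4) chi R n * (ln n%:R / n%:R).
  by apply: eq_bigr => n _; rewrite -mulrA [_^-1 * _]mulrC.
by move: (\sum_(_ <= _ < _) _) => s; lra.
Qed.

Definition chi_mertens (R : realType) (n : nat) : R :=
  \sum_(1 <= p < n.+1 | prime p) chi R p * (ln p%:R / p%:R).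

(** Expanding [ln n] in [sum_(n <= N) chi n ln n / n = O(1)] gives
    [sum_(p <= N) (chi p ln p / p) L(N/p)] up to prime powers, where the partial
    sums [L] of L(1, chi) stay above 2/3 and L(N/p) differs from L(N) by
    at most p / N. *)
Lemma chi_mertens_bound (R : realType) (N : nat) : `|chi_mertens R N| <= 9.
Proof.
case: N => [|N]; first by rewrite /chi_mertens big_geq// normr0.
set n := N.+1; have n0 : 0 < n%:R :> R by rewrite ltr0n.
have h0 := chi_ln_sum R n.+1; rewrite sum_mul_ln in h0.
pose L := chi_harmonic R.
have eL p k : (0 < p)%N -> \sum_(1 <= m < (n %/ p ^ k).+1) chi R (p ^ k * m) / (p ^ k * m)%:R
   = chi R (p ^ k) / p%:R ^+ k * L (n %/ p ^ k)%N.
  move=> p0; rewrite mulr_sumr; apply: eq_bigr => m _.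
  by rewrite chiM natrM natrX invfM mulrACA.
(* A collects the primes, B the higher prime powers *)
pose A := \sum_(1 <= p < n.+1 | prime p) chi R p * (ln p%:R / p%:R) * L (n %/ p)%N.
pose B := \sum_(1 <= p < n.+1 | prime p) \sum_(2 <= k < n.+1)
   ln p%:R * (chi R (p ^ k) / p%:R ^+ k * L (n %/ p ^ k)%N).
have h1 : `|A + B| <= 2.
  move: h0; congr (`|_| <= _); rewrite /A /B -big_split /=; apply: eq_bigr => p pp.
  rewrite big_ltn//= eL ?prime_gt0// expn1 expr1; congr (_ + _); first by ring.
  by apply: eq_bigr => k _; rewrite eL ?prime_gt0.
have hB : `|B| <= 2.
  apply: le_trans (sum_prime_powers R n.+1 n.+1).
  apply: le_trans (ler_norm_sum _ _ _) _; apply: ler_sum => p pp.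
  apply: le_trans (ler_norm_sum _ _ _) _; apply: ler_sum => k _.
  rewrite !normrM ger0_norm ?ln_nat_ge0// ler_wpM2l ?ln_nat_ge0//.
  rewrite [`|_ ^- k|]ger0_norm ?invr_ge0 ?exprn_ge0// mulrAC -[leRHS]mul1r.
  apply: ler_wpM2r; first by rewrite invr_ge0 exprn_ge0.
  by rewrite -[leRHS]mulr1 ler_pM// ?chi_norm ?chi_harmonic_norm.
have hL : 2 / 3 <= L n by exact: chi_harmonic_ge.
have hA : `|A - chi_mertens R n * L n| <= 2.
  rewrite /A /chi_mertens mulr_suml -sumrB.
  apply: le_trans (ler_norm_sum _ _ _) _.
  apply: le_trans (_ : n%:R^-1 * \sum_(1 <= p < n.+1 | prime p) ln p%:R <= _).
    rewrite mulr_sumr; apply: ler_sum => p pp; rewrite -mulrBr normrM.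
    have p0 : 0 < p%:R :> R by rewrite ltr0n prime_gt0.
    rewrite normrM [`|_ / _|]ger0_norm ?divr_ge0 ?ln_nat_ge0//.
    rewrite [`|L _ - _|]distrC; have := chi_harmonic_sub R (leq_div n p) => hs.
    have hd : (n %/ p).+1%:R^-1 <= p%:R / n%:R :> R.
      rewrite -[p%:R / _]invf_div lef_pV2 ?posrE ?divr_gt0 ?ltr0n//; last exact: prime_gt0.
      by have := natr_divn_gt R n (prime_gt0 pp); rewrite -natr1 => ?; lra.
    apply: le_trans (_ : (ln p%:R / p%:R) * (p%:R / n%:R) <= _).
      apply: ler_pM => //; [by rewrite mulr_ge0 ?divr_ge0 ?ln_nat_ge0| |exact: le_trans hd].
      rewrite -[leRHS]mul1r ler_wpM2r ?chi_norm// divr_ge0 ?ln_nat_ge0//.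
    by rewrite mulrA divfK ?gt_eqF// mulrC.
  rewrite ler_pdivrMl// mulrC; exact: theta_le.
have h3 : `|chi_mertens R n * L n| <= 6.
  move: h1 hB hA; rewrite !ler_norml => /andP[? ?] /andP[? ?] /andP[? ?].
  by apply/andP; split; lra.
have : `|chi_mertens R n| * (2 / 3) <= 6.
  apply: le_trans h3; rewrite normrM ler_wpM2l//.
  by apply: le_trans hL _; exact: ler_norm.
by lra.
Qed.

Definition mertens4 (R : realType) (a n : nat) : R :=
  \sum_(1 <= p < n.+1 | prime p && (p %% 4 == a)%N) ln p%:R / p%:R.

(** The error [d] is the contribution of the prime 2. *)
Lemma mertens4_sum (R : realType) (n : nat) :
  exists2 d : R, 0 <= d <= 1 &
    mertens R n = d + mertens4 R 1 n + mertens4 R 3 n /\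
    chi_mertens R n = mertens4 R 1 n - mertens4 R 3 n.
Proof.
exists (\sum_(1 <= p < n.+1 | prime p && (p == 2)%N) ln p%:R / p%:R).
  case: n => [|[|n]]; try by rewrite big_geq// lexx ler01.
    by rewrite unlock /= lexx ler01.
  rewrite big_ltn_cond//= big_ltn_cond//= big1_seq ?addr0 => [|i]; last first.
    by rewrite mem_index_iota => /andP[/andP[_ /eqP ->]].
  have := ln2_le1 R; have := ln2_ge R; lra.
have cl p : prime p -> [\/ p = 2, (p %% 4 = 1)%N | (p %% 4 = 3)%N].
  move=> /even_prime[->|]; first by constructor.
  by move=> o; case: (boolP (p %% 4 == 1)%N) => [/eqP|] h; [constructor 2|constructor 3; lia].
split; rewrite /mertens /chi_mertens /mertens4.
  rewrite [LHS]big_mkcond [X in X + _ + _]big_mkcond /=.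
  rewrite [X in _ + X + _]big_mkcond [X in _ + _ + X]big_mkcond -!big_split /=.
  apply: eq_bigr => p _; case: ifPn => //= pp; last by rewrite !addr0.
  case: (cl p pp) => h; rewrite h /= ?eqxx /= ?addr0 ?add0r//.
  - by case: ifPn => [/eqP pE|_]; [rewrite pE in h|rewrite add0r].
  - by case: ifPn => [/eqP pE|_]; [rewrite pE in h|rewrite add0r].
rewrite [X in X - _]big_mkcond [X in _ - X]big_mkcond -sumrB big_mkcond /=.
apply: eq_bigr => p _; case: ifPn => //= pp; last by rewrite subr0.
by rewrite /chi; case: (cl p pp) => h; rewrite h /=; ring.
Qed.

(** Solve the two relations of [mertens4_sum]: the two classes add up
    to [ln n + O(1)] and differ by O(1). *)
Lemma mertens4_bound (R : realType) (a n : nat) : a = 1%N \/ a = 3%N ->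
  `|mertens4 R a n - ln n%:R / 2| <= 7.
Proof.
move=> ha; have [d d01 [e1 e2]] := mertens4_sum R n.
have := mertens_le R n; have := mertens_ge R n.
have := chi_mertens_bound R n; rewrite e1 e2 !ler_norml => /andP[? ?] ? ?.
by case: ha => ->; apply/andP; split; lra.
Qed.

Lemma ln_succ_ge (R : realType) (x : R) : 0 < x -> (x + 1)^-1 <= ln (x + 1) - ln x.
Proof.
move=> x0; suff : ln x - ln (x + 1) <= - (x + 1)^-1 by lra.
rewrite -ln_div ?posrE; [|lra|lra].
have -> : x / (x + 1) = 1 + - (x + 1)^-1 by field; lra.
have x1 : (x + 1)^-1 < 1 by rewrite invf_lt1; lra.
by apply: le_ln1Dx; lra.
Qed.

Lemma harmonic_le (R : realType) (N : nat) :
  \sum_(2 <= n < N.+1) n%:R^-1 <= ln N%:R :> R.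
Proof.
case: N => [|N]; first by rewrite big_geq// ln0.
elim: N => [|N IH]; first by rewrite big_geq// ln1.
rewrite big_nat_recr//=; apply: le_trans (lerD IH (lexx _)) _.
rewrite -lerBrDl -[N.+2%:R]natr1; apply: ln_succ_ge; by rewrite ltr0n.
Qed.

Lemma harmonic_ge (R : realType) (N : nat) :
  ln N.+1%:R <= \sum_(1 <= n < N.+1) n%:R^-1 :> R.
Proof.
elim: N => [|N IH]; first by rewrite big_geq// ln1.
rewrite big_nat_recr//=; apply: le_trans (lerD IH (lexx _)).
by rewrite -lerBlDl -[N.+2%:R]natr1; apply: ln_succ_le; rewrite ltr0n.
Qed.

(** Telescoping against [ln (ln n)]. *)
Lemma sum_inv_n_ln (R : realType) (N : nat) : (2 <= N)%N ->
  \sum_(2 <= n < N.+1) (n%:R * ln n%:R)^-1 <= ln (ln N%:R) + 2 :> R.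
Proof.
elim: N => // N IH; rewrite leq_eqVlt => /orP[/eqP <-|N2].
  rewrite big_nat1; have l2 := ln2_ge R.
  have h1 : - ln (2 : R) <= ln (ln (2 : R)).
    by rewrite -lnV ?posrE// ler_ln ?posrE//; lra.
  have h2 : (2 * ln (2 : R))^-1 <= 1 by rewrite invf_le1; lra.
  have := ln2_le1 R; lra.
rewrite big_nat_recr//=; last by lia.
apply: le_trans (lerD (IH _) (lexx _)) _; first by lia.
rewrite addrAC lerD2r -lerBrDl.
have x2 : 2 <= N%:R :> R by rewrite ler_nat.
rewrite -natr1; move: (N%:R) x2 => x x2.
have lx : 2^-1 <= ln x by apply: le_trans (ln2_ge R) _; rewrite ler_ln ?posrE//; lra.
have d : (x + 1)^-1 <= ln (x + 1) - ln x by apply: ln_succ_ge; lra.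
have x0 : 0 < (x + 1)^-1 by rewrite invr_gt0; lra.
have y0 : 0 < ln (x + 1) by lra.
suff : ln (ln x) - ln (ln (x + 1)) <= - ((x + 1) * ln (x + 1))^-1 by lra.
rewrite -ln_div ?posrE; [|lra|lra].
have -> : ln x / ln (x + 1) = 1 + - ((ln (x + 1) - ln x) / ln (x + 1)) by field; lra.
apply: le_trans (_ : - ((ln (x + 1) - ln x) / ln (x + 1)) <= _).
  apply: le_ln1Dx; rewrite ltrNr opprK ltr_pdivrMr//; lra.
by rewrite lerN2 invfM ler_wpM2r// invr_ge0 ltW.
Qed.

(** Mertens' second theorem in the residue classes 1 and 3 modulo 4 (upper
    bound): Abel summation of [mertens4_bound] against [1 / ln]. *)
Lemma sum_inv_prime4 (R : realType) (a N : nat) : a = 1%N \/ a = 3%N -> (2 <= N)%N ->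
  \sum_(1 <= p < N.+1 | prime p && (p %% 4 == a)%N) p%:R^-1
   <= ln (ln N%:R) / 2 + 20 :> R.
Proof.
move=> ha N2; pose P p := prime p && (p %% 4 == a)%N.
pose u n : R := (if P n then ln n%:R / n%:R else 0) - n%:R^-1 / 2.
have P1 : P 1%N = false by [].
have split12 (F : nat -> R) m : \sum_(1 <= p < m | P p) F p =
    \sum_(2 <= p < m) (if P p then F p else 0).
  case: m => [|[|m]]; try by rewrite !big_geq.
  by rewrite big_ltn_cond//= big_mkcond.
have l2 := ln2_ge R; have lnp n : (2 <= n)%N -> 2^-1 <= ln n%:R :> R.
  move=> n2; apply: le_trans l2 _.
  by rewrite ler_ln ?posrE ?ltr0n ?ler_nat//; lia.
have hU m : `|\sum_(2 <= n < m) u n| <= 8.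
  case: m => [|m]; first by rewrite big_geq ?normr0.
  case: m => [|m]; first by rewrite big_geq ?normr0.
  rewrite sumrB -mulr_suml -(split12 (fun n => ln n%:R / n%:R)).
  have := harmonic_le R m.+1.
  have := harmonic_ge R m.+1; rewrite big_ltn//= invr1.
  have : ln (m.+1%:R : R) <= ln m.+2%:R by rewrite ler_ln ?posrE ?ltr0n ?ler_nat.
  have := mertens4_bound R m.+1 ha; rewrite /mertens4 -/P.
  set S := \sum_(_ <= _ < _ | _) _; set T := \sum_(_ <= _ < _) _.
  by rewrite !ler_norml => /andP[? ?] ? ? ?; apply/andP; split; lra.
have key : `|\sum_(2 <= n < N.+1) u n * (ln n%:R)^-1| <= 8 * (ln 2)^-1.
  apply: (@abel_bound R u (fun n => (ln n%:R)^-1)) => //.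
    by move=> n n2; rewrite invr_ge0 ln_nat_ge0.
  move=> n n2; have := lnp n n2; have := lnp n.+1 (ltnW n2) => *.
  rewrite lef_pV2 ?posrE; [|lra|lra].
  by rewrite ler_ln ?posrE ?ltr0n ?ler_nat//; lia.
have e : \sum_(1 <= p < N.+1 | P p) p%:R^-1 =
   \sum_(2 <= n < N.+1) u n * (ln n%:R)^-1 + (\sum_(2 <= n < N.+1) (n%:R * ln n%:R)^-1) / 2.
  rewrite split12 mulr_suml -big_split /=; apply: eq_big_nat => n /andP[n2 _].
  have l := lnp n n2; have n0 : 0 < n%:R :> R by rewrite ltr0n; lia.
  rewrite /u; set y := ln _ in l *; set x := n%:R in n0 *; clearbody y x.
  clear -l n0; by case: ifP => _; field; lra.
rewrite e; have := sum_inv_n_ln R N2.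
have : (ln (2 : R))^-1 <= 2 by rewrite -[leRHS]invrK lef_pV2 ?posrE//; lra.
move: key; rewrite ler_norml => /andP[_].
set S := \sum_(_ <= _ < _) _; set T := \sum_(_ <= _ < _) _; clear ha P1; lra.
Qed.

(** * Reciprocal sums over integers composed of given primes *)

Lemma ler_sum_subset (R : numDomainType) (T : eqType) (r s : seq T) (F : T -> R) :
  uniq r -> {subset r <= s} -> (forall x, x \in s -> 0 <= F x) ->
  \sum_(x <- r) F x <= \sum_(x <- s) F x.
Proof.
elim: r s => [|x r IH] s; first by move=> _ _ F0; rewrite big_nil big_seq sumr_ge0.
move=> /= /andP[xr ur] rs F0; have xs : x \in s by apply: rs; rewrite mem_head.
rewrite big_cons (perm_big _ (perm_to_rem xs)) big_cons lerD2l; apply: IH => // [y yr|y ys].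
  have yx : y != x by apply: contraNneq xr => <-.
  have : y \in s by apply: rs; rewrite in_cons yr orbT.
  by rewrite (perm_mem (perm_to_rem xs)) in_cons (negbTE yx).
by apply: F0; exact: mem_rem ys.
Qed.

(** The form in which all the double countings below are done: an injection
    of index sets that does not decrease the terms. *)
Lemma ler_sum_inj (R : numDomainType) (S T : eqType) (r : seq S) (s : seq T)
    (P : pred S) (Q : pred T) (h : S -> T) (G : S -> R) (F : T -> R) :
  uniq r -> {in [seq x <- r | P x] &, injective h} ->
  (forall x, x \in r -> P x -> [/\ h x \in s, Q (h x) & G x <= F (h x)]) ->
  (forall y, y \in s -> Q y -> 0 <= F y) ->
  \sum_(x <- r | P x) G x <= \sum_(y <- s | Q y) F y.
Proof.
move=> ur hi hP F0; rewrite -big_filter -[leRHS]big_filter.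
apply: le_trans (_ : \sum_(y <- [seq h x | x <- [seq x <- r | P x]]) F y <= _).
  rewrite big_map big_seq [leRHS]big_seq; apply: ler_sum => x.
  by rewrite mem_filter => /andP[Px xr]; case: (hP x xr Px).
apply: ler_sum_subset => [|y /mapP[x]|y].
- by rewrite map_inj_in_uniq ?filter_uniq.
- rewrite !mem_filter => /andP[Px xr] ->.
  by case: (hP x xr Px) => -> ->.
- by rewrite mem_filter => /andP[Qy ys]; exact: F0.
Qed.

Definition recip_sum (R : realType) (pi : nat_pred) (x : nat) : R :=
  \sum_(1 <= n < x.+1 | pi.-nat n) n%:R^-1.

Lemma recip_sum_ge0 (R : realType) (pi : nat_pred) (x : nat) :
  0 <= recip_sum R pi x.
Proof. by apply: sumr_ge0 => n _; rewrite invr_ge0. Qed.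

(** Same with a product of two sums on the right, for decompositions of each
    index into a pair. *)
Lemma ler_sum_inj2 (R : numDomainType) (S T U : eqType) (r : seq S) (s : seq T)
    (t : seq U) (P : pred S) (Q : pred T) (V : pred U) (h1 : S -> T) (h2 : S -> U)
    (G : S -> R) (F : T -> R) (E : U -> R) :
  uniq r ->
  {in [seq x <- r | P x] &, injective (fun x => (h1 x, h2 x))} ->
  (forall x, x \in r -> P x ->
     [/\ h1 x \in s, Q (h1 x), h2 x \in t, V (h2 x) & G x <= F (h1 x) * E (h2 x)]) ->
  (forall y, y \in s -> Q y -> 0 <= F y) ->
  (forall y, y \in t -> V y -> 0 <= E y) ->
  \sum_(x <- r | P x) G x <= (\sum_(y <- s | Q y) F y) * (\sum_(z <- t | V z) E z).
Proof.
move=> ur hi hP F0 E0.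
have -> : (\sum_(y <- s | Q y) F y) * (\sum_(z <- t | V z) E z) =
    \sum_(w <- [seq (y, z) | y <- [seq y <- s | Q y], z <- [seq z <- t | V z]])
       F w.1 * E w.2.
  rewrite big_allpairs -[\sum_(y <- s | Q y) _]big_filter mulr_suml.
  by apply: eq_bigr => y _; rewrite mulr_sumr -[LHS]big_filter.
apply: (@ler_sum_inj _ _ _ r _ P xpredT (fun x => (h1 x, h2 x))) => //.
- move=> x xr Px; case: (hP x xr Px) => a b c d e; split => //.
  by apply: allpairs_f; rewrite mem_filter ?a ?b ?c ?d.
- move=> w /allpairsP[[y z] /= [] ]; rewrite !mem_filter => /andP[? ?] /andP[? ?] -> _ /=.
  by apply: mulr_ge0; [exact: F0|exact: E0].
Qed.

(** Unique factorisation [n = n`_rho * n`_(negn rho)] makes a sum over [n]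
    submultiplicative. *)
Lemma recip_sum_mul (R : realType) (pi pi1 pi2 rho : nat_pred) (x : nat) :
  (forall n, pi.-nat n -> pi1.-nat (n`_rho)%N /\ pi2.-nat (n`_(negn rho))%N) ->
  recip_sum R pi x <= recip_sum R pi1 x * recip_sum R pi2 x.
Proof.
move=> h; apply: (@ler_sum_inj2 _ _ _ _ _ _ _ _ _ _ (fun n => (n`_rho)%N) (fun n => (n`_(negn rho))%N)).
- exact: iota_uniq.
- move=> m n; rewrite !mem_filter !mem_index_iota => /andP[_ /andP[m0 _]] /andP[_ /andP[n0 _]].
  by case=> e1 e2; rewrite -(partnC rho m0) -(partnC rho n0) e1 e2.
- move=> n; rewrite mem_index_iota ltnS => /andP[n0 nx] pn; have [h1 h2] := h n pn.
  rewrite !mem_index_iota !part_gt0 !ltnS h1 h2 !(leq_trans (dvdn_leq n0 (dvdn_part _ n)) nx)/=.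
  by split=> //; rewrite -{1}(partnC rho n0) natrM invfM.
- by move=> *; rewrite invr_ge0.
- by move=> *; rewrite invr_ge0.
Qed.

Lemma recip_sum_prime (R : realType) (p x : nat) : prime p ->
  recip_sum R p x <= expR ((p%:R - 1)^-1).
Proof.
move=> pp; have p1 : 1 < p%:R :> R by rewrite ltr1n prime_gt1.
have p0 : 0 < (p%:R : R)^-1 by rewrite invr_gt0; lra.
have p2 : (p%:R : R)^-1 < 1 by rewrite invf_lt1; lra.
apply: le_trans (_ : \sum_(0 <= v < x.+1) (p%:R : R)^-1 ^+ v <= _).
  apply: (@ler_sum_inj _ _ _ _ _ _ xpredT (logn p)).
  - exact: iota_uniq.
  - move=> m n; rewrite !mem_filter => /andP[pm _] /andP[pn _] e.
    by rewrite -(part_pnat_id pm) -(part_pnat_id pn) !p_part e.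
  - move=> n; rewrite mem_index_iota ltnS => /andP[n0 nx] pn; split=> //.
      rewrite mem_index_iota ltnS /=; apply: leq_trans nx; apply: ltnW.
      apply: leq_trans (dvdn_leq n0 (pfactor_dvdnn p n)).
      exact: ltn_expl (prime_gt1 pp).
    by rewrite -{1}(part_pnat_id pn) p_part natrX exprVn.
  - by move=> *; rewrite exprn_ge0// ltW.
apply: le_trans (_ : 1 + (p%:R - 1)^-1 <= _); last exact: expR_ge1Dx.
rewrite big_ltn// expr0 lerD2l; case: x => [|x].
  by rewrite big_geq// invr_ge0; lra.
rewrite big_ltn// expr1.
apply: le_trans (lerD (lexx _) (sum_geometric_tail _ _)) _; first by lra.
rewrite le_eqVlt; apply/orP; left; apply/eqP; field; lra.
Qed.

(** The Euler product bound: peel off one prime at a time. *)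
Lemma recip_sum_expR (R : realType) (pi : nat_pred) (x : nat) :
  recip_sum R pi x <=
  expR (\sum_(1 <= p < x.+1 | prime p && (p \in pi)) (p%:R - 1)^-1).
Proof.
pose piy y : nat_pred := [pred p | (p \in pi) && (p <= y)%N].
have key y : recip_sum R (piy y) x <=
    expR (\sum_(1 <= p < y.+1 | prime p && (p \in pi)) (p%:R - 1)^-1).
  elim: y => [|y IH].
    rewrite big_geq// expR0 /recip_sum; case: x => [|x]; first by rewrite big_geq ?ler01.
    rewrite big_ltn_cond//= [X in _ + X]big1_seq; first by rewrite invr1 addr0.
    move=> n; rewrite mem_index_iota => /andP[pn /andP[n1 _]]; exfalso.
    have /(pnatP _ (ltnW n1))/(_ _ (pdiv_prime n1) (pdiv_dvd n)) := pn.
    rewrite !inE leqn0 => /andP[_ /eqP h].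
    by have := pdiv_gt0 n; rewrite h.
  rewrite big_nat_recr_cond//=.
  have [/andP[pp pip]|npp] := boolP (prime y.+1 && (y.+1 \in pi)).
    rewrite expRD [leRHS]mulrC.
    apply: le_trans (@recip_sum_mul R _ y.+1 (piy y) y.+1 x _) _; last first.
      by apply: ler_pM; rewrite ?recip_sum_ge0 ?recip_sum_prime.
    move=> n pn; split; first exact: part_pnat.
    have n0 := part_gt0 (negn y.+1) n.
    apply/(pnatP _ n0) => q pq qd.
    have := part_pnat (negn y.+1) n => /(pnatP _ n0)/(_ q pq qd); rewrite !inE => qy.
    have qn : (q %| n)%N by apply: dvdn_trans qd (dvdn_part _ _).
    have ng : (0 < n)%N by case/andP: pn.
    have /(pnatP _ ng)/(_ q pq qn) := pn; rewrite !inE => /andP[-> /=].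
    by rewrite leq_eqVlt (negbTE qy) /= ltnS.
  rewrite addr0; apply: le_trans IH; rewrite le_eqVlt; apply/orP; left; apply/eqP.
  apply: eq_bigl => n; apply: eq_in_pnat => q qn; rewrite !inE.
  rewrite [(q <= y.+1)%N]leq_eqVlt ltnS; case: eqP => //= qy.
  case: (boolP (q \in pi)) => //= hq; move: npp.
  by rewrite -qy hq andbT; move: qn; rewrite mem_primes => /and3P[->].
apply: le_trans (key x); rewrite /recip_sum.
rewrite big_nat_cond [leRHS]big_nat_cond le_eqVlt; apply/orP; left; apply/eqP.
apply: eq_bigl => n; case: (boolP (1 <= n < x.+1)%N) => //= /andP[n0 nx].
apply: eq_in_pnat => q; rewrite mem_primes !inE => /and3P[_ _ /(dvdn_leq n0) qn].
by rewrite (leq_trans qn) ?andbT.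
Qed.

Lemma sum_inv_nn1 (R : realType) (N : nat) :
  \sum_(2 <= n < N) (n%:R * (n%:R - 1))^-1 <= 1 :> R.
Proof.
have h M : \sum_(2 <= n < M.+2) (n%:R * (n%:R - 1))^-1 = 1 - M.+1%:R^-1 :> R.
  elim: M => [|M IH]; first by rewrite big_geq// invr1 subrr.
  rewrite big_nat_recr//= IH -[M.+2%:R]natr1.
  have : 0 < M.+1%:R :> R by rewrite ltr0n.
  by move: (M.+1%:R) => x x0; field; lra.
case: N => [|[|N]]; try by rewrite big_geq// ler01.
by rewrite h gerBl invr_ge0.
Qed.

(** One of the two odd residue classes carries half of the sum of [1 / p], that is
    [ln (ln x) / 2], and the exponential of the Euler product bound turns this
    half into a square root.  The constant 22 exceeds the 20 of [sum_inv_prime4]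
    plus the prime 2 and the correction from [1 / p] to [1 / (p - 1)]. *)
Lemma recip_sum_le (R : realType) (pi : nat_pred) (a x : nat) :
  a = 1%N \/ a = 3%N -> (2 <= x)%N ->
  (forall p, prime p -> p \in pi -> p = 2 \/ (p %% 4 = a)%N) ->
  recip_sum R pi x <= expR 22 * Num.sqrt (ln x%:R).
Proof.
move=> ha x2 hpi; apply: le_trans (recip_sum_expR R pi x) _.
have lx : 0 < ln (x%:R : R) by rewrite ln_gt0// ltr1n.
have -> : Num.sqrt (ln x%:R) = expR (ln (ln x%:R) / 2) :> R.
  apply/eqP; rewrite -(@eqrXn2 _ 2)// ?sqrtr_ge0 ?expR_ge0// sqr_sqrtr ?ltW//.
  by rewrite -expRM_natl mulrC divfK// lnK ?posrE.
rewrite -expRD ler_expR.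
apply: le_trans (_ : 1 + (2^-1 + \sum_(1 <= p < x.+1 | prime p && (p %% 4 == a)%N) p%:R^-1) <= _); last first.
  have := sum_inv_prime4 R ha x2; clear ha hpi; lra.
have e2 : \sum_(1 <= p < x.+1 | (p == 2)%N) p%:R^-1 <= 2^-1 :> R.
  rewrite big_ltn_cond ?ltnS ?(ltnW x2)//= big_ltn_cond ?ltnS//=.
  rewrite [X in _ + X]big1_seq ?addr0// => p /=.
  by rewrite mem_index_iota; case: eqP => // ->.
have e1 : \sum_(1 <= p < x.+1 | prime p) (p%:R * (p%:R - 1))^-1 <= 1 :> R.
  apply: le_trans (sum_inv_nn1 R x.+1).
  rewrite big_ltn_cond ?ltnS ?(ltnW x2)//= big_mkcond; apply: ler_sum_nat => p /andP[p2 _].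
  by case: ifP => // _; rewrite invr_ge0 mulr_ge0// subr_ge0 ler1n; lia.
apply: le_trans (lerD e1 (lerD e2 (lexx _))).
rewrite [leLHS]big_mkcond [X in X + _]big_mkcond [X in _ + (_ + X)]big_mkcond.
rewrite [X in _ + (X + _)]big_mkcond -!big_split /=; apply: ler_sum => p _.
case: (boolP (prime p)) => //= pp; last by rewrite !addr0; case: ifP.
have p1 : 1 < p%:R :> R by rewrite ltr1n prime_gt1.
case: (boolP (p \in pi)) => hp; last first.
  rewrite addr_ge0//; last by rewrite addr_ge0//; case: ifP => // _; rewrite invr_ge0.
  by rewrite invr_ge0; nra.
have -> : (p%:R - 1)^-1 = (p%:R * (p%:R - 1))^-1 + p%:R^-1 :> R by clear -p1; field; lra.
rewrite lerD2l; case: (hpi p pp hp) => ->; last by rewrite eqxx lerDr; case: ifP => // _; rewrite invr_ge0.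
by rewrite eqxx lerDl; case: ifP => // _; rewrite invr_ge0.
Qed.

Definition residue4 (a : nat) : nat_pred := [pred p | (p %% 4 == a)%N].

Lemma residue4C (a p : nat) : a = 1%N \/ a = 3%N -> prime p ->
  p \in negn (residue4 a) -> p = 2 \/ (p %% 4 = 4 - a)%N.
Proof.
move=> ha /even_prime[->|o]; first by left.
by rewrite !inE => /eqP h; right; case: ha => aE; rewrite aE in h *; lia.
Qed.

(** The product of the two sums dominates the harmonic series, so an upper
    bound for one of them is a lower bound for the other. *)
Lemma recip_sum_ge (R : realType) (pi : nat_pred) (x : nat) :
  ln x.+1%:R <= recip_sum R pi x * recip_sum R (negn pi) x.
Proof.
apply: le_trans (harmonic_ge R x) _.
apply: le_trans (@recip_sum_mul R predT pi (negn pi) pi x _).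
  rewrite /recip_sum big_nat [leRHS]big_nat_cond le_eqVlt; apply/orP; left; apply/eqP.
  apply: eq_bigl => n; case: (boolP (1 <= n < x.+1)%N) => //= /andP[n0 _].
  by rewrite /pnat n0; apply/esym/allP.
by move=> n _; split; exact: part_pnat.
Qed.

Lemma recip_sum_residue4_ge (R : realType) (a x : nat) :
  a = 1%N \/ a = 3%N -> (2 <= x)%N ->
  Num.sqrt (ln x%:R) <= expR 22 * recip_sum R (residue4 a) x.
Proof.
move=> ha x2; have lx : 0 < ln (x%:R : R) by rewrite ln_gt0// ltr1n.
have s0 : 0 < Num.sqrt (ln (x%:R : R)) by rewrite sqrtr_gt0.
rewrite -(ler_pM2r s0) -expr2 sqr_sqrtr ?(ltW lx)//.
have h1 : ln (x%:R : R) <= ln x.+1%:R by rewrite ler_ln ?posrE ?ltr0n ?ler_nat//; lia.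
apply: le_trans h1 _; apply: le_trans (recip_sum_ge R (residue4 a) x) _.
rewrite mulrAC mulrC ler_wpM2r ?recip_sum_ge0//.
apply: (@recip_sum_le R _ (4 - a)%N) => //; first by case: ha => ->; [right|left].
by move=> p pp; exact: residue4C.
Qed.

(** * Counting integers composed of primes in one residue class *)

Lemma ler_sum_nat_cond (R : numDomainType) (a b : nat) (P : pred nat) (F G : nat -> R) :
  (forall i, (a <= i < b)%N -> P i -> F i <= G i) ->
  \sum_(a <= i < b | P i) F i <= \sum_(a <= i < b | P i) G i.
Proof.
by move=> h; rewrite big_nat_cond [leRHS]big_nat_cond; apply: ler_sum => i /andP[]; exact: h.
Qed.

Definition ncount (R : realType) (P : pred nat) (N : nat) : R :=
  \sum_(1 <= n < N.+1 | P n) 1.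

Lemma ncount_ge0 (R : realType) (P : pred nat) (N : nat) : 0 <= ncount R P N.
Proof. exact: sumr_ge0. Qed.

Lemma ncount_le (R : realType) (P : pred nat) (N : nat) : ncount R P N <= N%:R.
Proof.
rewrite /ncount big_mkcond; apply: le_trans (_ : \sum_(1 <= n < N.+1) (1 : R) <= _).
  by apply: ler_sum => n _; case: ifP.
by rewrite sumr_const_nat subn1.
Qed.

(** Dirichlet's hyperbola exchange: both sides are the sum of [F q] over the pairs
    [(q, m)] with [m * g q <= N]. *)
Lemma sum_hyperbola (R : realType) (T : Type) (N : nat) (s : seq T) (P : pred nat)
    (Q : pred T) (g : T -> nat) (F : T -> R) :
  (forall q, Q q -> (0 < g q)%N) ->
  \sum_(q <- s | Q q) F q * \sum_(1 <= m < (N %/ g q).+1 | P m) 1 =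
  \sum_(1 <= m < N.+1 | P m) \sum_(q <- s | Q q && (g q <= N %/ m)%N) F q.
Proof.
move=> g0.
transitivity (\sum_(q <- s | Q q) \sum_(1 <= m < N.+1 | P m)
   (if (g q <= N %/ m)%N then F q else 0)).
  apply: eq_bigr => q Qq.
  rewrite (@big_nat_widen _ _ _ _ _ N.+1) ?ltnS ?leq_div// mulr_sumr.
  rewrite big_nat_cond [RHS]big_nat_cond big_mkcondr /= [RHS]big_mkcond [LHS]big_mkcond.
  apply: eq_bigr => m _; case: (boolP (1 <= m < N.+1)%N) => //= /andP[m0 _].
  case: (P m) => //=; rewrite ltnS leq_divRL ?g0// leq_divRL// mulnC mulr1.
  by case: leqP.
rewrite exchange_big /=; apply: eq_bigr => m _.
by rewrite -big_mkcondr.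
Qed.

(** Chebyshev's function psi: [theta_le] for the primes, [sum_prime_powers] for
    the higher powers. *)
Lemma psi_le (R : realType) (N : nat) (x : nat) :
  \sum_(1 <= p < N.+1 | prime p) \sum_(1 <= k < N.+1 | (p ^ k <= x)%N) ln p%:R
   <= 4 * x%:R :> R.
Proof.
have [->|x0] := posnP x.
  rewrite mulr0 le_eqVlt big1 ?eqxx// => p pp; rewrite big1// => k.
  by rewrite leqn0 expn_eq0 -leqn0 leqNgt prime_gt0.
case: N => [|N]; first by rewrite big_geq// mulr_ge0.
apply: le_trans (_ : \sum_(1 <= p < x.+1 | prime p) ln p%:R +
   x%:R * \sum_(1 <= p < N.+2 | prime p) \sum_(2 <= k < N.+2) ln p%:R / p%:R ^+ k <= _); last first.
  have h : (0 : R) <= x%:R by [].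
  apply: le_trans (lerD (theta_le R x) (ler_wpM2l h (sum_prime_powers R _ _))) _.
  by move: (x%:R : R) h => y h; lra.
apply: le_trans (_ : \sum_(1 <= p < N.+2 | prime p && (p <= x)%N) ln p%:R +
   x%:R * \sum_(1 <= p < N.+2 | prime p) \sum_(2 <= k < N.+2) ln p%:R / p%:R ^+ k <= _).
  rewrite big_mkcondr mulr_sumr -big_split /=; apply: ler_sum => p pp.
  rewrite big_ltn_cond//= expn1; apply: le_trans (_ : (if (p <= x)%N then ln p%:R else 0) +
    \sum_(2 <= k < N.+2 | (p ^ k <= x)%N) (ln p%:R : R) <= _).
    by case: ifP => // _; rewrite add0r.
  apply: lerD => //; rewrite big_mkcond mulr_sumr; apply: ler_sum => k _.
  have pk0 : 0 < p%:R ^+ k :> R by rewrite exprn_gt0// ltr0n prime_gt0.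
  case: leqP => h; last by rewrite mulr_ge0 ?divr_ge0 ?ln_nat_ge0// ltW.
  rewrite mulrCA -[leLHS]mulr1 ler_wpM2l ?ln_nat_ge0// ler_pdivlMr// mul1r.
  by rewrite -natrX ler_nat.
rewrite lerD2r; apply: (@ler_sum_inj _ _ _ _ _ _ _ id); first exact: iota_uniq.
- by move=> a b _ _.
- move=> p; rewrite !mem_index_iota => /andP[-> _] /andP[-> px]; split=> //.
- by move=> *; exact: ln_nat_ge0.
Qed.

(** Expand [ln n] over prime powers and let [n = p ^ k * m]; the cofactor [m] is
    again composed of primes in [pi], and the sum over [p ^ k <= N / m] is at most
    [psi_le]. *)
Lemma sum_pnat_ln_le (R : realType) (pi : nat_pred) (N : nat) :
  \sum_(1 <= n < N.+1 | pi.-nat n) ln n%:R <= 4 * N%:R * recip_sum R pi N.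
Proof.
have -> : \sum_(1 <= n < N.+1 | pi.-nat n) ln n%:R =
    \sum_(1 <= n < N.+1) (pi.-nat n)%:R * ln n%:R :> R.
  by rewrite big_mkcond; apply: eq_bigr => n _; case: (pnat _ _); rewrite ?mul1r ?mul0r.
rewrite sum_mul_ln.
apply: le_trans (_ : \sum_(1 <= p < N.+1 | prime p) \sum_(1 <= k < N.+1)
     ln p%:R * \sum_(1 <= m < (N %/ p ^ k).+1 | pi.-nat m) 1 <= _).
  apply: ler_sum => p pp; apply: ler_sum => k _.
  apply: ler_wpM2l; rewrite ?ln_nat_ge0// [leRHS]big_mkcond; apply: ler_sum => m _.
  by rewrite pnatM; case: (pnat pi m); rewrite ?andbT ?andbF// lern1; case: (pnat _ _).
apply: le_trans (_ : \sum_(1 <= m < N.+1 | pi.-nat m) 4 * (N %/ m)%:R <= _); last first.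
  rewrite mulr_sumr; apply: ler_sum => m _; rewrite -mulrA.
  by apply: ler_wpM2l => //; exact: natr_divn_le.
under eq_bigr => p pp.
  rewrite (@sum_hyperbola R nat N (index_iota 1 N.+1) (pnat pi) xpredT (fun k => (p ^ k)%N)
     (fun=> ln p%:R)); last by move=> k _; rewrite expn_gt0 prime_gt0.
  over.
by rewrite exchange_big /=; apply: ler_sum => m _; exact: psi_le.
Qed.

(** [ln N - ln n] sums to at most [N] over [n <= N], so [ln n] may be replaced by
    [ln N]. *)
Lemma ncount_pnat_ln (R : realType) (pi : nat_pred) (N : nat) :
  ncount R (pnat pi) N * ln N%:R <= 4 * N%:R * recip_sum R pi N + N%:R.
Proof.
apply: le_trans (lerD (sum_pnat_ln_le R pi N) (lexx _)).
rewrite /ncount mulr_suml -lerBlDl -sumrB.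
apply: le_trans (_ : \sum_(1 <= n < N.+1) (ln N%:R - ln n%:R) <= _).
  rewrite big_mkcond; apply: ler_sum_nat => n /andP[n0 nN].
  have h : ln n%:R <= ln N%:R :> R by rewrite ler_ln ?posrE ?ltr0n ?ler_nat//; lia.
  by case: ifP; rewrite ?mul1r// subr_ge0.
rewrite sumrB sumr_const_nat subn1 /= -[ln _ *+ N]mulr_natl.
by have := sum_ln_ge R N; lra.
Qed.

(** The count times [ln N] is O(N) times the reciprocal sum, which is
    O([sqrt (ln N)]) for one residue class. *)
Lemma ncount_pnat_le (R : realType) (pi : nat_pred) (a N : nat) :
  a = 1%N \/ a = 3%N ->
  (forall p, prime p -> p \in pi -> p = 2 \/ (p %% 4 = a)%N) ->
  ncount R (pnat pi) N * Num.sqrt (ln N%:R) <= (4 * expR 22 + 2) * N%:R.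
Proof.
move=> ha hpi; have [N1|N2] := leqP N 1.
  have -> : ln (N%:R : R) = 0 by case: N N1 => [|[|//]] _; [rewrite ln0|rewrite ln1].
  by rewrite sqrtr0 mulr0 mulr_ge0// addr_ge0// mulr_ge0// expR_ge0.
have l2 : 2^-1 <= ln N%:R :> R.
  by apply: le_trans (ln2_ge R) _; rewrite ler_ln ?posrE ?ltr0n ?ler_nat//; lia.
have s0 : 0 < Num.sqrt (ln N%:R) :> R by rewrite sqrtr_gt0; lra.
have sE : Num.sqrt (ln N%:R) ^+ 2 = ln N%:R :> R by rewrite sqr_sqrtr//; lra.
have s2 : 2^-1 <= Num.sqrt (ln N%:R) :> R.
  by rewrite -(@ler_pXn2r _ 2)// ?nnegrE ?invr_ge0 ?(ltW s0)// sE; lra.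
have h1 := ncount_pnat_ln R pi N.
have h2 := @recip_sum_le R pi a N ha N2 hpi.
have n0 : 0 <= N%:R :> R by [].
rewrite -(ler_pM2r s0) -mulrA -expr2 sE; apply: le_trans h1 _.
have := ler_wpM2l n0 h2; move: s2; clear.
set s := Num.sqrt _; set e := expR _; set r := recip_sum _ _ _.
have n0 : 0 <= N%:R :> R by [].
by move: (N%:R : R) n0 => n n0 *; nra.
Qed.

Lemma mertens4_gap (R : realType) (y K : nat) : (0 < K <= y)%N ->
  ln K%:R / 2 - 14 <= mertens4 R 1 y - mertens4 R 1 (y %/ K).
Proof.
move=> /andP[K0 Ky].
have := mertens4_bound R y (or_introl erefl).
have := mertens4_bound R (y %/ K) (or_introl erefl).
rewrite !ler_norml => /andP[_ h1] /andP[h2 _].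
have k0 : 0 < K%:R :> R by rewrite ltr0n.
have y0 : 0 < (y %/ K)%:R :> R by rewrite ltr0n divn_gt0.
have yy : 0 < y%:R :> R by rewrite ltr0n; lia.
have : ln (y %/ K)%:R <= ln y%:R - ln K%:R :> R.
  by rewrite -ln_div ?posrE// ler_ln ?posrE ?divr_gt0// natr_divn_le.
by lra.
Qed.

(** Chebyshev's lower bound for the primes 1 mod 4: Mertens' estimate leaves a
    fixed mass in (y/K, y] once [K] is a large constant. *)
Lemma theta1_ge (R : realType) : exists2 K : nat, (0 < K)%N &
  forall y : nat, (K <= y)%N ->
  y%:R <= K%:R * \sum_(1 <= p < y.+1 | prime p && (p %% 4 == 1)%N) ln p%:R :> R.
Proof.
(* 60 makes half of ln K exceed the error 14 of mertens4_gap; it is kept abstract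
   to prevent the unfolding of 2 ^ 60 *)
have [k kE] : exists k, k = 60%N by exists 60%N.
have K0 : (0 < 2 ^ k)%N by rewrite expn_gt0.
exists (2 ^ k)%N => // y Ky; set K := (2 ^ k)%N in K0 Ky *.
have lK : 30 <= ln K%:R :> R.
  rewrite /K natrX lnXn// kE; have := ln2_ge R; rewrite -mulr_natr; lra.
have gap : 1 <= mertens4 R 1 y - mertens4 R 1 (y %/ K).
  by apply: le_trans (@mertens4_gap R y K _); [lra|rewrite K0].
have k0 : 0 < K%:R :> R by rewrite ltr0n.
have yy : 0 < y%:R :> R by rewrite ltr0n; lia.
rewrite -ler_pdivrMl// mulrC.
apply: le_trans (_ : (y%:R / K%:R) * (mertens4 R 1 y - mertens4 R 1 (y %/ K)) <= _).
  by rewrite -[leLHS]mulr1 ler_wpM2l// divr_ge0// ltW.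
have ydK : ((y %/ K).+1 <= y.+1)%N by rewrite ltnS leq_div.
rewrite /mertens4 (@big_cat_nat _ _ _ (y %/ K).+1 1 y.+1)//= addrAC subrr add0r.
rewrite [leRHS](@big_cat_nat _ _ _ (y %/ K).+1 1 y.+1)//= ler_wpDl//.
  by apply: sumr_ge0 => p _; exact: ln_nat_ge0.
rewrite mulr_sumr; apply: ler_sum_nat_cond => p /andP[py _] /andP[pp _].
have p0 : 0 < p%:R :> R by rewrite ltr0n prime_gt0.
rewrite mulrCA -[leRHS]mulr1 ler_wpM2l ?ln_nat_ge0// ler_pdivrMr// mul1r.
have := natr_divn_gt R y K0; have : (y %/ K).+1%:R <= p%:R :> R by rewrite ler_nat.
by rewrite -natr1; lra.
Qed.

(** Dual to the upper bound: the sum of [ln n] is at least the sum over [m] of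
    theta_1(N/m), restricted to [m <= N / K] where [theta1_ge] applies. *)
Lemma ncount_pnat_ge (R : realType) : exists2 c : R, 0 < c &
  exists N0 : nat, forall N, (N0 <= N)%N ->
  c * N%:R <= ncount R (pnat (residue4 1)) N * Num.sqrt (ln N%:R).
Proof.
have [K K0 hK] := theta1_ge R.
have k0 : 0 < K%:R :> R by rewrite ltr0n.
have e0 := expR_gt0 (22 : R).
exists ((8 * K%:R ^+ 2 * expR 22)^-1); first by rewrite invr_gt0 !mulr_gt0// exprn_gt0.
exists (4 * K * K + 4)%N => N NK.
set pi := residue4 1; have n0 : 0 < N%:R :> R by rewrite ltr0n; lia.
have l2 : 2^-1 <= ln N%:R :> R.
  by apply: le_trans (ln2_ge R) _; rewrite ler_ln ?posrE ?ltr0n ?ler_nat//; lia.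
have s0 : 0 < Num.sqrt (ln N%:R) :> R by rewrite sqrtr_gt0; lra.
have sE : Num.sqrt (ln N%:R) ^+ 2 = ln N%:R :> R by rewrite sqr_sqrtr//; lra.
set M := (N %/ K)%N.
have MN : (N <= M * M)%N by rewrite /M; nia.
have M2 : (2 <= M)%N by nia.
(* keep only n = m p with p a prime 1 mod 4 *)
have h1 : \sum_(1 <= m < N.+1 | pnat pi m) \sum_(1 <= p < N.+1 | (prime p && (p %% 4 == 1)%N) && (p <= N %/ m)%N) ln p%:R
   <= ncount R (pnat pi) N * ln N%:R.
  rewrite -(@sum_hyperbola R nat N (index_iota 1 N.+1) (pnat pi) (fun p => prime p && (p %% 4 == 1)%N) id); last first.
    by move=> p /andP[/prime_gt0].
  apply: le_trans (_ : \sum_(1 <= n < N.+1 | pi.-nat n) ln n%:R <= _); last first.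
    rewrite /ncount mulr_suml; apply: ler_sum_nat_cond => n /andP[n1 n2] _.
    by rewrite mul1r ler_ln ?posrE ?ltr0n ?ler_nat//; lia.
  have -> : \sum_(1 <= n < N.+1 | pi.-nat n) ln n%:R =
      \sum_(1 <= n < N.+1) (pi.-nat n)%:R * ln n%:R :> R.
    by rewrite big_mkcond; apply: eq_bigr => n _; case: (pnat _ _); rewrite ?mul1r ?mul0r.
  rewrite sum_mul_ln big_mkcondr /=; apply: ler_sum => p pp.
  case: ifP => hp; last by apply: sumr_ge0 => k _; rewrite mulr_ge0 ?ln_nat_ge0// sumr_ge0.
  rewrite big_ltn ?ltnS; last lia.
  rewrite expn1 ler_wpDr//.
    by apply: sumr_ge0 => k _; rewrite mulr_ge0 ?ln_nat_ge0// sumr_ge0.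
  rewrite ler_wpM2l ?ln_nat_ge0// [leLHS]big_mkcond; apply: ler_sum => m _.
  by case: ifP => // hm; rewrite pnatM hm pnatE// inE hp.
have h2 : N%:R / (2 * K%:R) * recip_sum R pi M <= ncount R (pnat pi) N * ln N%:R.
  apply: le_trans h1; rewrite /recip_sum mulr_sumr.
  have MN1 : (M.+1 <= N.+1)%N by rewrite ltnS leq_div.
  rewrite [leRHS](@big_cat_nat _ _ _ M.+1 1 N.+1)//= ler_wpDr//.
    by apply: sumr_ge0 => m _; apply: sumr_ge0 => p _; exact: ln_nat_ge0.
  apply: ler_sum_nat_cond => m /andP[m1 mM] _.
  have KNm : (K <= N %/ m)%N.
    by rewrite leq_divRL// mulnC -leq_divRL//.
  have m0 : 0 < m%:R :> R by rewrite ltr0n.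
  have := hK _ KNm; rewrite mulrC -ler_pdivrMr//; set A := \sum_(_ <= _ < _ | _) _ => hA.
  apply: le_trans (_ : A <= _).
    apply: le_trans hA; rewrite invfM mulrA mulrAC ler_wpM2r ?invr_ge0 ?(ltW k0)//.
    have := natr_divn_gt R N m1; have : 1 <= (N %/ m)%:R :> R by rewrite ler1n; lia.
    by rewrite [_ / 2 / _]mulrAC; move: (N%:R / m%:R) => x; lra.
  rewrite /A le_eqVlt; apply/orP; left; apply/eqP.
  rewrite -(@big_nat_widen _ _ _ 1 (N %/ m).+1 N.+1) ?ltnS ?leq_div//.
have h3 := @recip_sum_residue4_ge R 1 M (or_introl erefl) M2.
have h4 : Num.sqrt (ln N%:R) <= 2 * Num.sqrt (ln M%:R) :> R.
  have -> : 2 = Num.sqrt 4 :> R by rewrite (_ : 4 = 2 ^+ 2) ?sqrtr_sqr ?ger0_norm// -natrX.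
  rewrite -sqrtrM// ler_wsqrtr//.
  apply: le_trans (_ : ln (M%:R ^+ 2) <= _).
    by rewrite ler_ln ?posrE ?exprn_gt0 -?natrX ?ltr0n ?ler_nat//; lia.
  have m0 : 0 < M%:R :> R by rewrite ltr0n; lia.
  rewrite lnXn//; have := ln_nat_ge0 R M; lra.
rewrite -(ler_pM2r s0) -[leRHS]mulrA -expr2 sE; apply: le_trans h2.
apply: le_trans (_ : (8 * K%:R ^+ 2 * expR 22)^-1 * N%:R * (2 * (expR 22 * recip_sum R pi M)) <= _).
  by rewrite ler_wpM2l//; apply: le_trans h4 _; rewrite ler_wpM2l.
have -> : (8 * K%:R ^+ 2 * expR 22)^-1 * N%:R * (2 * (expR 22 * recip_sum R pi M)) =
   (2 * K%:R)^-1 * (N%:R / (2 * K%:R) * recip_sum R pi M) by field; lra.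
rewrite -[leRHS]mul1r ler_wpM2r ?mulr_ge0 ?invr_ge0 ?mulr_ge0 ?recip_sum_ge0 ?(ltW k0) ?(ltW n0)//.
have : 1 <= K%:R :> R by rewrite ler1n.
by move=> k1; rewrite invf_le1 ?mulr_gt0//; lra.
Qed.

(** * Sums of two squares *)

Lemma Fp_fermat (p : nat) (x : 'F_p) : prime p -> x != 0 -> x ^+ p.-1 = 1.
Proof.
move=> pp x0; apply: (mulfI x0); rewrite -exprS prednK ?prime_gt0// mulr1.
rewrite -(natr_Zp x) -natrX -(Fp_nat_mod pp (x ^ p)) fermat_little//.
by rewrite (Fp_nat_mod pp).
Qed.

(** Otherwise [-1] would be a square modulo [p], against Fermat's little
    theorem since [(p - 1) / 2] is odd. *)
Lemma prime3_dvd_sum_squares (p a b : nat) : prime p -> (p %% 4 = 3)%N ->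
  (p %| a ^ 2 + b ^ 2)%N -> (p %| a)%N.
Proof.
move=> pp p3 h; apply/negPn/negP => na.
have ch := pchar_Fp pp.
have nb : ~~ (p %| b)%N.
  apply: contra na => pb; move: h; rewrite dvdn_addl; last by rewrite dvdn_exp.
  by rewrite Euclid_dvdX// => /andP[].
pose x : 'F_p := a%:R; pose y : 'F_p := b%:R.
have x0 : x != 0 by rewrite -(dvdn_pcharf ch).
have y0 : y != 0 by rewrite -(dvdn_pcharf ch).
have e : x ^+ 2 = - y ^+ 2.
  apply/eqP; rewrite -addr_eq0 -!natrX -natrD -(dvdn_pcharf ch)//.
have pE : p.-1 = (2 * (p %/ 4).*2.+1)%N by lia.
have := Fp_fermat pp x0; rewrite pE exprM e exprNn -exprM -pE Fp_fermat// mulr1.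
rewrite -signr_odd /= odd_double /= expr1 => /eqP; rewrite eq_sym -addr_eq0 -(natrD _ 1 1).
rewrite -(dvdn_pcharf ch) => /dvdn_leq -/(_ isT) p2.
by have := prime_gt1 pp; lia.
Qed.

(** Divide out the primes 3 mod 4, which divide both squares; only their even
    powers occur. *)
Lemma sum_squares_decomp (n : nat) : sums_two_squares n ->
  exists k u, [/\ (0 < k)%N, (0 < u)%N, n = (k ^ 2 * u)%N & (negn (residue4 3)).-nat u].
Proof.
elim/ltn_ind: n => n IH [n0 [a [b nE]]].
have [pn|] := boolP ((negn (residue4 3)).-nat n).
  by exists 1%N, n; rewrite exp1n mul1n.
move=> npn; have [p /and3P[pp pn p3]] : exists p, [&& prime p, (p %| n)%N & (p %% 4 == 3)%N].
  apply/not_existsP => h; move/negP: npn; apply; apply/(pnatP _ n0) => p pp pn.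
  rewrite !inE; apply/negP => p3; apply: (h p); by rewrite pp pn p3.
have pa : (p %| a)%N by apply: (@prime3_dvd_sum_squares p a b) => //; [exact/eqP|rewrite -nE].
have pb : (p %| b)%N by apply: (@prime3_dvd_sum_squares p b a) => //; [exact/eqP|rewrite addnC -nE].
move: pa pb nE => /dvdnP[a' ->] /dvdnP[b' ->] nE.
have nE' : n = (p ^ 2 * (a' ^ 2 + b' ^ 2))%N by rewrite nE !expnMn; lia.
have p1 := prime_gt1 pp.
have s0 : (0 < a' ^ 2 + b' ^ 2)%N by move: n0; rewrite nE' muln_gt0 => /andP[].
have sn : (a' ^ 2 + b' ^ 2 < n)%N by rewrite nE' ltn_Pmull// -(exp1n 2) ltn_exp2r.
have [k [u [k0 u0 sE pu]]] := IH _ sn (conj s0 (ex_intro _ a' (ex_intro _ b' erefl))).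
exists (p * k)%N, u; split => //; first by rewrite muln_gt0 prime_gt0.
by rewrite nE' sE expnMn mulnA.
Qed.

Lemma brahmagupta (a b c d : nat) : exists k l : nat,
  ((a ^ 2 + b ^ 2) * (c ^ 2 + d ^ 2) = k ^ 2 + l ^ 2)%N.
Proof.
exists (a * c + b * d)%N; case: (leqP (b * c) (a * d)) => [|/ltnW] h.
- exists (a * d - b * c)%N; set e := (_ - _)%N.
  have eE : (a * d = e + b * c)%N by rewrite /e subnK.
  have -> : ((a ^ 2 + b ^ 2) * (c ^ 2 + d ^ 2) =
      (a * c) ^ 2 + (b * d) ^ 2 + ((a * d) ^ 2 + (b * c) ^ 2))%N by ring.
  have -> : ((a * c + b * d) ^ 2 = (a * c) ^ 2 + (b * d) ^ 2 + 2 * (a * d) * (b * c))%N by ring.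
  by rewrite eE; ring.
- exists (b * c - a * d)%N; set e := (_ - _)%N.
  have eE : (b * c = e + a * d)%N by rewrite /e subnK.
  have -> : ((a ^ 2 + b ^ 2) * (c ^ 2 + d ^ 2) =
      (a * c) ^ 2 + (b * d) ^ 2 + ((a * d) ^ 2 + (b * c) ^ 2))%N by ring.
  have -> : ((a * c + b * d) ^ 2 = (a * c) ^ 2 + (b * d) ^ 2 + 2 * (a * d) * (b * c))%N by ring.
  by rewrite eE; ring.
Qed.

Lemma sums_two_squaresM (m n : nat) :
  sums_two_squares m -> sums_two_squares n -> sums_two_squares (m * n)%N.
Proof.
case=> m0 [a [b mE]] [n0 [c [d nE]]]; split; first by rewrite muln_gt0 m0.
by rewrite mE nE; exact: brahmagupta.
Qed.

(** Some unit has [x ^ ((p - 1) / 2)] different from 1, as this polynomial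
    equation has too few roots; then [x ^ ((p - 1) / 4)] is the root. *)
Lemma exists_sqrtN1 (p : nat) : prime p -> (p %% 4 = 1)%N ->
  exists y : 'F_p, y ^+ 2 = -1.
Proof.
move=> pp p1; have p2 := prime_gt1 pp.
pose h := (p %/ 2)%N; pose q : {poly 'F_p} := ('X^h - 1)%R.
have hE : p = (h * 2).+1 by rewrite /h; lia.
have h0 : (0 < h)%N by rewrite /h; lia.
have sq : size q = h.+1 by rewrite size_XnsubC.
have [x /andP[x0 xh]] : exists x : 'F_p, (x != 0) && (x ^+ h != 1).
  apply/existsP; apply: contraT; rewrite negb_exists => /forallP H.
  have := @max_poly_roots _ q (enum [pred x : 'F_p | x != 0]).
  rewrite -size_poly_eq0 sq => /(_ isT).
  have -> : all (root q) (enum [pred x : 'F_p | x != 0]).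
    apply/allP => x; rewrite mem_enum inE => x0.
    have := H x; rewrite x0 /= negbK => /eqP xh.
    by rewrite /root /q !hornerE xh subrr.
  move=> /(_ isT (enum_uniq _)); rewrite -cardE.
  have -> : #|[pred x : 'F_p | x != 0]| = p.-1.
    transitivity #|predC1 (0 : 'F_p)|; last by rewrite cardC1 card_Fp.
    by apply: eq_card => x; rewrite !inE.
  by lia.
exists (x ^+ (h %/ 2)%N); rewrite -exprM.
have -> : (h %/ 2 * 2)%N = h by rewrite /h; lia.
have : (x ^+ h) ^+ 2 == 1.
  by rewrite -exprM (_ : (h * 2)%N = p.-1) ?Fp_fermat// hE.
by rewrite sqrf_eq1 (negbTE xh) /= => /eqP.
Qed.

Lemma exists_isqrt (n : nat) : exists s, (s ^ 2 <= n < s.+1 ^ 2)%N.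
Proof.
elim: n => [|n [s /andP[h1 h2]]]; first by exists 0%N.
case: (leqP (s.+1 ^ 2) n.+1) => h; last by exists s; rewrite h (leq_trans h1).
exists s.+1; rewrite h; apply: leq_ltn_trans (_ : s.+1 ^ 2 < _)%N => //.
by rewrite ltn_exp2r.
Qed.

(** Thue's pigeonhole argument: with [y ^ 2 = -1] two of the more than [p]
    values [u - y v], [u, v <= sqrt p], coincide, and the difference of the
    two pairs gives a representation. *)
Lemma prime1_sum_squares (p : nat) : prime p -> (p %% 4 = 1)%N -> sums_two_squares p.
Proof.
move=> pp p1; have [y y2] := exists_sqrtN1 pp p1.
have [s /andP[s1 s2]] := exists_isqrt p.
have sp : (s ^ 2 < p)%N.
  rewrite ltn_neqAle s1 andbT; apply/eqP => sE.
  have : (p %| s ^ 2)%N by rewrite sE.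
  rewrite Euclid_dvdX// => /andP[ps _].
  have := prime_gt1 pp; have [s0|s0] := posnP s; first by rewrite s0 in sE; lia.
  by have := dvdn_leq s0 ps; nia.
pose f (w : 'I_s.+1 * 'I_s.+1) : 'F_p := (w.1 : nat)%:R - y * (w.2 : nat)%:R.
have : ~~ injectiveb f.
  apply/negP => /injectiveP /leq_card.
  by rewrite card_Fp// card_prod !card_ord leqNgt -[(_ * _)%N]/(s.+1 ^ 2)%N s2.
move=> /injectivePn[[u v] [[u' v'] uv fE]].
have ch := pchar_Fp pp.
pose d (i j : nat) : nat := ((i - j) + (j - i))%N.
have dE (i j : nat) : ((d i j)%:R : 'F_p) ^+ 2 = (i%:R - j%:R) ^+ 2.
  rewrite /d; case: (leqP i j) => h.
    by rewrite (eqP (_ : (i - j == 0)%N)) ?subn_eq0// add0n natrB// sqrrB sqrrB; ring.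
  by rewrite (eqP (_ : (j - i == 0)%N)) ?subn_eq0 ?(ltnW h)// addn0 natrB// ltnW.
pose a := d u u'; pose b := d v v'.
have ab : (p %| a ^ 2 + b ^ 2)%N.
  rewrite (dvdn_pcharf ch) natrD !natrX !dE.
  have e : (u : nat)%:R - (u' : nat)%:R = y * ((v : nat)%:R - (v' : nat)%:R) :> 'F_p.
    by apply/eqP; rewrite -subr_eq0; apply/eqP; move: fE; rewrite /f /= => /eqP;
       rewrite -subr_eq0 => /eqP <-; ring.
  by rewrite e exprMn y2 mulN1r addNr.
have us := ltn_ord u; have us' := ltn_ord u'; have vs := ltn_ord v; have vs' := ltn_ord v'.
have as_ : (a <= s)%N by rewrite /a /d; lia.
have bs_ : (b <= s)%N by rewrite /b /d; lia.
have ab0 : (0 < a ^ 2 + b ^ 2)%N.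
  rewrite addn_gt0 !expn_gt0 !orbF; apply: contraT; rewrite negb_or -!eqn0Ngt => /andP[/eqP a0 /eqP b0].
  move/eqP: uv; case; congr (_, _); apply: val_inj => /=; [move: a0; rewrite /a|move: b0; rewrite /b]; rewrite /d; lia.
have ab2 : (a ^ 2 + b ^ 2 < 2 * p)%N.
  by rewrite mul2n -addnn -addSn; apply: leq_add; [apply: leq_ltn_trans sp|apply: ltnW; apply: leq_ltn_trans sp]; rewrite leq_exp2r.
split; first exact: prime_gt0.
exists a, b; move/dvdnP: ab => [q qE]; rewrite qE in ab0 ab2 *.
have -> : q = 1%N by nia.
by rewrite mul1n.
Qed.

Lemma pnat_sums_two_squares (n : nat) : (residue4 1).-nat n -> sums_two_squares n.
Proof.
elim/ltn_ind: n => n IH pn; have n0 : (0 < n)%N by case/andP: pn.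
have [n1|n1] := leqP n 1; first by split=> //; exists 1%N, 0%N; lia.
have pp := pdiv_prime n1; have pd := pdiv_dvd n.
have p4 : (pdiv n %% 4 = 1)%N by have /(pnatP _ n0)/(_ _ pp pd) := pn; rewrite inE => /eqP.
rewrite -(divnK pd); apply: sums_two_squaresM; last exact: prime1_sum_squares.
apply: IH; first by rewrite ltn_Pdiv// prime_gt1.
by apply: pnat_dvd pn; rewrite dvdn_div.
Qed.

Lemma sum_ln1_div_sqr (R : realType) (N : nat) :
  \sum_(1 <= k < N) (1 + ln k%:R) / k%:R ^+ 2 <= 4 :> R.
Proof.
case: N => [|[|N]]; try by rewrite big_geq.
rewrite big_ltn// ln1 addr0 expr1n divr1.
apply: le_trans (_ : 1 + (\sum_(2 <= k < N.+2) (k%:R * (k%:R - 1))^-1 +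
    \sum_(2 <= k < N.+2) ln k%:R / (k%:R * (k%:R - 1))) <= _); last first.
  have := sum_inv_nn1 R N.+2; have := sum_ln_div_sqr R N.+2.
  by move: (\sum_(_ <= _ < _) _) => a; move: (\sum_(_ <= _ < _) _) => b; lra.
rewrite lerD2l -big_split /=; apply: ler_sum_nat => k /andP[k2 _].
have k1 : 1 < k%:R :> R by rewrite ltr1n.
have -> : (k%:R * (k%:R - 1))^-1 + ln k%:R / (k%:R * (k%:R - 1)) =
    (1 + ln k%:R) / (k%:R * (k%:R - 1)) :> R by rewrite [RHS]mulrDl mul1r.
rewrite ler_wpM2l ?addr_ge0 ?ln_nat_ge0//.
by rewrite lef_pV2 ?posrE ?exprn_gt0 ?mulr_gt0//; nra.
Qed.

(** Write the sums of two squares as [k ^ 2 * u] with [u] free of primes 3 mod 4;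
    for [k ^ 4 <= N] the cofactors are counted by [ncount_pnat_le], and larger [k]
    trivially. *)
Lemma ncount_sums_two_squares_le (R : realType) : exists2 C : R, 0 < C &
  forall N, (16 <= N)%N ->
  ncount R (fun n => `[< sums_two_squares n >]) N * Num.sqrt (ln N%:R) <= C * N%:R.
Proof.
pose C := 4 * expR 22 + 2 : R; have C0 : 2 <= C by have := expR_gt0 (22 : R); rewrite /C; lra.
exists (4 * (2 * C)) => [|N N16]; first lra.
have N0 : (0 < N)%N by exact: leq_trans N16.
pose U := pnat (negn (residue4 3)).
have U3 p : prime p -> p \in negn (residue4 3) -> p = 2 \/ (p %% 4 = 1)%N.
  by move=> pp hp; apply: (@residue4C 3 p) => //; right.
have h1 : ncount R (fun n => `[< sums_two_squares n >]) N <=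
    \sum_(1 <= k < N.+1) ncount R U (N %/ k ^ 2).
  pose s := [seq (k, u) | k <- index_iota 1 N.+1, u <- [seq u <- index_iota 1 (N %/ k ^ 2).+1 | U u]].
  have -> : \sum_(1 <= k < N.+1) ncount R U (N %/ k ^ 2) = \sum_(w <- s) 1.
    by rewrite big_allpairs_dep; apply: eq_bigr => k _; rewrite /ncount big_filter.
  have /choice[g gP] : forall n, exists w : nat * nat, sums_two_squares n ->
      [/\ (0 < w.1)%N, (0 < w.2)%N, n = (w.1 ^ 2 * w.2)%N & U w.2].
    move=> n; have [/sum_squares_decomp [k [u h]]|h] := pselect (sums_two_squares n).
      by exists (k, u).
    by exists (0, 0)%N.
  apply: (@ler_sum_inj _ _ _ _ _ _ xpredT g) => //; first exact: iota_uniq.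
    move=> m n; rewrite !mem_filter => /andP[/asboolP hm _] /andP[/asboolP hn _] e.
    by case: (gP m hm) => _ _ -> _; case: (gP n hn) => _ _ -> _; rewrite e.
  move=> n; rewrite mem_index_iota ltnS => /andP[n0 nN] /asboolP hn; split=> //.
  case: (gP n hn) => k0 u0 nE hu; rewrite [g n]surjective_pairing.
  have k20 : (0 < (g n).1 ^ 2)%N by rewrite expn_gt0 k0.
  apply: allpairs_f_dep.
    rewrite mem_index_iota k0 ltnS; apply: leq_trans nN.
    by rewrite [leqRHS]nE; apply: leq_trans (leq_pmulr _ u0); rewrite expnS expn1 leq_pmulr.
  by rewrite mem_filter hu mem_index_iota u0 ltnS leq_divRL// mulnC -nE.
have s0 : 0 <= Num.sqrt (ln N%:R) :> R by exact: sqrtr_ge0.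
apply: le_trans (ler_wpM2r s0 h1) _; rewrite mulr_suml.
have key k : (0 < k)%N -> ncount R U (N %/ k ^ 2) * Num.sqrt (ln N%:R) <=
    2 * C * N%:R * ((1 + ln k%:R) / k%:R ^+ 2).
  move=> k0; have kk : 1 <= k%:R :> R by rewrite ler1n.
  have k2 : 0 < k%:R ^+ 2 :> R by rewrite exprn_gt0//; lra.
  have lk := ln_nat_ge0 R k; have n0 : 0 <= N%:R :> R by [].
  set M := (N %/ k ^ 2)%N.
  have ME : M%:R <= N%:R / k%:R ^+ 2 :> R by rewrite -natrX; exact: natr_divn_le.
  have [kN|kN] := leqP (k ^ 4) N.
    have M1 : (N < M.+1 ^ 2)%N.
      have : (N < M.+1 * k ^ 2)%N by rewrite -ltn_divLR ?expn_gt0 ?k0.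
      have : (k ^ 2 <= M)%N by rewrite leq_divRL ?expn_gt0 ?k0// -expnD.
      by rewrite (expnS _ 1) expn1; nia.
    have M4 : (4 <= M)%N by rewrite -ltnS -(@ltn_exp2r _ _ 2)//; apply: leq_ltn_trans M1.
    have h4 : Num.sqrt (ln N%:R) <= 2 * Num.sqrt (ln M%:R) :> R.
      have -> : 2 = Num.sqrt 4 :> R by rewrite (_ : 4 = 2 ^+ 2) ?sqrtr_sqr ?ger0_norm// -natrX.
      rewrite -sqrtrM// ler_wsqrtr//.
      have M0 : (0 < M)%N by lia.
      have m0 : 0 < M%:R :> R by rewrite ltr0n.
      have -> : 4 * ln M%:R = ln (M%:R ^+ 4) :> R by rewrite lnXn// mulr_natl.
      rewrite ler_ln ?posrE ?exprn_gt0 ?ltr0n//.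
      by rewrite -natrX ler_nat (expnM _ 2 2); nia.
    have := @ncount_pnat_le R (negn (residue4 3)) 1 M (or_introl erefl) U3; rewrite -/C -/U => h5.
    apply: le_trans (ler_wpM2l (ncount_ge0 R U M) h4) _.
    apply: le_trans (_ : 2 * (C * M%:R) <= _); first by rewrite mulrCA ler_wpM2l.
    rewrite -!mulrA ler_wpM2l// ler_wpM2l//; first lra.
    apply: le_trans ME _; rewrite ler_wpM2l// -[leLHS]mul1r ler_wpM2r ?invr_ge0 ?(ltW k2)//; lra.
  have h4 : Num.sqrt (ln N%:R) <= 2 * (1 + ln k%:R) :> R.
    rewrite -(@ler_pXn2r _ 2)// ?nnegrE; last by lra.
    rewrite sqr_sqrtr ?ln_nat_ge0//; apply: le_trans (_ : ln (k%:R ^+ 4) <= _).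
      rewrite ler_ln ?posrE ?exprn_gt0 ?ltr0n//.
      by rewrite -natrX ler_nat ltnW.
    by rewrite lnXn ?ltr0n// -mulr_natl; nra.
  apply: le_trans (_ : (N%:R / k%:R ^+ 2) * (2 * (1 + ln k%:R)) <= _).
    by apply: ler_pM => //; [exact: ncount_ge0|apply: le_trans ME; exact: ncount_le].
  have -> : 2 * C * N%:R * ((1 + ln k%:R) / k%:R ^+ 2) = C * (N%:R / k%:R ^+ 2 * (2 * (1 + ln k%:R))) by ring.
  rewrite -[leLHS]mul1r ler_wpM2r ?mulr_ge0 ?invr_ge0 ?(ltW k2)//; lra.
apply: le_trans (_ : \sum_(1 <= k < N.+1) 2 * C * N%:R * ((1 + ln k%:R) / k%:R ^+ 2) <= _).
  by apply: ler_sum_nat => k /andP[k0 _]; exact: key.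
rewrite -mulr_sumr; apply: le_trans (ler_wpM2l _ (sum_ln1_div_sqr R N.+1)) _.
  by rewrite mulr_ge0//; lra.
by rewrite le_eqVlt; apply/orP; left; apply/eqP; ring.
Qed.

(** * Selberg's sieve *)

Lemma prod_1D_subsets (R : comPzRingType) (T : finType) (K : {set T}) (f : T -> R) :
  \prod_(t in K) (1 + f t) = \sum_(L : {set T} | L \subset K) \prod_(t in L) f t.
Proof.
rewrite big_mkcond /=.
transitivity (\prod_t ((if t \in K then f t else 0) + 1)).
  by apply: eq_bigr => t _; case: ifP; rewrite ?add0r// addrC.
rewrite bigA_distr [RHS]big_mkcond; apply: eq_bigr => L _.
case: ifPn => [/fintype.subsetP LK|/fintype.subsetPn[t tL tK]].
  rewrite [RHS]big_mkcond; apply: eq_bigr => t _.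
  by case: ifPn => // tL; rewrite LK.
by rewrite (bigD1 t)//= tL (negbTE tK) mul0r.
Qed.

(** Moebius inversion on the lattice of subsets. *)
Lemma sum_alternating (R : comPzRingType) (T : finType) (L M : {set T}) :
  \sum_(A : {set T} | (L \subset A) && (A \subset M)) (-1) ^+ #|A| =
  if L == M then (-1) ^+ #|L| else 0 :> R.
Proof.
pose F t : R := if t \in M then -1 else 0.
pose G t : R := if t \in L then 0 else 1.
have e : \sum_(A : {set T} | (L \subset A) && (A \subset M)) (-1) ^+ #|A| =
    \prod_t (F t + G t).
  rewrite bigA_distr big_mkcond /=; apply: eq_bigr => A _.
  case: ifPn => [/andP[/fintype.subsetP LA /fintype.subsetP AM]|].
    rewrite -[LHS]prodr_const big_mkcond; apply: eq_bigr => t _.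
    rewrite /F /G; case: ifPn => tA; first by rewrite AM.
    by case: ifPn => // tL; rewrite LA in tA.
  rewrite negb_and => /orP[] /fintype.subsetPn[t t1 t2].
    by rewrite (bigD1 t)//= (negbTE t2) /G t1 mul0r.
  by rewrite (bigD1 t)//= t1 /F (negbTE t2) mul0r.
rewrite e; case: eqP => [LM|/eqP LM].
  rewrite -[RHS]prodr_const [RHS]big_mkcond; apply: eq_bigr => t _.
  by rewrite /F /G LM; case: ifP; rewrite ?addr0 ?add0r.
have [t tLM] : exists t, (t \in L) != (t \in M).
  by apply/existsP; apply: contraNT LM => /existsPn h; apply/eqP/finset.setP => t; have := h t; rewrite negbK => /eqP.
rewrite (bigD1 t)//= /F /G; move: tLM.
by case: (t \in L); case: (t \in M) => // _; rewrite ?addr0 ?addNr mul0r.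
Qed.

Lemma prod_setU_setI (R : comPzRingType) (T : finType) (A B : {set T}) (f : T -> R) :
  (\prod_(t in A :|: B) f t) * (\prod_(t in A :&: B) f t) =
  (\prod_(t in A) f t) * \prod_(t in B) f t.
Proof.
rewrite [X in X * _]big_mkcond [X in _ * X]big_mkcond [X in _ = X * _]big_mkcond.
rewrite [X in _ = _ * X]big_mkcond -!big_split /=; apply: eq_bigr => t _.
by rewrite !inE; case: (t \in A); case: (t \in B); rewrite /= ?mulr1 ?mul1r.
Qed.

(** Selberg's upper bound sieve, over an arbitrary finite family of events [t] of
    density [g t], restricted to the downward closed family [F] of combinations
    for which the remainder is under control.  The indicator of an unsieved [n] is
    at most the square of a weighted sum [lam] over [A \subset bad n] with
    [lam set0 = 1]; the weights are those which minimise the main term, a quadratic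
    form that becomes diagonal in the sums of [lam] over supersets, and the minimum
    is [1 / G]. *)
Lemma selberg_sieve (R : realFieldType) (I : eqType) (T : finType) (r : seq I)
    (bad : I -> {set T}) (F : pred {set T}) (g : T -> R) (X : R) (rho : {set T} -> R) :
  (forall t, 0 < g t < 1) ->
  F finset.set0 ->
  (forall A B : {set T}, A \subset B -> F B -> F A) ->
  (forall A : {set T}, `|\sum_(n <- r | A \subset bad n) 1 - X * \prod_(t in A) g t| <= rho A) ->
  \sum_(n <- r | bad n == finset.set0) 1 <=
   X / (\sum_(A : {set T} | F A) \prod_(t in A) (g t / (1 - g t))) +
   \sum_(A : {set T} | F A) \sum_(B : {set T} | F B)
     (\prod_(t in A) g t)^-1 * (\prod_(t in B) g t)^-1 * rho (A :|: B).
Proof.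
move=> g01 F0 Fdown hrho.
pose h t := g t / (1 - g t).
pose gS (A : {set T}) := \prod_(t in A) g t.
pose hS (A : {set T}) := \prod_(t in A) h t.
have gS0 A : 0 < gS A by apply: prodr_gt0 => t _; case/andP: (g01 t).
have h0 t : 0 < h t.
  by case/andP: (g01 t) => t0 t1; rewrite divr_gt0// subr_gt0.
have hS0 A : 0 < hS A by apply: prodr_gt0.
pose G := \sum_(A : {set T} | F A) hS A.
have G0 : 0 < G.
  rewrite /G (bigD1 finset.set0)//=; apply: ltr_wpDr; last exact: hS0.
  by apply: sumr_ge0 => A _; exact: ltW.
(* Selberg's weights *)
pose lam (A : {set T}) := (-1) ^+ #|A| / (gS A * G) * \sum_(L : {set T} | F L && (A \subset L)) hS L.
have lam0 : lam finset.set0 = 1.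
  rewrite /lam cards0 expr0 /gS big_set0 mul1r mul1r.
  rewrite (eq_bigl F) => [|L]; last by rewrite finset.sub0set andbT.
  by rewrite mulVf// gt_eqF.
have lamF A : ~~ F A -> lam A = 0.
  move=> nF; rewrite /lam big1 ?mulr0// => L /andP[FL AL].
  by rewrite (Fdown _ _ AL FL) in nF.
have lam_le A : `|lam A| <= (gS A)^-1.
  rewrite /lam normrM normrM normrX normrN1 expr1n mul1r.
  rewrite [`|(gS A * G)^-1|]ger0_norm ?invr_ge0 ?mulr_ge0 ?(ltW (gS0 A)) ?(ltW G0)//.
  have s0 : 0 <= \sum_(L : {set T} | F L && (A \subset L)) hS L by apply: sumr_ge0 => L _; exact: ltW.
  rewrite ger0_norm// invfM -mulrA ler_piMr ?invr_ge0 ?(ltW (gS0 A))// ler_pdivrMl// mulr1.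
  rewrite /G [leRHS](bigID (fun L : {set T} => A \subset L)) /= ler_wpDr//.
  by apply: sumr_ge0 => L _; exact: ltW.
(* the sums of lam over supersets diagonalise the quadratic form *)
have lamg A : lam A * gS A = \sum_(M : {set T} | F M && (A \subset M)) (-1) ^+ #|A| * (hS M / G).
  rewrite /lam; set s := \sum_(_ | _) _; have := gS0 A => gA.
  transitivity ((-1) ^+ #|A| / G * s); first by field; rewrite !gt_eqF.
  by rewrite mulr_sumr; apply: eq_bigr => M _; rewrite -mulrA [_^-1 * _]mulrC.
have sumlam (L : {set T}) : \sum_(A : {set T} | L \subset A) lam A * gS A =
    (if F L then (-1) ^+ #|L| * (hS L / G) else 0).
  under eq_bigr do rewrite lamg.
  rewrite (exchange_big_dep F) /=; last by move=> A M _ /andP[].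
  transitivity (\sum_(M : {set T} | F M) (if L == M then (-1) ^+ #|L| * (hS L / G) else 0)).
    apply: eq_bigr => M FM; rewrite -mulr_suml.
    rewrite (eq_bigl (fun A : {set T} => (L \subset A) && (A \subset M))); last first.
      by move=> A; rewrite FM.
    by rewrite sum_alternating; case: eqP => [->|_] //; rewrite mul0r.
  rewrite -big_mkcondr; case: ifPn => FL.
    rewrite (bigD1 L) ?FL ?eqxx//= big1 ?addr0// => M /andP[/andP[_ /eqP ->]].
    by rewrite eqxx.
  by rewrite big1// => M /andP[FM /eqP LM]; rewrite LM FM in FL.
have gU (A B : {set T}) : gS (A :|: B) = gS A * gS B * \sum_(L : {set T} | L \subset A :&: B) (hS L)^-1.
  have e : \sum_(L : {set T} | L \subset A :&: B) (hS L)^-1 = (gS (A :&: B))^-1.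
    rewrite /gS -prodfV; transitivity (\prod_(t in A :&: B) (1 + (h t)^-1)).
      by rewrite prod_1D_subsets; apply: eq_bigr => L _; rewrite /hS prodfV.
    apply: eq_bigr => t _; rewrite /h; case/andP: (g01 t) => t0 t1.
    by field; apply/andP; split; lra.
  by rewrite e /gS -prod_setU_setI mulfK// gt_eqF// gS0.
have Q : \sum_(A : {set T}) \sum_(B : {set T}) lam A * lam B * gS (A :|: B) = G^-1.
  transitivity (\sum_(L : {set T}) (hS L)^-1 * (\sum_(A : {set T} | L \subset A) lam A * gS A) ^+ 2).
    transitivity (\sum_(A : {set T}) \sum_(B : {set T}) \sum_(L : {set T})
       (if L \subset A :&: B then (hS L)^-1 * (lam A * gS A) * (lam B * gS B) else 0)).
      apply: eq_bigr => A _; apply: eq_bigr => B _; rewrite gU -big_mkcond !mulr_sumr /=.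
      by apply: eq_bigr => L _; ring.
    under eq_bigr do rewrite exchange_big /=.
    rewrite exchange_big /=; apply: eq_bigr => L _.
    rewrite expr2 mulrA [_^-1 * _]mulr_sumr [RHS]mulr_suml [RHS]big_mkcond; apply: eq_bigr => A _.
    case: ifP => LA; last by rewrite big1// => B _; rewrite finset.subsetI LA.
    rewrite mulr_sumr [RHS]big_mkcond; apply: eq_bigr => B _.
    by rewrite finset.subsetI LA; case: ifP => //; rewrite mulrA.
  transitivity (\sum_(L : {set T} | F L) hS L / G ^+ 2).
    rewrite [RHS]big_mkcond; apply: eq_bigr => L _; rewrite sumlam; case: ifP => FL.
      rewrite exprMn -exprM mulnC exprM sqrrN expr1n expr1n mul1r.
      by have := hS0 L => hL; field; rewrite !gt_eqF.
    by rewrite expr2 mul0r mulr0.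
  rewrite -mulr_suml -/G; field; by rewrite gt_eqF.
(* the indicator of an unsieved n is at most the square of its weighted sum *)
apply: le_trans (_ : \sum_(n <- r) (\sum_(A : {set T} | A \subset bad n) lam A) ^+ 2 <= _).
  rewrite big_mkcond; apply: ler_sum => n _; case: ifP => [/eqP ->|_]; last exact: sqr_ge0.
  rewrite (big_pred1 finset.set0) ?lam0 ?expr1n// => A.
  by rewrite finset.subset0.
have -> : \sum_(n <- r) (\sum_(A : {set T} | A \subset bad n) lam A) ^+ 2 =
  \sum_(A : {set T}) \sum_(B : {set T}) lam A * lam B * \sum_(n <- r | A :|: B \subset bad n) 1.
  transitivity (\sum_(n <- r) \sum_(A : {set T}) \sum_(B : {set T})
     (if A :|: B \subset bad n then lam A * lam B else 0)).
    apply: eq_bigr => n _; rewrite expr2 mulr_suml big_mkcond; apply: eq_bigr => A _.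
    case: ifP => An; last by rewrite big1// => B _; rewrite finset.subUset An.
    rewrite mulr_sumr big_mkcond; apply: eq_bigr => B _.
    by rewrite finset.subUset An.
  rewrite exchange_big /=; apply: eq_bigr => A _.
  rewrite exchange_big /=; apply: eq_bigr => B _.
  by rewrite mulr_sumr -big_mkcond /=; apply: eq_bigr => n _; rewrite mulr1.
rewrite -/G -Q.
have -> : X * (\sum_(A : {set T}) \sum_(B : {set T}) lam A * lam B * gS (A :|: B)) =
   \sum_(A : {set T}) \sum_(B : {set T}) lam A * lam B * (X * gS (A :|: B)).
  rewrite mulr_sumr; apply: eq_bigr => A _; rewrite mulr_sumr; apply: eq_bigr => B _; ring.
rewrite -lerBlDl -sumrB [leRHS]big_mkcond; apply: ler_sum => A _; rewrite -sumrB.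
case: ifPn => FA; last by rewrite big1// => B _; rewrite lamF// !mul0r subrr.
rewrite [leRHS]big_mkcond; apply: ler_sum => B _; rewrite -mulrBr.
case: ifPn => FB; last by rewrite (lamF B)// mulr0 !mul0r.
apply: le_trans (ler_norm _) _; rewrite normrM (normrM (lam A)); apply: ler_pM => //.
  by apply: ler_pM => //; exact: lam_le.
Qed.

(** * The sieve for pairs of integers at a given distance *)

Lemma count_residue (q r N : nat) : (r < q)%N ->
  (\sum_(0 <= n < N.+1) (n %% q == r) = (N + q - r) %/ q)%N.
Proof.
move=> rq; elim: N => [|N IH].
  rewrite big_nat1 mod0n add0n; case: r rq => [|r] rq; first by rewrite subn0 divnn (leq_ltn_trans _ rq).
  by rewrite divn_small//; lia.
rewrite big_nat_recr//= IH (_ : (N.+1 + q - r = (N + q - r).+1)%N); last lia.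
rewrite divnS; last lia.
rewrite addnC; congr (_ + _)%N; congr nat_of_bool.
rewrite (_ : ((N + q - r).+1 = N.+1 + q - r)%N); last lia.
have -> : (N.+1 %% q == r)%N = (N.+1 == r %[mod q]) by rewrite (modn_small rq).
rewrite -(eqn_modDr (q - r)) subnKC; last lia.
by rewrite modnn addnBA //; lia.
Qed.

Lemma count_class (R : realType) (q c N : nat) : (0 < q)%N ->
  `|\sum_(1 <= n < N.+1 | n == c %[mod q]) 1 - N%:R / q%:R| <= 1 :> R.
Proof.
move=> q0; have rq := ltn_pmod c q0; set r := (c %% q)%N in rq *.
have q0' : 0 < q%:R :> R by rewrite ltr0n.
have := count_residue N rq; rewrite big_ltn// mod0n.
have -> : \sum_(1 <= n < N.+1 | n == c %[mod q]) 1 = (\sum_(1 <= n < N.+1) (n %% q == r))%N%:R :> R.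
  by rewrite natr_sum big_mkcond; apply: eq_bigr => n _; case: (_ == _).
set f := (\sum_(_ <= _ < _) _)%N => fE.
have h1 : (f * q <= N + q)%N.
  have : ((N + q - r) %/ q * q <= N + q - r)%N by exact: leq_divM.
  by rewrite -fE; case: (0 == r)%N; nia.
have h2 : (N <= f * q + q)%N.
  have := divn_eq (N + q - r) q; have := ltn_pmod (N + q - r) q0.
  rewrite -fE; case: eqP => [<-|/eqP r0] /=; rewrite ?subn0 ?add0n ?mulnDl; lia.
have h1' : f%:R <= N%:R / q%:R + 1 :> R.
  by rewrite -[X in _ + X](divff (lt0r_neq0 q0')) -mulrDl ler_pdivlMr// -natrM -natrD ler_nat.
have h2' : N%:R / q%:R - 1 <= f%:R :> R.
  by rewrite lerBlDr -[X in _ + X](divff (lt0r_neq0 q0')) ler_pdivrMr// mulrDl divfK ?gt_eqF// -natrM -natrD ler_nat.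
by rewrite ler_norml; apply/andP; split; lra.
Qed.

Lemma count_two_classes (R : realType) (u v d N : nat) : coprime u v -> (0 < u)%N -> (0 < v)%N ->
  `|\sum_(1 <= n < N.+1 | (u %| n)%N && (v %| n + d)%N) 1 - N%:R / (u * v)%:R| <= 1 :> R.
Proof.
move=> co u0 v0; pose c := chinese u v 0 (v.-1 * d).
have := @count_class R (u * v) c N; rewrite muln_gt0 u0 v0 => /(_ isT).
congr (`|_ - _| <= _); apply: eq_bigl => n.
rewrite chinese_remainder// /c (chinese_modl co) (chinese_modr co).
rewrite mod0n -/(dvdn u n); congr (_ && _).
by rewrite -(eqn_modDr d) -mulSnr prednK// modnMr.
Qed.

Lemma prod_addr_subsets (R : comPzRingType) (T : finType) (A : {set T}) (a b : T -> R) :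
  \prod_(t in A) (a t + b t) =
  \sum_(B : {set T} | B \subset A) (\prod_(t in B) a t) * \prod_(t in A :\: B) b t.
Proof.
rewrite big_mkcond /=.
transitivity (\prod_t ((if t \in A then a t else 0) + (if t \in A then b t else 1))).
  by apply: eq_bigr => t _; case: ifP; rewrite ?add0r.
rewrite bigA_distr [RHS]big_mkcond; apply: eq_bigr => B _.
case: ifPn => [/fintype.subsetP BA|/fintype.subsetPn[t tB tA]].
  rewrite [X in _ = X * _]big_mkcond [X in _ = _ * X]big_mkcond -big_split /=.
  apply: eq_bigr => t _; rewrite finset.in_setD; case: ifPn => tB; first by rewrite BA// mulr1.
  by rewrite mul1r.
by rewrite (bigD1 t)//= tB (negbTE tA) mul0r.
Qed.

(** Each [t] in the union lies in the first set only, the second only, or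
    both.  Summing over all subsets of [A] makes the identity a square of
    [prod_1D_subsets], and induction on the cardinal inverts the summation. *)
Lemma sum_setU_prod (R : comPzRingType) (T : finType) (A : {set T}) (x : T -> R) :
  \sum_(B : {set T}) \sum_(C : {set T} | B :|: C == A)
     (\prod_(t in B) x t) * (\prod_(t in C) x t) =
  \prod_(t in A) (x t *+ 2 + x t ^+ 2).
Proof.
move: {2}#|A|.+1 (leqnn #|A|.+1) => k; elim: k A => // k IH A cA.
pose S (A' : {set T}) := \sum_(B : {set T}) \sum_(C : {set T} | B :|: C == A')
     (\prod_(t in B) x t) * (\prod_(t in C) x t).
pose W (A' : {set T}) := \prod_(t in A') (x t *+ 2 + x t ^+ 2).
have e : \sum_(A' : {set T} | A' \subset A) S A' = \sum_(A' : {set T} | A' \subset A) W A'.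
  transitivity ((\sum_(B : {set T} | B \subset A) \prod_(t in B) x t) ^+ 2).
    rewrite exchange_big /= expr2 mulr_suml [RHS]big_mkcond; apply: eq_bigr => B _.
    rewrite (exchange_big_dep xpredT) //=.
    case: ifP => BA; last first.
      rewrite big1// => C _; rewrite big1// => A' /andP[A'A /eqP BC].
      by rewrite -BC finset.subUset BA in A'A.
    rewrite mulr_sumr [RHS]big_mkcond; apply: eq_bigr => C _.
    case: ifP => CA; last first.
      rewrite big1// => A' /andP[A'A /eqP BC].
      by rewrite -BC finset.subUset CA andbF in A'A.
    rewrite (big_pred1 (B :|: C)) // => A'; rewrite eq_sym andbC.
    by rewrite /=; case: eqP => //= ->; rewrite finset.subUset BA CA.
  rewrite -!prod_1D_subsets expr2 -big_split /=; apply: eq_bigr => t _; ring.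
move: e; rewrite (bigD1 A)//= [in RHS](bigD1 A)//=.
have -> : \sum_(A' : {set T} | (A' \subset A) && (A' != A)) S A' =
   \sum_(A' : {set T} | (A' \subset A) && (A' != A)) W A'.
  apply: eq_bigr => A' /andP[s ne]; apply: IH.
  have pr : A' \proper A by rewrite finset.properEneq ne.
  by apply: leq_trans (proper_card pr) _; rewrite -ltnS.
by move/addIr.
Qed.

(** The sieving primes form a finite type, the index type of the events of
    the sieve.  Those dividing the shift [d] are left out: they impose one
    condition on the pair instead of two. *)
Notation sprime D d :=
  {t : 'I_(D.+1) | [&& prime t, (t %% 4 == 3)%N & ~~ (t %| d)%N]}.

Definition spv (D d : nat) (t : sprime D d) : nat := val (val t).

Lemma spvP (D d : nat) (t : sprime D d) :
  [/\ prime (spv t), (spv t %% 4 == 3)%N, ~~ (spv t %| d)%N & (spv t <= D)%N].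
Proof.
by case: t => t ht; case/and3P: (ht) => h1 h2 h3; split => //; exact: (ltn_ord t).
Qed.

Lemma spv_inj (D d : nat) : injective (@spv D d).
Proof. by move=> s t h; apply: val_inj; exact: val_inj. Qed.

Lemma spv_ge3 (D d : nat) (t : sprime D d) : (3 <= spv t)%N.
Proof.
case: (spvP t) => pt m _ _; have := prime_gt1 pt.
by rewrite [(2 < _)%N]ltn_neqAle => ->; rewrite andbT; apply: contraTneq m => <-.
Qed.

Definition sprod (D d : nat) (A : {set sprime D d}) : nat := (\prod_(t in A) spv t)%N.

Lemma sprod_gt0 (D d : nat) (A : {set sprime D d}) : (0 < sprod A)%N.
Proof. by apply: prodn_cond_gt0 => t _; case: (spvP t) => /prime_gt0. Qed.

Lemma dvdn_sprod (D d : nat) (A : {set sprime D d}) (t : sprime D d) :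
  (spv t %| sprod A)%N = (t \in A).
Proof.
case: (spvP t) => pt _ _ _; rewrite Euclid_dvd_prod// big_has_cond.
apply/hasP/idP => [[s _ /andP[sA]]|tA].
  by case: (spvP s) => ps _ _ _; rewrite dvdn_prime2// => /eqP/spv_inj ->.
by exists t; rewrite ?mem_index_enum//=; apply/andP.
Qed.

Lemma sprod_inj (D d : nat) : injective (@sprod D d).
Proof. by move=> A B e; apply/finset.setP => t; rewrite -!dvdn_sprod e. Qed.

Lemma coprime_sprod (D d : nat) (A B : {set sprime D d}) :
  A :&: B = finset.set0 -> coprime (sprod A) (sprod B).
Proof.
move=> AB; rewrite /sprod; apply: (big_ind (fun m => coprime m (sprod B))).
- exact: coprime1n.
- by move=> m n hm hn; rewrite coprimeMl hm.
- move=> t tA; case: (spvP t) => pt _ _ _; rewrite prime_coprime// dvdn_sprod.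
  apply/negP => tB; have : t \in A :&: B by rewrite inE tA.
  by rewrite AB inE.
Qed.

Lemma sprod_dvdn (D d : nat) (A : {set sprime D d}) (n : nat) :
  (sprod A %| n)%N = [forall (t | t \in A), (spv t %| n)%N].
Proof.
apply/idP/forall_inP => [h t tA|h].
  by apply: dvdn_trans h; rewrite dvdn_sprod.
have : forall B : {set sprime D d}, B \subset A -> (sprod B %| n)%N.
  move=> B; move: {2}#|B|.+1 (leqnn #|B|.+1) => k; elim: k B => // k IH B cB BA.
  have [->|[t tB]] := set_0Vmem B; first by rewrite /sprod big_set0 dvd1n.
  rewrite /sprod (finset.big_setD1 t)//= Gauss_dvd; last first.
    case: (spvP t) => pt _ _ _; rewrite prime_coprime// -/(sprod (B :\ t)) dvdn_sprod.
    by rewrite finset.setD11.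
  rewrite h ?(fintype.subsetP BA)//=; apply: IH.
    by move: cB; rewrite (cardsD1 t) tB.
  by apply: fintype.subset_trans BA; exact: finset.subsetDl.
by apply.
Qed.

Definition bad_primes (D d n : nat) : {set sprime D d} :=
  finset (fun t => (spv t %| n * (n + d))%N).

(** Each prime of [A] has two forbidden classes, 0 and [- d], so there are
    [2 ^ #|A|] classes modulo the product, each counted with an error at most 1. *)
Lemma count_sprod (R : realType) (D d N : nat) (A : {set sprime D d}) :
  `|\sum_(1 <= n < N.+1 | A \subset bad_primes D d n) 1
     - N%:R * \prod_(t in A) (2 / (spv t)%:R)| <= (2 ^ #|A|)%:R :> R.
Proof.
pose c (B : {set sprime D d}) : R := \sum_(1 <= n < N.+1 | (sprod B %| n)%N && (sprod (A :\: B) %| n + d)%N) 1.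
have e1 : \sum_(1 <= n < N.+1 | A \subset bad_primes D d n) 1 =
   \sum_(B : {set sprime D d} | B \subset A) c B.
  rewrite /c; under [RHS]eq_bigr do rewrite big_mkcond.
  rewrite exchange_big /= big_mkcond; apply: eq_bigr => n _.
  transitivity (\prod_(t in A) (((spv t %| n)%N)%:R + ((spv t %| n + d)%N)%:R) : R).
    case: ifPn => [/fintype.subsetP h|/fintype.subsetPn[t tA]].
      rewrite big1// => t tA; have := h t tA; rewrite !inE.
      case: (spvP t) => pt _ td _; rewrite Euclid_dvdM//.
      have : ~~ ((spv t %| n)%N && (spv t %| n + d)%N).
        by apply/negP => /andP[tn]; rewrite dvdn_addr// (negbTE td).
      by do 2 case: (_ %| _)%N => //=; rewrite ?addr0 ?add0r.
    rewrite inE => h; rewrite (bigD1 t)//=; case: (spvP t) h => pt _ _ _.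
    by rewrite Euclid_dvdM// negb_or => /andP[/negbTE -> /negbTE ->]; rewrite addr0 mul0r.
  rewrite prod_addr_subsets; apply: eq_bigr => B BA.
  have prodb (E : {set sprime D d}) m : \prod_(t in E) ((spv t %| m)%N)%:R = ((sprod E %| m)%N)%:R :> R.
    rewrite sprod_dvdn; case: (boolP [forall (t | t \in E), _]) => [/forall_inP h|].
      by rewrite big1// => t tE; rewrite h.
    rewrite negb_forall_in => /exists_inP[t tE h].
    by rewrite (bigD1 t)//= (negbTE h) mul0r.
  by rewrite !prodb; do 2 case: (_ %| _)%N; rewrite ?mulr1 ?mulr0.
have e2 : N%:R * \prod_(t in A) (2 / (spv t)%:R) =
    \sum_(B : {set sprime D d} | B \subset A) N%:R / (sprod B * sprod (A :\: B))%:R :> R.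
  transitivity (N%:R * \prod_(t in A) ((spv t)%:R^-1 + (spv t)%:R^-1) : R).
    by congr (_ * _); apply: eq_bigr => t _; rewrite -mulr2n mulr_natl.
  rewrite prod_addr_subsets mulr_sumr; apply: eq_bigr => B _.
  by rewrite natrM invfM /sprod !natr_prod !prodfV.
rewrite e1 e2 -sumrB.
apply: le_trans (ler_norm_sum _ _ _) _.
apply: le_trans (_ : \sum_(B : {set sprime D d} | B \subset A) 1 <= _).
  apply: ler_sum => B BA; apply: count_two_classes; rewrite ?sprod_gt0//.
  by apply: coprime_sprod; apply/finset.setP => t; rewrite !inE; case: (t \in B).
rewrite sumr_const; have -> : #|[pred B : {set sprime D d} | B \subset A]| = #|powerset A|.
  by apply: eq_card => B; rewrite !inE.
by rewrite card_powerset.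
Qed.

Definition sieve_class (d : nat) : nat_pred := [pred p | (p %% 4 == 3)%N && ~~ (p %| d)%N].

Lemma squarefree_decomp (D d n : nat) : (0 < n <= D)%N ->
  pnat (sieve_class d) n ->
  exists w : nat * {set sprime D d}, (0 < w.1)%N /\ n = (w.1 ^ 2 * sprod w.2)%N.
Proof.
elim/ltn_ind: n => n IH /andP[n0 nD] pn.
have [n1|n1] := leqP n 1.
  by exists (1%N, finset.set0); rewrite /sprod big_set0 /=; split=> //; lia.
have pp := pdiv_prime n1; have pd := pdiv_dvd n.
have := pn => /(pnatP _ n0)/(_ _ pp pd); rewrite inE => /andP[p4 pnd].
have pD : (pdiv n < D.+1)%N by rewrite ltnS (leq_trans (dvdn_leq n0 pd)).
have ht : [&& prime (Ordinal pD), (Ordinal pD %% 4 == 3)%N & ~~ (Ordinal pD %| d)%N] by apply/and3P.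
pose t : sprime D d := exist _ (Ordinal pD) ht.
have tE : spv t = pdiv n by [].
have l1 : (n %/ pdiv n < n)%N by rewrite ltn_Pdiv// prime_gt1.
have l2 : (0 < n %/ pdiv n <= D)%N.
  by rewrite divn_gt0 ?prime_gt0// dvdn_leq//= (leq_trans (leq_div _ _)).
have l3 : pnat (sieve_class d) (n %/ pdiv n)%N.
  by apply: pnat_dvd pn; exact: dvdn_div.
have [[k B] /= [k0 nE]] := IH _ l1 l2 l3.
have {}nE : n = (k ^ 2 * sprod B * spv t)%N by rewrite -nE tE divnK.
case: (boolP (t \in B)) => tB.
  exists ((k * spv t)%N, B :\ t) => /=; rewrite muln_gt0 k0 tE pdiv_gt0; split=> //.
  by rewrite [LHS]nE /sprod (finset.big_setD1 t)//= -tE expnMn; ring.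
exists (k, t |: B) => /=; split=> //.
by rewrite [LHS]nE /sprod (finset.big_setU1 _ tB)/=; ring.
Qed.

(** Squarefree numbers already carry the reciprocal sum up to a constant: the
    square factor contributes a convergent series. *)
Lemma recip_sum_squarefree (R : realType) (D d X : nat) : (X <= D)%N ->
  recip_sum R (sieve_class d) X <=
  2 * \sum_(B : {set sprime D d} | (sprod B <= X)%N) \prod_(t in B) (spv t)%:R^-1.
Proof.
move=> XD; set pi := sieve_class d.
have /choice[w wP] : forall n, exists w : nat * {set sprime D d},
    (0 < n <= X)%N -> pi.-nat n -> (0 < w.1)%N /\ n = (w.1 ^ 2 * sprod w.2)%N.
  move=> n; have [/andP[n0 nX]|h] := pselect (0 < n <= X)%N; last by exists (0%N, finset.set0).
  have [pn|h] := pselect (pi.-nat n); last by exists (0%N, finset.set0).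
  have [v hv] : exists v : nat * {set sprime D d}, (0 < v.1)%N /\ n = (v.1 ^ 2 * sprod v.2)%N.
    by apply: squarefree_decomp => //; rewrite n0 (leq_trans nX).
  by exists v.
have k2 : \sum_(1 <= k < X.+1 | xpredT k) (k%:R ^+ 2)^-1 <= 2 :> R.
  case: X XD pi w wP => [|X] XD pi w wP; first by rewrite big_geq.
  rewrite big_ltn// expr1n invr1; have := sum_inv_nn1 R X.+2.
  suff : \sum_(2 <= k < X.+2) (k%:R ^+ 2)^-1 <= \sum_(2 <= n < X.+2) (n%:R * (n%:R - 1))^-1 :> R by lra.
  apply: ler_sum_nat => k /andP[kk _]; have k1 : 1 < k%:R :> R by rewrite ltr1n.
  by rewrite lef_pV2 ?posrE ?exprn_gt0 ?mulr_gt0//; nra.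
have s0 : 0 <= \sum_(B : {set sprime D d} | (sprod B <= X)%N) \prod_(t in B) (spv t)%:R^-1 :> R.
  by apply: sumr_ge0 => B _; apply: prodr_ge0 => t _; rewrite invr_ge0.
apply: le_trans (ler_wpM2r s0 k2).
apply: (@ler_sum_inj2 _ _ _ _ _ _ _ _ _ _ (fun n => (w n).1) (fun n => (w n).2)).
- exact: iota_uniq.
- move=> m n; rewrite !mem_filter !mem_index_iota !ltnS => /andP[pm hm] /andP[pn hn] [e1 e2].
  by case: (wP m hm pm) => _ ->; case: (wP n hn pn) => _ ->; rewrite e1 e2.
- move=> n; rewrite mem_index_iota ltnS => hn pn; have [k0 nE] := wP n hn pn.
  have kX : ((w n).1 ^ 2 <= n)%N by rewrite [leqRHS]nE leq_pmulr ?sprod_gt0.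
  have nX : (n <= X)%N by case/andP: hn.
  split=> //.
  + rewrite mem_index_iota k0 ltnS; apply: leq_trans nX; apply: leq_trans kX.
    by rewrite expnS expn1 leq_pmulr.
  + exact: mem_index_enum.
  + apply: leq_trans nX; rewrite [leqRHS]nE leq_pmull// expn_gt0 k0 //.
  + by rewrite {1}nE natrM invfM natrX /sprod natr_prod prodfV.
- by move=> *; rewrite invr_ge0 exprn_ge0.
- by move=> B _ _; apply: prodr_ge0 => t _; rewrite invr_ge0.
Qed.

(** The primes 3 mod 4 dividing [d] impose one condition on a pair [(n, n + d)]
    instead of two; this is the resulting loss in the sieve bound, in a form that
    is easy to compare with [recip_sum_expR]. *)
Definition shift_factor (R : realType) (X d : nat) : R :=
  expR (2 * \sum_(1 <= p < X.+1 | prime p && (p %% 4 == 3)%N && (p %| d)%N) (p%:R - 1)^-1).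

Lemma shift_factor_ge1 (R : realType) (X d : nat) : 1 <= shift_factor R X d.
Proof.
rewrite -[leLHS]expR0 ler_expR mulr_ge0// sumr_ge0// => p /andP[/andP[pp _] _].
by rewrite invr_ge0 subr_ge0 ler1n prime_gt0.
Qed.

(** The primes dividing [d] are put back at the cost of [shift_factor]. *)
Lemma recip_sum_sieve_class (R : realType) (d X : nat) : (2 <= X)%N ->
  ln X%:R <= (expR 22) ^+ 2 * shift_factor R X d * recip_sum R (sieve_class d) X ^+ 2.
Proof.
move=> X2; pose pd : nat_pred := [pred p | (p %% 4 == 3)%N && (p %| d)%N].
have lX : 0 <= ln X%:R :> R by exact: ln_nat_ge0.
have h1 : recip_sum R (residue4 3) X <= recip_sum R (sieve_class d) X * recip_sum R pd X.
  apply: (@recip_sum_mul R _ _ _ [pred p | ~~ (p %| d)%N]) => n pn.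
  have n0 : (0 < n)%N by case/andP: pn.
  split; apply/(pnatP _ (part_gt0 _ _)) => p pp pdv.
  - have := part_pnat [pred p | ~~ (p %| d)%N] n.
    move=> /(pnatP _ (part_gt0 _ _))/(_ p pp pdv); rewrite !inE => ->; rewrite andbT.
    by have := pn => /(pnatP _ n0)/(_ p pp (dvdn_trans pdv (dvdn_part _ _))); rewrite inE.
  - have := part_pnat (negn [pred p | ~~ (p %| d)%N]) n.
    move=> /(pnatP _ (part_gt0 _ _))/(_ p pp pdv); rewrite !inE negbK => ->; rewrite andbT.
    by have := pn => /(pnatP _ n0)/(_ p pp (dvdn_trans pdv (dvdn_part _ _))); rewrite inE.
have h2 : recip_sum R pd X ^+ 2 <= shift_factor R X d.
  rewrite /shift_factor (expRM_natl 2) ler_pXn2r ?nnegrE ?recip_sum_ge0 ?expR_ge0//.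
  apply: le_trans (recip_sum_expR R pd X) _; rewrite ler_expR le_eqVlt; apply/orP; left.
  by apply/eqP; apply: eq_bigl => p; rewrite inE andbA.
have h3 := @recip_sum_residue4_ge R 3 X (or_intror erefl) X2.
rewrite -[leLHS]sqr_sqrtr//.
apply: le_trans (_ : (expR 22 * (recip_sum R (sieve_class d) X * recip_sum R pd X)) ^+ 2 <= _).
  rewrite ler_pXn2r ?nnegrE ?sqrtr_ge0 ?mulr_ge0 ?expR_ge0 ?recip_sum_ge0//.
  by apply: le_trans h3 _; rewrite ler_wpM2l ?expR_ge0.
by rewrite !exprMn -mulrA [_ ^+ 2 * recip_sum R pd X ^+ 2]mulrC ler_wpM2l ?exprn_ge0 ?expR_ge0// ler_wpM2r ?exprn_ge0 ?recip_sum_ge0.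
Qed.

Lemma sprod_setU_le (D d : nat) (B C : {set sprime D d}) :
  (sprod (B :|: C) <= sprod B * sprod C)%N.
Proof.
apply: dvdn_leq; first by rewrite muln_gt0 !sprod_gt0.
rewrite sprod_dvdn; apply/forall_inP => t; rewrite finset.in_setU => /orP[] tB.
  by rewrite dvdn_mulr// dvdn_sprod.
by rewrite dvdn_mull// dvdn_sprod.
Qed.

Lemma sprod_expn_le (D d : nat) (A : {set sprime D d}) : (2 ^ #|A| <= sprod A)%N.
Proof.
rewrite -prod_nat_const; apply: leq_prod => t _; apply: ltnW; exact: spv_ge3.
Qed.

(** The denominator of Selberg's bound: expanding 2/(p-2) >= 2/p + 1/p^2 over
    unions [A = B :|: C] bounds it below by a square. *)
Lemma selberg_denominator (R : realType) (X d : nat) :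
  (\sum_(B : {set sprime (X ^ 2) d} | (sprod B <= X)%N) \prod_(t in B) (spv t)%:R^-1) ^+ 2
  <= \sum_(A : {set sprime (X ^ 2) d} | (sprod A <= X ^ 2)%N)
      \prod_(t in A) (2 / (spv t)%:R / (1 - 2 / (spv t)%:R)) :> R.
Proof.
set T := sprime _ _.
have x0 (t : T) : 0 < (spv t)%:R^-1 :> R.
  by rewrite invr_gt0 ltr0n; case: (spvP t) => /prime_gt0.
have p0 (B : {set T}) : 0 <= \prod_(t in B) (spv t)%:R^-1 :> R.
  by apply: prodr_ge0 => t _; exact: ltW.
apply: le_trans (_ : \sum_(A : {set T} | (sprod A <= X ^ 2)%N)
   \sum_(B : {set T}) \sum_(C : {set T} | B :|: C == A)
     (\prod_(t in B) (spv t)%:R^-1) * (\prod_(t in C) (spv t)%:R^-1) <= _); last first.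
  apply: ler_sum => A _; rewrite sum_setU_prod; apply: ler_prod => t _.
  have := x0 t; have := spv_ge3 t; rewrite -(ler_nat R); move: (spv t)%:R => p p3 pV.
  rewrite addr_ge0 ?mulrn_wge0 ?exprn_ge0 ?(ltW pV)//=.
  have -> : 2 / p / (1 - 2 / p) = 2 / (p - 2) by field; apply/andP; split; lra.
  rewrite ler_pdivlMr; last lra.
  have -> : (p^-1 *+ 2 + p^-1 ^+ 2) * (p - 2) = 2 - 3 / p - 2 / p ^+ 2 by field; lra.
  have : 0 < 2 / p ^+ 2 by rewrite divr_gt0// exprn_gt0//; lra.
  by have : 0 < 3 / p; [rewrite divr_gt0//; lra|lra].
rewrite exchange_big /= expr2 mulr_suml big_mkcond; apply: ler_sum => B _.
rewrite (exchange_big_dep xpredT)//=.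
have g0 : 0 <= \sum_(C : {set T}) \sum_(A : {set T} | (sprod A <= X ^ 2)%N && (B :|: C == A))
    (\prod_(t in B) (spv t)%:R^-1) * (\prod_(t in C) (spv t)%:R^-1) :> R.
  by apply: sumr_ge0 => C _; apply: sumr_ge0 => A _; rewrite mulr_ge0.
case: ifPn => // BX; rewrite mulr_sumr big_mkcond; apply: ler_sum => C _.
case: ifPn => CX; last by apply: sumr_ge0 => A _; rewrite mulr_ge0.
rewrite (big_pred1 (B :|: C)) // => A /=; rewrite eq_sym.
case: eqP => [->|]; rewrite ?andbF// andbT.
by apply: leq_trans (sprod_setU_le B C) _; exact: leq_mul.
Qed.

(** The sieving level [X ^ 2] is a small power of the length [X ^ 16], so crude
    bounds suffice for the remainder, while [ln X] and [ln (X ^ 16)] only differ by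
    a constant. *)
Lemma pair_sieve (R : realType) (X d : nat) : (2 <= X)%N ->
  (\sum_(1 <= n < (X ^ 16).+1 | pnat (residue4 1) n && pnat (residue4 1) (n + d)%N) 1) * ln X%:R
  <= (4 * expR 22 ^+ 2 + 1) * (X ^ 16)%:R * shift_factor R X d.
Proof.
move=> X2; set D := (X ^ 2)%N; set N := (X ^ 16)%N; set T := sprime D d.
have D0 : (0 < D)%N by rewrite expn_gt0; apply/orP; left; lia.
have lX : 0 < ln X%:R :> R by rewrite ln_gt0// ltr1n.
have g01 (t : T) : 0 < (2 / (spv t)%:R : R) < 1.
  have h : 3 <= (spv t)%:R :> R by rewrite ler_nat spv_ge3.
  by apply/andP; split; [rewrite divr_gt0//; lra|rewrite ltr_pdivrMr; lra].
have x0 (t : T) : 0 < (spv t)%:R^-1 :> R.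
  by rewrite invr_gt0 ltr0n; case: (spvP t) => /prime_gt0.
pose F (A : {set T}) := (sprod A <= D)%N.
have F0 : F finset.set0 by rewrite /F /sprod big_set0.
have Fdown (A B : {set T}) : A \subset B -> F B -> F A.
  move=> AB; apply: leq_trans; apply: dvdn_leq; first exact: sprod_gt0.
  by rewrite sprod_dvdn; apply/forall_inP => t tA; rewrite dvdn_sprod (fintype.subsetP AB).
have := @selberg_sieve R nat T (index_iota 1 N.+1) (bad_primes D d) F
  (fun t => 2 / (spv t)%:R) N%:R (fun A => (2 ^ #|A|)%:R) g01 F0 Fdown
  (fun A => count_sprod R N A).
set G := \sum_(A : {set T} | F A) \prod_(t in A) _; set E := \sum_(A : {set T} | F A) \sum_(B : {set T} | F B) _ => hS.
have hG : ln X%:R <= 4 * expR 22 ^+ 2 * shift_factor R X d * G.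
  apply: le_trans (recip_sum_sieve_class R d X2) _.
  have -> : 4 * expR 22 ^+ 2 * shift_factor R X d * G = expR 22 ^+ 2 * shift_factor R X d * (4 * G) by ring.
  rewrite ler_wpM2l ?mulr_ge0 ?exprn_ge0 ?expR_ge0//.
  apply: le_trans (_ : (2 * \sum_(B : {set T} | (sprod B <= X)%N) \prod_(t in B) (spv t)%:R^-1) ^+ 2 <= _).
    rewrite ler_pXn2r ?nnegrE ?recip_sum_ge0//.
      by apply: recip_sum_squarefree; rewrite /D expnS expn1 leq_pmulr//; lia.
    by rewrite mulr_ge0// sumr_ge0// => B _; apply: prodr_ge0 => t _; exact: ltW.
  rewrite exprMn (_ : 2 ^+ 2 = 4 :> R) ?ler_pM2l//; last by rewrite -natrX.
  exact: selberg_denominator.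
have G0 : 0 < G.
  rewrite ltNge; apply/negP => G0; move: hG; rewrite leNgt => /negP; apply.
  apply: le_lt_trans lX; rewrite mulr_ge0_le0// !mulr_ge0 ?exprn_ge0 ?expR_ge0//.
have cF : \sum_(A : {set T} | F A) 1 <= D%:R :> R.
  apply: le_trans (_ : \sum_(1 <= m < D.+1 | xpredT m) 1 <= _); last by rewrite sumr_const_nat subn1.
  apply: (@ler_sum_inj _ _ _ _ _ _ _ (@sprod D d)) => //; first exact: index_enum_uniq.
    by move=> A B _ _; exact: sprod_inj.
  by move=> A _ FA; rewrite mem_index_iota sprod_gt0 ltnS.
have gV (A : {set T}) : F A -> (\prod_(t in A) (2 / (spv t)%:R))^-1 <= D%:R :> R.
  move=> FA; apply: le_trans (_ : (sprod A)%:R <= _); last by rewrite ler_nat.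
  rewrite /sprod natr_prod -prodfV; apply: ler_prod => t _.
  have /andP[h1 h2] := g01 t; rewrite invr_ge0 ltW//= invf_div ler_pdivrMr//.
  by rewrite ler_peMr// ler1n.
(* at most D ^ 2 pairs, each contributing at most D ^ 4 *)
have hE : E <= (X ^ 12)%:R.
  have -> : (X ^ 12)%:R = (D%:R * D%:R * (D%:R * D%:R)) * D%:R * D%:R :> R.
    by rewrite -!natrM; congr (_%:R); rewrite /D; ring.
  apply: le_trans (_ : \sum_(A : {set T} | F A) \sum_(B : {set T} | F B) D%:R * D%:R * (D%:R * D%:R) <= _).
    apply: ler_sum => A FA; apply: ler_sum => B FB.
    apply: ler_pM => //; rewrite ?mulr_ge0 ?invr_ge0 ?prodr_ge0//; try by move=> t _; case/andP: (g01 t) => /ltW.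
      by apply: ler_pM; rewrite ?invr_ge0 ?prodr_ge0 ?gV//; move=> t _; case/andP: (g01 t) => /ltW.
    rewrite -natrM ler_nat; apply: leq_trans (sprod_expn_le _) _.
    by apply: leq_trans (sprod_setU_le A B) _; exact: leq_mul.
  have c0 : 0 <= D%:R * D%:R * (D%:R * D%:R) :> R by rewrite !mulr_ge0.
  set c := D%:R * D%:R * (D%:R * D%:R) in c0 *.
  have cst (e : R) : \sum_(A : {set T} | F A) e = e * \sum_(A : {set T} | F A) 1.
    by rewrite mulr_sumr; apply: eq_bigr => A _; rewrite mulr1.
  rewrite cst [X in X * _]cst; apply: ler_pM => //; first by rewrite mulr_ge0// sumr_ge0.
    by apply: sumr_ge0.
  by rewrite ler_wpM2l.
have hc : \sum_(1 <= n < N.+1 | pnat (residue4 1) n && pnat (residue4 1) (n + d)%N) 1 <=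
    \sum_(1 <= n < N.+1 | bad_primes D d n == finset.set0) 1 :> R.
  rewrite big_mkcond [leRHS]big_mkcond; apply: ler_sum_nat => n /andP[n0 _].
  case: ifPn => [/andP[pn pnd]|_]; last by case: ifP.
  rewrite ifT//; apply/eqP/finset.setP => t; rewrite !inE.
  case: (spvP t) => pt /eqP t3 _ _; rewrite Euclid_dvdM//; apply/negbTE; rewrite negb_or.
  have aux m : (0 < m)%N -> (residue4 1).-nat m -> ~~ (spv t %| m)%N.
    move=> m0 /(pnatP _ m0) h; apply/negP => tm; have := h _ pt tm.
    by rewrite inE t3.
  by rewrite !aux// addn_gt0 n0.
have X1 : 1 <= X%:R :> R by rewrite ler1n; lia.
have N0 : 0 <= N%:R :> R by [].
have SS := shift_factor_ge1 R X d.
apply: le_trans (ler_wpM2r (ltW lX) (le_trans hc hS)) _.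
rewrite mulrDl !mulrDl; apply: lerD.
  rewrite mulrAC ler_pdivrMr//; apply: le_trans (ler_wpM2l N0 hG) _.
  by rewrite le_eqVlt; apply/orP; left; apply/eqP; ring.
apply: le_trans (_ : (X ^ 12)%:R * X%:R <= _).
  apply: ler_pM => //; last by rewrite ltW// ln_sublinear//; lra.
    by apply: sumr_ge0 => A _; apply: sumr_ge0 => B _; rewrite !mulr_ge0 ?invr_ge0 ?prodr_ge0// => t _; case/andP: (g01 t) => /ltW.
  exact: ltW.
apply: le_trans (_ : N%:R * 1 <= _); last by rewrite mul1r ler_wpM2l.
rewrite mulr1 -natrM ler_nat -expnSr /N leq_exp2l//.
Qed.

(** * Distance to the nearest integer and badly approximable numbers *)

Lemma nint_dist_le (R : realType) (x : R) (m : int) : nint_dist x <= `|x - m%:~R|.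
Proof.
rewrite /nint_dist; apply: ge_inf; last by exists m.
by exists 0 => _ [k _ <-].
Qed.

Lemma exists_nearest (R : realType) (x : R) : exists m : int, `|x - m%:~R| <= 2^-1.
Proof.
have /andP[h1 h2] := floor_itv x.
have [h|h] := lerP (x - (Num.floor x)%:~R) 2^-1.
  by exists (Num.floor x); rewrite ger0_norm// subr_ge0.
by exists (Num.floor x + 1); rewrite ler_norml rmorphD /= in h2 *; apply/andP; split; lra.
Qed.

(** The infimum is a minimum, reached at a nearest integer. *)
Lemma nint_dist_attained (R : realType) (x : R) :
  exists m : int, nint_dist x = `|x - m%:~R|.
Proof.
have [m hm] := exists_nearest x; exists m; apply/eqP; rewrite eq_le nint_dist_le /=.
rewrite /nint_dist; apply: lb_le_inf; first by exists `|x - m%:~R|, m.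
move=> _ [k _ <-]; rewrite leNgt; apply/negP => h.
have km : k != m by apply: contraTneq h => ->; rewrite ltxx.
have : 1 <= `|(k - m)%:~R : R|.
  rewrite -intr_norm (ler_int R 1); have : k - m != 0 by rewrite subr_eq0.
  by rewrite -normr_gt0 gtz0_ge1.
have : `|(k - m)%:~R : R| <= `|x - m%:~R| + `|x - k%:~R|.
  rewrite rmorphB /= (_ : k%:~R - m%:~R = (x - m%:~R) - (x - k%:~R)); last by ring.
  exact: ler_normB.
by lra.
Qed.

Lemma nint_dist_ge0 (R : realType) (x : R) : 0 <= nint_dist x.
Proof. by have [m ->] := nint_dist_attained x. Qed.

Lemma nint_dist_half (R : realType) (x : R) : nint_dist x <= 2^-1.
Proof. by have [m h] := exists_nearest x; exact: le_trans (nint_dist_le x m) h. Qed.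

Lemma nint_distN (R : realType) (x : R) : nint_dist (- x) = nint_dist x.
Proof.
have aux (y : R) : nint_dist (- y) <= nint_dist y.
  have [m ->] := nint_dist_attained y; apply: le_trans (nint_dist_le _ (- m)) _.
  by rewrite rmorphN /= opprK addrC distrC.
by apply/eqP; rewrite eq_le aux/= -{1}[x]opprK aux.
Qed.

Lemma nint_distD (R : realType) (x y : R) : nint_dist (x + y) <= nint_dist x + nint_dist y.
Proof.
have [m ->] := nint_dist_attained x; have [k ->] := nint_dist_attained y.
apply: le_trans (nint_dist_le _ (m + k)) _; rewrite rmorphD /= opprD addrACA.
exact: ler_normD.
Qed.

Lemma nint_distB (R : realType) (x y : R) : nint_dist (x - y) <= nint_dist x + nint_dist y.
Proof. by apply: le_trans (nint_distD _ _) _; rewrite nint_distN. Qed.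

Lemma nint_dist_int (R : realType) (m : int) : nint_dist (m%:~R : R) = 0.
Proof.
apply/eqP; rewrite eq_le nint_dist_ge0 andbT.
by apply: le_trans (nint_dist_le _ m) _; rewrite subrr normr0.
Qed.

Lemma nint_dist_addz (R : realType) (x : R) (m : int) : nint_dist (x + m%:~R) = nint_dist x.
Proof.
apply/eqP; rewrite eq_le; apply/andP; split.
  by apply: le_trans (nint_distD _ _) _; rewrite nint_dist_int addr0.
rewrite -{1}(addrK m%:~R x); apply: le_trans (nint_distB _ _) _.
by rewrite nint_dist_int addr0.
Qed.

Lemma nint_distMn (R : realType) (n : nat) (x : R) : nint_dist (n%:R * x) <= n%:R * nint_dist x.
Proof.
elim: n => [|n IH]; first by rewrite !mul0r -[0]/((0 : int)%:~R) nint_dist_int.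
by rewrite -natr1 !mulrDl !mul1r; apply: le_trans (nint_distD _ _) _; rewrite lerD2r.
Qed.

Lemma limn_einfE (R : realType) (u : nat -> \bar R) :
  limn_einf u = ereal_sup (range (einfs u)).
Proof. by rewrite limn_einf_lim; apply/cvg_lim => //; exact: cvg_einfs_sup. Qed.

Lemma limn_einf_gt0 (R : realType) (u : nat -> R) :
  (0 < limn_einf (fun n => (u n)%:E))%E ->
  exists n0 : nat, exists2 c : R, 0 < c & forall n, (n0 <= n)%N -> (c%:E <= (u n)%:E)%E.
Proof.
rewrite limn_einfE => /ereal_sup_gt[_ [n0 _ <-]] h; exists n0.
have hle n : (n0 <= n)%N -> (einfs (fun n => (u n)%:E) n0 <= (u n)%:E)%E.
  by move=> n0n; apply: ereal_inf_lbound; exists n.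
have := hle n0 (leqnn _); move: h hle; case: (einfs _ _) => [c| |]//.
by rewrite lte_fin => c0 hle _; exists c.
Qed.

Lemma limn_einf_eq0 (R : realType) (u : nat -> R) (e : R) (K : nat) :
  limn_einf (fun n => (u n)%:E) = 0%E -> 0 < e -> exists2 n, (K <= n)%N & u n < e.
Proof.
rewrite limn_einfE => h e0; apply: contrapT => hn.
have : (e%:E <= 0)%E.
  rewrite -h; apply: le_trans (_ : (einfs (fun n => (u n)%:E) K <= _)%E); last first.
    by apply: ereal_sup_ubound; exists K.
  apply: le_ereal_inf_tmp => _ [n /= Kn <-]; rewrite lee_fin leNgt; apply/negP => un.
  by apply: hn; exists n.
by rewrite lee_fin leNgt e0.
Qed.

(** The liminf only controls large [n]; a multiple [(n0 + 1) n] transfers the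
    bound to every [n], at the cost of a constant. *)
Lemma badly_approximableP (R : realType) (alpha : R) : badly_approximable alpha ->
  exists2 c : R, 0 < c & forall n, (0 < n)%N -> c <= n%:R * nint_dist (n%:R * alpha).
Proof.
rewrite /badly_approximable => /limn_einf_gt0[n0 [c c0 hc]].
exists (c / n0.+1%:R ^+ 2) => [|n n1]; first by rewrite divr_gt0// exprn_gt0.
have := hc (n0.+1 * n)%N; rewrite (leq_trans (leqnSn n0)) ?leq_pmulr// lee_fin => /(_ isT) h.
rewrite ler_pdivrMr ?exprn_gt0//; apply: le_trans h _.
rewrite natrM -[n0.+1%:R * n%:R * alpha]mulrA.
apply: le_trans (ler_wpM2l _ (nint_distMn _ _)) _; first by rewrite mulr_ge0.
by rewrite le_eqVlt; apply/orP; left; apply/eqP; ring.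
Qed.

(** Rounding down [(f i - a) / delta] is injective. *)
Lemma packing (R : realType) (T : eqType) (s : seq T) (f : T -> R) (a b delta : R) :
  0 < delta -> uniq s -> (a <= b) ->
  (forall i, i \in s -> a <= f i <= b) ->
  (forall i j, i \in s -> j \in s -> i != j -> delta <= `|f i - f j|) ->
  (size s)%:R <= (b - a) / delta + 1.
Proof.
move=> d0 us ab fab sep.
pose g i := Num.truncn ((f i - a) / delta).
have ginj : {in s &, injective g}.
  move=> i j si sj e; apply/eqP; apply: contraT => ij.
  have := sep i j si sj ij; rewrite leNgt => /negP[].
  have /andP[ai _] := fab i si; have /andP[aj _] := fab j sj.
  have hi : 0 <= (f i - a) / delta by rewrite divr_ge0 ?subr_ge0// ltW.
  have hj : 0 <= (f j - a) / delta by rewrite divr_ge0 ?subr_ge0// ltW.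
  have /andP[i1 i2] := truncn_itv hi; have /andP[j1 j2] := truncn_itv hj.
  rewrite -/(g i) -/(g j) e in i1 i2 j1 j2.
  have -> : f i - f j = ((f i - a) / delta - (f j - a) / delta) * delta by field; rewrite gt_eqF.
  rewrite normrM (gtr0_norm d0) gtr_pMl// ltr_norml.
  by rewrite -natr1 in i2 j2; apply/andP; split; lra.
have : (size [seq g i | i <- s] <= size (iota 0 (Num.truncn ((b - a) / delta)).+1))%N.
  apply: uniq_leq_size; first by rewrite map_inj_in_uniq.
  move=> _ /mapP[i si ->]; rewrite mem_iota /= add0n ltnS /g.
  apply: le_truncn; rewrite ler_pM2r ?invr_gt0// lerD2r.
  by case/andP: (fab i si).
rewrite size_map size_iota -(ler_nat R) => h; apply: le_trans h _.
by rewrite -natr1 lerD2r truncn_le// divr_ge0 ?subr_ge0// ltW.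
Qed.

Lemma packing_circle (R : realType) (T : eqType) (s : seq T) (f : T -> R) (rho delta : R) :
  0 < delta -> uniq s -> 0 <= rho ->
  (forall i, i \in s -> nint_dist (f i) <= rho) ->
  (forall i j, i \in s -> j \in s -> i != j -> delta <= nint_dist (f i - f j)) ->
  (size s)%:R <= 2 * rho / delta + 1.
Proof.
move=> d0 us r0 fr sep.
have /choice[m mP] : forall i, exists m : int, nint_dist (f i) = `|f i - m%:~R|.
  by move=> i; exact: nint_dist_attained.
have -> : 2 * rho = rho - (- rho) by ring.
apply: (@packing R T s (fun i => f i - (m i)%:~R)) => //; first lra.
  by move=> i si; rewrite -ler_norml -mP fr.
move=> i j si sj ij; apply: le_trans (sep i j si sj ij) _.
apply: le_trans (nint_dist_le _ (m i - m j)) _.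
by rewrite rmorphB /= le_eqVlt; apply/orP; left; apply/eqP; congr (`|_|); ring.
Qed.

Lemma nint_dist_diff (R : realType) (beta : R) (i j : nat) :
  nint_dist (i%:R * beta - j%:R * beta) = nint_dist ((i - j + (j - i))%N%:R * beta).
Proof.
rewrite -mulrBl; case: (leqP i j) => h.
  by rewrite (eqP (_ : (i - j == 0)%N)) ?subn_eq0// add0n natrB// -[RHS]nint_distN -mulNr opprB.
by rewrite (eqP (_ : (j - i == 0)%N)) ?subn_eq0 ?(ltnW h)// addn0 natrB// ltnW.
Qed.

(** Take the least [Q] with [Q * beta] within [1 / Y] of an integer.  It is at
    most [Y + 1] by packing, and the multiples of [beta] below [Q] are
    [1 / (2 Q)]-separated modulo 1 (Legendre): with [a], [b] the integers nearest
    to [Q * beta] and [e * beta], the nonzero integer [e a - Q b] would otherwise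
    be less than 1 in absolute value. *)
Lemma best_denominator (R : realType) (beta Y : R) : 1 <= Y ->
  exists Q : nat, [/\ (0 < Q)%N, Q%:R <= Y + 1, nint_dist (Q%:R * beta) <= Y^-1 &
    forall e, (0 < e < Q)%N -> (2 * Q%:R)^-1 <= nint_dist (e%:R * beta)].
Proof.
move=> Y1; have Y0 : 0 < Y^-1 by rewrite invr_gt0; lra.
have diff := @nint_dist_diff R beta.
have sepQ (Q : nat) : (forall e, (0 < e < Q)%N -> Y^-1 < nint_dist (e%:R * beta)) -> Q%:R <= Y + 1.
  move=> hQ; have := @packing_circle R nat (iota 0 Q) (fun i => i%:R * beta) 2^-1 Y^-1 Y0 (iota_uniq _ _).
  rewrite size_iota mulfV// div1r invrK; apply.
  - by rewrite invr_ge0.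
  - by move=> i _; exact: nint_dist_half.
  - move=> i j; rewrite !mem_iota !add0n /= => iQ jQ ij; rewrite diff; apply: ltW; apply: hQ.
    by move/eqP: ij; lia.
have hex : exists n, (0 < n)%N && (nint_dist (n%:R * beta) <= Y^-1).
  apply: contrapT => hn; pose K := (Num.truncn (Y + 1)).+1.
  have : K%:R <= Y + 1 :> R.
    apply: sepQ => e /andP[e0 _]; rewrite ltNge; apply/negP => he; apply: hn.
    by exists e; rewrite e0.
  by rewrite leNgt => /negP; apply; exact: truncnS_gt.
case: (ex_minnP hex) => Q /andP[Q0 hQ] Qmin.
have big e : (0 < e < Q)%N -> Y^-1 < nint_dist (e%:R * beta).
  move=> /andP[e0 eQ]; rewrite ltNge; apply/negP => he.
  by have := Qmin e; rewrite e0 he leqNgt eQ => /(_ isT).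
exists Q; split => //; first exact: sepQ.
move=> e eQ; have h1 := big e eQ; move: eQ => /andP[e0 eQ].
move: hQ h1; have [a aE] := nint_dist_attained (Q%:R * beta).
have [b bE] := nint_dist_attained (e%:R * beta).
rewrite aE bE; set x := Q%:R * beta - a%:~R; set y := e%:R * beta - b%:~R => hx hy.
have Qr : 0 < Q%:R :> R by rewrite ltr0n.
have er : 0 < e%:R :> R by rewrite ltr0n.
have eQr : e%:R < Q%:R :> R by rewrite ltr_nat.
pose z : int := e%:Z * a - Q%:Z * b.
have zE : z%:~R = Q%:R * y - e%:R * x :> R.
  by rewrite /z rmorphB /= !rmorphM /= /x /y -!pmulrn; ring.
have z1 : 1 <= `|z%:~R : R|.
  have z0 : z != 0.
    apply/eqP => z0; have : Q%:R * `|y| = e%:R * `|x|.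
      have : Q%:R * y = e%:R * x by apply/eqP; rewrite -subr_eq0 -zE z0.
      move=> h; have : `|Q%:R * y| = `|e%:R * x| by rewrite h.
      by rewrite !normrM (gtr0_norm Qr) (gtr0_norm er).
    by have := normr_ge0 x; nra.
  by rewrite -intr_norm (ler_int R 1); move: z0; rewrite -normr_gt0 gtz0_ge1.
rewrite -[leLHS]div1r ler_pdivrMr ?mulr_gt0//; apply: le_trans z1 _; rewrite zE.
apply: le_trans (ler_normB _ _) _; rewrite !normrM (gtr0_norm Qr) (gtr0_norm er).
by have := normr_ge0 x; nra.
Qed.

(** Multiples of [q] in a Bohr set: cut [1, N / q] into blocks of length [Q],
    a best denominator of [q alpha] at scale [N / sqrt M].  Bad approximability
    bounds [Q] from below, hence the number of blocks from above. *)
Lemma bohr_multiples (R : realType) (alpha c : R) : 0 < c ->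
  (forall n, (0 < n)%N -> c <= n%:R * nint_dist (n%:R * alpha)) ->
  forall (N q : nat) (M : R), (0 < N)%N -> (0 < q)%N -> 1 <= M <= N%:R ->
  \sum_(1 <= d < N.+1 | (q %| d)%N && (nint_dist (d%:R * alpha) <= M / N%:R)) 1
   <= 4 * M / q%:R + (9 + c^-1) * Num.sqrt M.
Proof.
move=> c0 hc N q M N0 q0 /andP[M1 MN].
have n0 : 0 < N%:R :> R by rewrite ltr0n.
have qq : 0 < q%:R :> R by rewrite ltr0n.
set rho := M / N%:R; set E := (N %/ q)%N; set beta := q%:R * alpha.
set S := Num.sqrt M; have S1 : 1 <= S by rewrite -sqrtr1 ler_wsqrtr.
have SE : S ^+ 2 = M by rewrite sqr_sqrtr//; lra.
(* this scale balances the two error terms N / (q Q) and rho Q *)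
pose Y := N%:R / S; have Y1 : 1 <= Y by rewrite ler_pdivlMr; nra.
have rho0 : 0 <= rho by rewrite divr_ge0//; lra.
have [Q [Q0 QY hQ sepQ]] := @best_denominator R beta Y Y1.
have Qr : 0 < Q%:R :> R by rewrite ltr0n.
have Qlow : c * Y <= q%:R * Q%:R.
  have := hc (q * Q)%N; rewrite muln_gt0 q0 Q0 => /(_ isT).
  have -> : (q * Q)%N%:R * alpha = Q%:R * beta by rewrite natrM /beta; ring.
  rewrite natrM => h; have Yp : 0 < Y by lra.
  rewrite -ler_pdivlMr//; apply: le_trans h _.
  by rewrite ler_wpM2l// mulr_ge0.
have -> : \sum_(1 <= d < N.+1 | (q %| d)%N && (nint_dist (d%:R * alpha) <= rho)) 1 =
   \sum_(1 <= e < E.+1 | nint_dist (e%:R * beta) <= rho) 1 :> R.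
  rewrite big_mkcondr /= (@sum_multiples R (fun d => if nint_dist (d%:R * alpha) <= rho then 1 else 0))// [RHS]big_mkcond.
  by apply: eq_bigr => e _; rewrite /beta mulrA -natrM mulnC.
have block j : \sum_(1 <= e < E.+1 | (nint_dist (e%:R * beta) <= rho) && (e %/ Q == j)%N) 1 <= 4 * rho * Q%:R + 1 :> R.
  rewrite -big_filter; set s := [seq _ <- _ | _].
  have -> : \sum_(e <- s) 1 = (size s)%:R :> R by rewrite -sum1_size natr_sum.
  have -> : 4 * rho * Q%:R + 1 = 2 * rho / (2 * Q%:R)^-1 + 1 by field; lra.
  apply: (@packing_circle R nat s (fun e => e%:R * beta)) => //.
  - by rewrite invr_gt0 mulr_gt0.
  - by rewrite filter_uniq ?iota_uniq.
  - by move=> e; rewrite mem_filter => /andP[/andP[]].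
  - move=> e e'; rewrite !mem_filter => /andP[/andP[_ /eqP h1] _] /andP[/andP[_ /eqP h2] _] ne.
    rewrite nint_dist_diff; apply: sepQ.
    have e1 := divn_eq e Q; have e2 := divn_eq e' Q; rewrite h1 in e1; rewrite h2 in e2.
    have := ltn_pmod e Q0; have := ltn_pmod e' Q0; move/eqP: ne; move: e1 e2; clear.
    by move: (j * Q)%N (e %% Q)%N (e' %% Q)%N => x r r'; lia.
apply: le_trans (_ : \sum_(0 <= j < (E %/ Q).+1) (4 * rho * Q%:R + 1) <= _).
  apply: le_trans (ler_sum _ (fun j _ => block j)).
  rewrite (exchange_big_dep (fun e => nint_dist (e%:R * beta) <= rho)) /=; last by move=> j e _ /andP[].
  apply: ler_sum_nat_cond => e /andP[e0 eE] he.
  rewrite big_mkcond (bigD1_seq (e %/ Q)%N) ?iota_uniq//=; last by rewrite mem_index_iota/= ltnS leq_div2r.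
  by rewrite he eqxx lerDl sumr_ge0// => j _; case: ifP.
rewrite sumr_const_nat subn0 -[_ *+ _]mulr_natl -natr1.
have EQ : (E %/ Q)%:R <= N%:R / (q%:R * Q%:R) :> R.
  by rewrite /E -divnMA -natrM; exact: natr_divn_le.
apply: le_trans (_ : (N%:R / (q%:R * Q%:R) + 1) * (4 * rho * Q%:R + 1) <= _).
  apply: ler_wpM2r; first by rewrite addr_ge0// mulr_ge0// mulr_ge0.
  by rewrite lerD2r.
have -> : (N%:R / (q%:R * Q%:R) + 1) * (4 * rho * Q%:R + 1) =
   4 * M / q%:R + N%:R / (q%:R * Q%:R) + 4 * rho * Q%:R + 1.
  by rewrite /rho; field; rewrite !gt_eqF.
have h1 : N%:R / (q%:R * Q%:R) <= c^-1 * S.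
  rewrite ler_pdivrMr ?mulr_gt0//; apply: le_trans (_ : c^-1 * S * (c * Y) <= _).
    by rewrite /Y le_eqVlt; apply/orP; left; apply/eqP; field; apply/andP; split; lra.
  by rewrite ler_wpM2l// mulr_ge0 ?invr_ge0 ?ltW//; lra.
have h2 : rho * Q%:R <= 2 * S.
  apply: le_trans (_ : rho * (Y + 1) <= _); first by rewrite ler_wpM2l.
  have -> : rho * (Y + 1) = S + M / N%:R.
    by rewrite /rho /Y -SE; field; apply/andP; split; lra.
  have : M / N%:R <= 1 by rewrite ler_pdivrMr// mul1r.
  by lra.
by lra.
Qed.

(** * Well spaced sums of two squares *)

Lemma sum_sprime (V : nmodType) (D d : nat) (F : nat -> V) :
  \sum_(t : sprime D d) F (spv t) =
  \sum_(1 <= p < D.+1 | prime p && (p %% 4 == 3)%N && ~~ (p %| d)%N) F p.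
Proof.
rewrite -(big_map (@spv D d) xpredT F) -[RHS]big_filter; apply: perm_big.
apply: uniq_perm.
- by rewrite map_inj_uniq ?index_enum_uniq//; exact: spv_inj.
- by rewrite filter_uniq ?iota_uniq.
move=> p; rewrite mem_filter mem_index_iota; apply/mapP/idP.
  move=> [t _ ->]; case: (spvP t) => h1 h2 h3 h4.
  by rewrite h1 h2 h3 prime_gt0.
move=> /andP[/andP[/andP[h1 h2] h3] /andP[h4 h5]].
have ht : [&& prime (Ordinal h5), (Ordinal h5 %% 4 == 3)%N & ~~ (Ordinal h5 %| d)%N].
  by apply/and3P.
by exists (exist _ (Ordinal h5) ht) => //; exact: mem_index_enum.
Qed.

Lemma expR_le_linear (R : realType) (t : R) : 0 <= t <= 1 -> expR t <= 1 + t * expR 1.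
Proof.
move=> /andP[t0 t1]; have h := expR_ge1Dx (- t).
have e0 := expR_gt0 t; have e1 : expR t <= expR 1 by rewrite ler_expR.
have : expR t * expR (- t) = 1 by exact: expRxMexpNx_1.
by nra.
Qed.

(** The primes above [y] contribute boundedly, because their logarithms add up to
    at most [ln d]; the others are expanded into divisors of [d]. *)
Lemma shift_factor_le (R : realType) (X N d y : nat) : (0 < d <= N)%N -> (X <= N)%N ->
  (0 < y)%N -> ln N%:R <= y%:R :> R ->
  shift_factor R X d <= expR 4 * \sum_(A : {set sprime y 1} | (sprod A %| d)%N)
    \prod_(t in A) (3 * expR 1 / (spv t)%:R).
Proof.
move=> /andP[d0 dN] XN y0 Ny.
pose c p := prime p && (p %% 4 == 3)%N.
pose S1 : R := \sum_(t : sprime y 1 | (spv t %| d)%N) ((spv t)%:R - 1)^-1.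
have inv0 p : prime p -> 0 <= (p%:R - 1)^-1 :> R.
  by move=> pp; rewrite invr_ge0 subr_ge0 ler1n prime_gt0.
(* a prime p > y costs at most (2 / y) ln p, and these ln p add up to at most ln d <= y *)
have hS : \sum_(1 <= p < X.+1 | c p && (p %| d)%N) (p%:R - 1)^-1 <= S1 + 2 :> R.
  rewrite (bigID (fun p => (p <= y)%N)) /=; apply: lerD.
    have -> : S1 = \sum_(1 <= p < y.+1 | prime p && (p %% 4 == 3)%N && ~~ (p %| 1)%N)
        (if (p %| d)%N then (p%:R - 1)^-1 else 0).
      by rewrite /S1 big_mkcond -(@sum_sprime R y 1 (fun p => if (p %| d)%N then (p%:R - 1)^-1 else 0)).
    apply: (@ler_sum_inj _ _ _ _ _ _ _ id); first exact: iota_uniq.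
    - by move=> p q _ _.
    - move=> p; rewrite !mem_index_iota => /andP[p0 _] /andP[/andP[/andP[pp p3] pd] py].
      rewrite p0 ltnS py pp p3 pd dvdn1; split=> //=.
      by apply: contraTneq pp => ->.
    - by move=> p _ /andP[/andP[pp _] _]; case: ifP => // _; exact: inv0.
  apply: le_trans (_ : \sum_(1 <= p < X.+1 | prime p && (p %| d)%N) 2 / y%:R * ln p%:R <= _).
    apply: le_trans (_ : \sum_(1 <= p < X.+1 | c p && (p %| d)%N && ~~ (p <= y)%N) 2 / y%:R * ln p%:R <= _).
      apply: ler_sum => p /andP[/andP[/andP[pp _] _]]; rewrite -ltnNge => yp.
      have lp : 2^-1 <= ln p%:R :> R.
        by apply: le_trans (ln2_ge R) _; rewrite ler_ln ?posrE ?ltr0n ?prime_gt0// ler_nat prime_gt1.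
      have yr : 0 < y%:R :> R by rewrite ltr0n.
      have yp' : y%:R + 1 <= p%:R :> R by rewrite natr1 ler_nat.
      apply: le_trans (_ : y%:R^-1 <= _); first by rewrite lef_pV2 ?posrE//; lra.
      rewrite mulrAC -[leLHS]mul1r ler_wpM2r ?invr_ge0 ?(ltW yr)//; lra.
    rewrite big_mkcond [leRHS]big_mkcond; apply: ler_sum => p _.
    have h0 : 0 <= 2 / y%:R * ln p%:R :> R by rewrite mulr_ge0 ?divr_ge0 ?ln_nat_ge0.
    rewrite /c; case: (prime p) => //=; case: (p %% 4 == 3)%N => //=.
      by case: (p %| d)%N => //=; case: ifP.
    by case: ifP.
  rewrite -mulr_sumr; have yr : 0 < y%:R :> R by rewrite ltr0n.
  rewrite mulrAC ler_pdivrMr// ler_pM2l//; apply: le_trans Ny.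
  apply: le_trans (_ : ln d%:R <= _); last by rewrite ler_ln ?posrE ?ltr0n ?ler_nat//; lia.
  rewrite (@ln_factor R d N) ?d0//.
  apply: le_trans (_ : \sum_(1 <= p < N.+1 | prime p && (p %| d)%N) ln p%:R <= _).
    apply: (@ler_sum_inj _ _ _ _ _ _ _ id); first exact: iota_uniq.
    - by move=> p q _ _.
    - by move=> p; rewrite !mem_index_iota => /andP[-> pX] /andP[-> ->]; split=> //=; lia.
    - by move=> *; exact: ln_nat_ge0.
  rewrite big_mkcondr; apply: ler_sum => p pp.
  have s0 : 0 <= \sum_(1 <= k < N.+1 | (p ^ k %| d)%N) (ln p%:R : R).
    by apply: sumr_ge0 => *; exact: ln_nat_ge0.
  case: ifP => pd //; rewrite big_ltn_cond ?ltnS ?(leq_trans d0)// expn1 pd lerDl.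
  by apply: sumr_ge0 => *; exact: ln_nat_ge0.
have -> : \sum_(A : {set sprime y 1} | (sprod A %| d)%N) \prod_(t in A) (3 * expR 1 / (spv t)%:R) =
    \prod_(t : sprime y 1 | (spv t %| d)%N) (1 + 3 * expR 1 / (spv t)%:R) :> R.
  pose B : {set sprime y 1} := finset (fun t => (spv t %| d)%N).
  transitivity (\prod_(t in B) (1 + 3 * expR 1 / (spv t)%:R) : R).
    rewrite prod_1D_subsets; apply: eq_bigl => A; rewrite sprod_dvdn.
    apply/forall_inP/fintype.subsetP => h t tA; first by rewrite inE h.
    by have := h t tA; rewrite inE.
  by apply: eq_bigl => t; rewrite inE.
apply: le_trans (_ : expR 4 * expR (2 * S1) <= _).
  by rewrite -expRD ler_expR /shift_factor -/(c _); have := hS; rewrite /c; lra.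
rewrite ler_wpM2l ?expR_ge0// /S1 mulr_sumr expR_sum; apply: ler_prod => t td.
rewrite expR_ge0 /=; have p3 : 3 <= (spv t)%:R :> R by rewrite ler_nat spv_ge3.
move: (spv t)%:R p3 => p p3.
apply: le_trans (expR_le_linear _) _.
  rewrite divr_ge0//=; last lra.
  by rewrite ler_pdivrMr; lra.
rewrite lerD2l [3 * _ / p]mulrAC ler_wpM2r ?expR_ge0// ler_pdivrMr; last lra.
rewrite mulrAC ler_pdivlMr; lra.
Qed.

(** Each divisor [q] costs [1 / q * (M / q + sqrt M)] by [bohr_multiples].  The
    first part sums to O(M), and the second is [sqrt M] times an Euler product over
    primes up to [y]. *)
Lemma shift_factor_bohr_sum (R : realType) (alpha c : R) : 0 < c ->
  (forall n, (0 < n)%N -> c <= n%:R * nint_dist (n%:R * alpha)) ->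
  forall (X N y : nat) (M : R), (0 < N)%N -> (X <= N)%N -> (2 <= y)%N ->
  ln N%:R <= y%:R :> R -> 1 <= M <= N%:R ->
  \sum_(1 <= d < N.+1 | nint_dist (d%:R * alpha) <= M / N%:R) shift_factor R X d <=
  expR 4 * (4 * expR (3 * expR 1) * M +
     (9 + c^-1) * Num.sqrt M * expR (3 * expR 1 * (ln (ln y%:R) / 2 + 20))).
Proof.
move=> c0 hc X N y M N0 XN y2 Ny M1N.
have y0 : (0 < y)%N by lia.
pose K : R := 3 * expR 1; have K0 : 0 < K by rewrite mulr_gt0 ?expR_gt0.
have M0 : 0 <= M by case/andP: M1N; lra.
have S0 : 0 <= Num.sqrt M := sqrtr_ge0 M.
have C0 : 0 < 9 + c^-1 by rewrite addr_gt0// invr_gt0.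
set S := Num.sqrt M in S0 *; set C := 9 + c^-1 in C0 *.
pose w (A : {set sprime y 1}) : R := \prod_(t in A) (K / (spv t)%:R).
have t0 (t : sprime y 1) : 3 <= (spv t)%:R :> R by rewrite ler_nat spv_ge3.
have w0 A : 0 <= w A by apply: prodr_ge0 => t _; rewrite divr_ge0// ltW.
apply: le_trans (_ : \sum_(1 <= d < N.+1 | nint_dist (d%:R * alpha) <= M / N%:R)
   expR 4 * \sum_(A : {set sprime y 1} | (sprod A %| d)%N) w A <= _).
  by apply: ler_sum_nat_cond => d hd _; apply: (@shift_factor_le R X N d y).
rewrite -mulr_sumr ler_wpM2l ?expR_ge0//.
under eq_bigr do rewrite big_mkcond.
rewrite exchange_big /=.
apply: le_trans (_ : \sum_(A : {set sprime y 1}) w A * (4 * M / (sprod A)%:R + C * S) <= _).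
  apply: ler_sum => A _.
  have := @bohr_multiples R alpha c c0 hc N (sprod A) M N0 (sprod_gt0 A) M1N.
  move=> h; apply: le_trans (ler_wpM2l (w0 A) h); rewrite mulr_sumr big_mkcond [leRHS]big_mkcond.
  apply: ler_sum => d _; rewrite mulr1; case: ifP => h1; case: ifP => h2 //=; rewrite ?andbT ?andbF ?h1//.
have euler (f : sprime y 1 -> R) : (forall t, 0 <= f t) ->
    \sum_(A : {set sprime y 1}) \prod_(t in A) f t <= expR (\sum_t f t).
  move=> f0; apply: le_trans (_ : \prod_(t in finset.setT) (1 + f t) <= _).
    rewrite prod_1D_subsets le_eqVlt; apply/orP; left; apply/eqP.
    by apply: eq_bigl => A; rewrite finset.subsetT.
  rewrite expR_sum big_mkcond; apply: ler_prod => t _; rewrite inE.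
  by rewrite expR_ge1Dx addr_ge0.
have -> : \sum_(A : {set sprime y 1}) w A * (4 * M / (sprod A)%:R + C * S) =
   4 * M * (\sum_(A : {set sprime y 1}) \prod_(t in A) (K / (spv t)%:R ^+ 2)) +
   C * S * \sum_(A : {set sprime y 1}) w A.
  rewrite !mulr_sumr -big_split /=; apply: eq_bigr => A _; rewrite mulrDr; congr (_ + _); last by rewrite mulrC.
  rewrite mulrCA; congr (_ * _); rewrite /w /sprod natr_prod -prodfV -big_split /=.
  by apply: eq_bigr => t _; have := t0 t => ?; field; lra.
apply: lerD.
  have -> : 4 * expR (3 * expR 1) * M = 4 * M * expR K by rewrite /K; ring.
  rewrite ler_wpM2l ?mulr_ge0//; apply: le_trans (euler _ _) _.
    by move=> t; rewrite divr_ge0// ?exprn_ge0// ltW.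
  rewrite ler_expR -mulr_sumr -[leRHS]mulr1 ler_wpM2l ?(ltW K0)//.
  rewrite (@sum_sprime R y 1 (fun p => (p%:R ^+ 2)^-1)).
  apply: le_trans (sum_inv_nn1 R y.+1).
  rewrite big_ltn_cond ?ltnS//= big_mkcond; apply: ler_sum_nat => p /andP[p2 _].
  have p1 : 1 < p%:R :> R by rewrite ltr1n.
  case: ifP => _; last by rewrite invr_ge0; nra.
  by rewrite lef_pV2 ?posrE ?exprn_gt0 ?mulr_gt0//; nra.
rewrite ler_wpM2l ?mulr_ge0 ?(ltW C0)//; apply: le_trans (euler _ _) _.
  by move=> t; rewrite divr_ge0// ltW.
rewrite ler_expR -mulr_sumr ler_wpM2l ?(ltW K0)//.
rewrite (@sum_sprime R y 1 (fun p => p%:R^-1)).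
apply: le_trans (sum_inv_prime4 R (or_intror erefl : 3%N = 1%N \/ 3%N = 3%N) y2).
rewrite big_mkcond [leRHS]big_mkcond; apply: ler_sum => p _.
by case: ifP => [/andP[-> _]|_] //; case: ifP => // _; rewrite invr_ge0.
Qed.

(** A power of [ln (ln N)] is absorbed by [(ln N) ^ (1/4)]. *)
Lemma exp_loglog_le_root (R : realType) (K : R) : 1 <= K -> exists2 L0 : R, 1 <= L0 &
  forall L y : R, L0 <= L -> 1 < y <= 2 * L ->
  expR (K * (ln (ln y) / 2 + 20)) <= Num.sqrt (Num.sqrt L).
Proof.
move=> K1; pose A := 4 * K; have A1 : 4 <= A by rewrite /A; lra.
have lA : 0 <= ln A by rewrite ln_ge0//; lra.
pose U0 := 1 + A * ln A + 40 * A.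
have U1 : 1 <= U0 by rewrite /U0; nra.
exists (expR U0) => [|L y hL /andP[y1 yL]]; first by have := expR_ge1Dx U0; lra.
have L0 : 0 < L by apply: lt_le_trans hL; exact: expR_gt0.
pose u := ln L; have uU : U0 <= u by rewrite /u -(@expRK R U0) ler_ln ?posrE ?expR_gt0.
have -> : Num.sqrt (Num.sqrt L) = expR (u / 4).
  have e1 : L = expR (u / 2) ^+ 2 by rewrite -expRM_natl mulrC divfK// /u lnK ?posrE.
  have e2 : expR (u / 2) = expR (u / 4) ^+ 2.
    by rewrite -expRM_natl; congr expR; field.
  by rewrite {1}e1 sqrtr_sqr ger0_norm ?expR_ge0// e2 sqrtr_sqr ger0_norm ?expR_ge0.
rewrite ler_expR.
have ly : ln y <= 1 + u.
  apply: le_trans (_ : ln (2 * L) <= _); first by rewrite ler_ln ?posrE//; lra.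
  by rewrite lnM ?posrE// /u; have := ln2_le1 R; lra.
have ly0 : 0 < ln y by exact: ln_gt0.
have lly : ln (ln y) <= (1 + u) / A + ln A - 1.
  apply: le_trans (_ : ln ((1 + ((1 + u) / A - 1)) * A) <= _).
    have -> : (1 + ((1 + u) / A - 1)) * A = 1 + u by field; lra.
    by rewrite ler_ln ?posrE//; lra.
  have p : 0 < (1 + u) / A by rewrite divr_gt0; lra.
  rewrite lnM ?posrE; [|lra|lra].
  by have := @le_ln1Dx R ((1 + u) / A - 1); lra.
have : K * ln (ln y) <= K * ((1 + u) / A + ln A - 1) by rewrite ler_wpM2l//; lra.
have -> : K * ((1 + u) / A + ln A - 1) = (1 + u) / 4 + A * ln A / 4 - K.
  by rewrite /A; field; lra.
by move: uU; rewrite /U0 /A; move: (ln (4 * K)) => lnA; nra.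
Qed.

(** With [M = sqrt (ln N)] and [y] about [ln N], the Euler product of
    [shift_factor_bohr_sum] is a power of [ln (ln N)], which [sqrt M] absorbs. *)
Lemma shift_factor_critical_sum (R : realType) (alpha c : R) : 0 < c ->
  (forall n, (0 < n)%N -> c <= n%:R * nint_dist (n%:R * alpha)) ->
  exists2 C : R, 0 < C & exists X0 : nat, forall X, (X0 <= X)%N ->
    \sum_(1 <= d < (X ^ 16).+1 | nint_dist (d%:R * alpha) <=
        Num.sqrt (ln (X ^ 16)%:R) / (X ^ 16)%:R) shift_factor R X d
    <= C * Num.sqrt (ln (X ^ 16)%:R).
Proof.
move=> c0 hc; pose K : R := 3 * expR 1.
have e1 : 1 <= expR 1 :> R by rewrite -[leLHS]expR0 ler_expR.
have K1 : 1 <= K by rewrite /K; lra.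
have [L0 L1 hL] := exp_loglog_le_root K1.
have C1 : 0 < 9 + c^-1 by rewrite addr_gt0// invr_gt0.
exists (expR 4 * (4 * expR K + (9 + c^-1))).
  by rewrite mulr_gt0 ?expR_gt0// addr_gt0// mulr_gt0 ?expR_gt0.
exists (Num.truncn (expR L0)).+2 => X hX.
have X2 : (2 <= X)%N by lia.
set N := (X ^ 16)%N; have XN : (X <= N)%N by rewrite /N -{1}(expn1 X) leq_exp2l.
have N0 : (0 < N)%N by exact: leq_trans (ltnW X2) XN.
have Nr : 0 < N%:R :> R by rewrite ltr0n.
set L := ln N%:R; have LL : L0 <= L.
  rewrite /L -(expRK L0) ler_ln ?posrE ?expR_gt0//.
  apply: le_trans (ltW (truncnS_gt _)) _; rewrite ler_nat.
  exact: leq_trans (ltnW hX) XN.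
have LN : L <= N%:R by rewrite ltW// ln_sublinear.
pose y := (Num.truncn L).+1.
have yL : L <= y%:R by rewrite ltW// truncnS_gt.
have tL : (Num.truncn L)%:R <= L by rewrite truncn_le; lra.
have yL2 : y%:R <= 2 * L by rewrite /y -natr1; lra.
have t1 : (0 < Num.truncn L)%N by rewrite truncn_gt0; lra.
have y2 : (2 <= y)%N by [].
have y1 : 1 < y%:R :> R by rewrite ltr1n.
have S1 : 1 <= Num.sqrt L by rewrite -[leLHS]sqrtr1 ler_wsqrtr//; lra.
have SE : Num.sqrt L ^+ 2 = L by rewrite sqr_sqrtr//; lra.
have MN : 1 <= Num.sqrt L <= N%:R by rewrite S1 /=; nra.
apply: le_trans (@shift_factor_bohr_sum R alpha c c0 hc X N y (Num.sqrt L) N0 XN y2 yL MN) _.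
rewrite -[leRHS]mulrA ler_wpM2l ?expR_ge0// [leRHS]mulrDl -/K lerD2l -[leLHS]mulrA ler_wpM2l ?(ltW C1)//.
set s := Num.sqrt (Num.sqrt L).
have sE : s ^+ 2 = Num.sqrt L by rewrite sqr_sqrtr// sqrtr_ge0.
rewrite -sE expr2 ler_wpM2l ?sqrtr_ge0//.
by apply: hL => //; rewrite y1.
Qed.

(** Keep one element, discard its at most [D] neighbours, and repeat. *)
Lemma greedy_independent (T : eqType) (e : rel T) (D : nat) (s : seq T) :
  reflexive e -> symmetric e -> uniq s ->
  (forall v, v \in s -> (count (e v) s <= D)%N) ->
  exists q : seq T, [/\ uniq q, {subset q <= s},
    {in q &, forall v w, v != w -> ~~ e v w} & (size s <= D * size q)%N].
Proof.
move=> er es; move: {2}(size s).+1 (leqnn (size s).+1) => k.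
elim: k s => // k IH [|v s] sk us hD.
  by exists [::]; rewrite muln0.
pose s' := [seq w <- s | ~~ e v w].
have ss' : {subset s' <= s} by move=> w; rewrite mem_filter => /andP[].
have [||w ws'|q [uq qs qi qsz]] := IH s'.
- by rewrite size_filter; apply: leq_ltn_trans (count_size _ _) _; rewrite -ltnS.
- by rewrite filter_uniq//; case/andP: us.
- apply: leq_trans (hD w _); last by rewrite in_cons ss' ?orbT.
  rewrite /s' count_filter /=; apply: leq_trans (leq_addl _ _).
  by apply: sub_count => x /= /andP[].
have vs : v \notin s by case/andP: us.
exists (v :: q); split=> /=.
- by rewrite uq andbT; apply: contra vs => /qs /ss'.
- move=> w; rewrite !in_cons => /orP[->//|/qs /ss' ->]; by rewrite orbT.
- move=> a b; rewrite !in_cons => /orP[/eqP ->|aq] /orP[/eqP ->|bq] ab.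
  + by rewrite eqxx in ab.
  + by have := qs _ bq; rewrite mem_filter => /andP[].
  + by rewrite es; have := qs _ aq; rewrite mem_filter => /andP[].
  + exact: qi.
- rewrite mulnS; apply: leq_trans (_ : (count (e v) (v :: s) + size s' <= _)%N); last first.
    by apply: leq_add; rewrite ?hD ?mem_head.
  have -> : count (e v) (v :: s) = (count (e v) s).+1 by rewrite /= er.
  by rewrite addSn ltnS size_filter -(count_predC (e v) s).
Qed.

(** The sieve bound for each shift, summed over the Bohr set of admissible
    shifts. *)
Lemma close_pairs (R : realType) (alpha c : R) : 0 < c ->
  (forall n, (0 < n)%N -> c <= n%:R * nint_dist (n%:R * alpha)) ->
  exists2 C : R, 0 < C & exists X0 : nat, forall X, (X0 <= X)%N ->
    \sum_(1 <= d < (X ^ 16).+1 | nint_dist (d%:R * alpha) <=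
        Num.sqrt (ln (X ^ 16)%:R) / (X ^ 16)%:R)
      \sum_(1 <= n < (X ^ 16).+1 | pnat (residue4 1) n && pnat (residue4 1) (n + d)%N) 1
    <= C * (X ^ 16)%:R / Num.sqrt (ln (X ^ 16)%:R).
Proof.
move=> c0 hc; have [C C0 [X0 hX0]] := shift_factor_critical_sum c0 hc.
have e0 := expR_gt0 (22 : R).
exists (16 * (4 * expR 22 ^+ 2 + 1) * C).
  by rewrite mulr_gt0// mulr_gt0// addr_gt0// mulr_gt0// exprn_gt0.
exists (X0 + 2)%N => X hX; have X2 : (2 <= X)%N by lia.
have lX : 0 < ln X%:R :> R by rewrite ln_gt0// ltr1n.
have hS := hX0 X ltac:(lia); set N := (X ^ 16)%N in hS *.
have LE : ln N%:R = 16 * ln X%:R :> R.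
  by rewrite /N natrX lnXn ?ltr0n ?(ltn_trans _ X2)// mulr_natl.
set L := ln N%:R in hS LE *.
have S0 : 0 < Num.sqrt L by rewrite sqrtr_gt0; lra.
have SE : Num.sqrt L ^+ 2 = L by rewrite sqr_sqrtr//; lra.
rewrite -(ler_pM2r lX) mulr_suml.
apply: le_trans (_ : \sum_(1 <= d < N.+1 | nint_dist (d%:R * alpha) <= Num.sqrt L / N%:R)
   (4 * expR 22 ^+ 2 + 1) * N%:R * shift_factor R X d <= _).
  by apply: ler_sum => d _; exact: pair_sieve.
rewrite -mulr_sumr; apply: le_trans (ler_wpM2l _ hS) _.
  by rewrite mulr_ge0// addr_ge0// mulr_ge0// exprn_ge0// ltW.
have -> : 16 * (4 * expR 22 ^+ 2 + 1) * C * N%:R / Num.sqrt L * ln X%:R =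
   (4 * expR 22 ^+ 2 + 1) * C * N%:R / Num.sqrt L * Num.sqrt L ^+ 2 by rewrite SE LE; ring.
by rewrite le_eqVlt; apply/orP; left; apply/eqP; field; lra.
Qed.

Definition well_spaced (R : realType) (alpha : R) (N : nat) (rho : R) (q : seq nat) : Prop :=
  [/\ uniq q, forall n, n \in q -> (n <= N)%N /\ sums_two_squares n &
   forall m n, m \in q -> n \in q -> m != n -> rho <= nint_dist (m%:R * alpha - n%:R * alpha)].

(** Apply [greedy_independent] to the integers in (X, X ^ 16] composed of primes
    1 mod 4, two of them being in conflict when they are closer than the critical
    radius.  By [close_pairs] the mean number of conflicts is bounded, so
    at least half of the integers have a bounded number of them.  The lower bound
    [X < n] makes the selections at infinitely many scales reach infinitely many
    integers. *)
Lemma exists_well_spaced (R : realType) (alpha : R) : badly_approximable alpha ->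
  exists2 c : R, 0 < c & exists X0 : nat, forall X, (X0 <= X)%N ->
  exists2 q : seq nat,
    well_spaced alpha (X ^ 16) (Num.sqrt (ln (X ^ 16)%:R) / (X ^ 16)%:R) q &
    (forall n, n \in q -> (X < n)%N) /\
    c <= (size q)%:R * (Num.sqrt (ln (X ^ 16)%:R) / (X ^ 16)%:R).
Proof.
move=> /badly_approximableP[b b0 hb].
have [C C0 [X1 hC]] := close_pairs b0 hb.
have [c c0 [X2 hc]] := ncount_pnat_ge R.
pose c' := c / 2; have c'0 : 0 < c' by rewrite divr_gt0.
exists (c' ^+ 2 / (8 * (c' + 2 * C))).
  by rewrite divr_gt0 ?exprn_gt0// mulr_gt0// addr_gt0// mulr_gt0.
have [X3 hX3] : exists X3 : nat, c'^-1 <= X3%:R.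
  by exists (Num.truncn c'^-1).+1; rewrite ltW// truncnS_gt.
exists (X1 + X2 + X3 + 2)%N => X hX.
have [X2' X1X X2X X3X] : [/\ 2 <= X, X1 <= X, X2 <= X & X3 <= X]%N by split; lia.
set N := (X ^ 16)%N; have XN : (X <= N)%N by rewrite /N -{1}(expn1 X) leq_exp2l.
have N0 : (0 < N)%N by exact: leq_trans (ltnW X2') XN.
have Nr : 0 < N%:R :> R by rewrite ltr0n.
set L := ln N%:R; set S := Num.sqrt L.
have lX : 0 < ln X%:R :> R by rewrite ln_gt0// ltr1n.
have LE : L = 16 * ln X%:R.
  by rewrite /L /N natrX lnXn ?ltr0n ?(ltn_trans _ X2')// mulr_natl.
have S0 : 0 < S by rewrite sqrtr_gt0; lra.
have SE : S ^+ 2 = L by rewrite sqr_sqrtr//; lra.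
set rho := S / N%:R; have rho0 : 0 < rho by rewrite divr_gt0.
pose V := [seq n <- index_iota X.+1 N.+1 | pnat (residue4 1) n].
have uV : uniq V by rewrite filter_uniq ?iota_uniq.
have VP n : n \in V -> (X < n <= N)%N /\ pnat (residue4 1) n.
  by rewrite mem_filter mem_index_iota ltnS => /andP[].
pose a := c' * N%:R / S; have a0 : 0 < a by rewrite divr_gt0// mulr_gt0.
have hV : a <= (size V)%:R.
  have -> : (size V)%:R = \sum_(X.+1 <= n < N.+1 | pnat (residue4 1) n) 1 :> R.
    by rewrite -sum1_size natr_sum big_filter.
  have h1 : c * N%:R / S <= ncount R (pnat (residue4 1)) N.
    by rewrite ler_pdivrMr//; apply: hc; exact: leq_trans XN.
  have h2 : ncount R (pnat (residue4 1)) N <= X%:R + \sum_(X.+1 <= n < N.+1 | pnat (residue4 1) n) 1.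
    rewrite /ncount (@big_cat_nat _ _ _ X.+1 1 N.+1)//= lerD2r; exact: ncount_le.
  (* the integers up to X are negligible *)
  have h3 : X%:R <= a.
    have Xr : 2 <= X%:R :> R by rewrite ler_nat.
    have S4 : S <= 4 * X%:R.
      have X4 : 0 <= 4 * X%:R :> R by lra.
      have lsub : ln X%:R < X%:R :> R by apply: ln_sublinear; lra.
      rewrite -(@ler_pXn2r _ 2)// ?nnegrE ?(ltW S0)// SE LE.
      by set l := ln X%:R in lsub *; clearbody l; clear -lsub Xr; nra.
    have cX : 1 <= c' * X%:R.
      rewrite -ler_pdivrMl// mulr1; by apply: le_trans hX3 _; rewrite ler_nat.
    rewrite ler_pdivlMr//; apply: le_trans (_ : X%:R * (4 * X%:R) <= _); first by rewrite ler_wpM2l.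
    have -> : c' * N%:R = (c' * X%:R) * (X%:R * X%:R) * X%:R ^+ 13 by rewrite /N natrX; ring.
    have X13 : 4 <= X%:R ^+ 13 :> R.
      apply: le_trans (_ : X%:R ^+ 2 <= _); first by nra.
      by rewrite ler_eXn2l//; lra.
    have XX : 0 < X%:R * X%:R :> R by nra.
    have -> : X%:R * (4 * X%:R) = X%:R * X%:R * 4 :> R by ring.
    have -> : c' * X%:R * (X%:R * X%:R) * X%:R ^+ 13 = X%:R * X%:R * (c' * X%:R * X%:R ^+ 13) by ring.
    rewrite ler_pM2l// -[leLHS]mul1r; apply: ler_pM => //.
  have : c * N%:R / S = a + a by rewrite /a /c'; field; lra.
  by lra.
have v0 : (0 < size V)%N by rewrite -(ltr_nat R); apply: lt_le_trans hV.
pose e m n : bool := nint_dist (m%:R * alpha - n%:R * alpha) < rho.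
have er : reflexive e by move=> n; rewrite /e subrr -[0]/((0 : int)%:~R) nint_dist_int.
have es : symmetric e by move=> m n; rewrite /e -nint_distN opprB.
pose P := (\sum_(v <- V) count (e v) V)%N.
(* each unordered close pair is counted twice, and the diagonal once *)
have hP : P%:R <= (size V)%:R + 2 * (C * N%:R / S).
  pose W : R := \sum_(v <- V) \sum_(w <- V) ((v < w)%N && e v w)%:R.
  have hW : W <= C * N%:R / S.
    apply: le_trans (hC X X1X); rewrite -/N -/L -/S -/rho.
    rewrite (exchange_big_dep (fun n => pnat (residue4 1) n)) /=; last by move=> d n _ /andP[].
    rewrite /W /V big_filter.
    apply: le_trans (_ : \sum_(X.+1 <= v < N.+1 | pnat (residue4 1) v)
       \sum_(1 <= d < N.+1 | (nint_dist (d%:R * alpha) <= rho) && (pnat (residue4 1) v && pnat (residue4 1) (v + d)%N)) 1 <= _); last first.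
      rewrite [leRHS](@big_cat_nat _ _ _ X.+1 1 N.+1)//= lerDr.
      by apply: sumr_ge0 => v _; exact: sumr_ge0.
    apply: ler_sum_nat_cond => v /andP[v1 vN] pv.
    rewrite big_filter big_mkcond /=.
    apply: le_trans (_ : \sum_(X.+1 <= w < N.+1 | pnat (residue4 1) w && ((v < w)%N && e v w)) 1 <= _).
      by rewrite [leRHS]big_mkcond; apply: ler_sum => w _; case: (pnat _ w) => //=; case: (_ && _).
    apply: (@ler_sum_inj _ _ _ _ _ _ _ (fun w => (w - v)%N)) => //; first exact: iota_uniq.
      move=> w w'; rewrite !mem_filter => /andP[/andP[_ /andP[vw _]] _] /andP[/andP[_ /andP[vw' _]] _].
      by move: vw vw'; clear; lia.
    move=> w; rewrite !mem_index_iota => /andP[w1 wN] /andP[pw /andP[vw evw]].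
    rewrite /= pv [X in pnat _ X](_ : _ = w); last exact: (subnKC (ltnW vw)).
    rewrite pw /= andbT; split=> //.
      by rewrite subn_gt0 vw /= ltnS (leq_trans (leq_subr _ _)).
    by rewrite natrB ?(ltnW vw)// mulrBl -nint_distN opprB ltW.
  have -> : P%:R = \sum_(v <- V) \sum_(w <- V) (e v w)%:R :> R.
    rewrite /P natr_sum; apply: eq_bigr => v _; rewrite -sum1_count natr_sum big_mkcond.
    by apply: eq_bigr => w _; case: (e v w).
  apply: le_trans (_ : \sum_(v <- V) \sum_(w <- V) ((v == w)%:R + ((v < w)%N && e v w)%:R + ((w < v)%N && e w v)%:R) <= _).
    apply: ler_sum => v _; apply: ler_sum => w _; rewrite (es w v).
    case: (ltngtP v w) => _ /=; case: (e v w); rewrite /= ?addr0 ?add0r//.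
  under eq_bigr do rewrite !big_split /=.
  rewrite !big_split /= [X in _ + X]exchange_big /= -/W.
  have -> : \sum_(v <- V) \sum_(w <- V) (v == w)%:R = (size V)%:R :> R.
    rewrite -sum1_size natr_sum big_seq [RHS]big_seq; apply: eq_bigr => v vV.
    by rewrite (bigD1_seq v)//= eqxx big1 ?addr0// => w; rewrite eq_sym => /negbTE ->.
  lra.
(* at most half of V has more conflicts than twice the mean *)
pose D := ((2 * P) %/ size V)%N.
pose V' := [seq v <- V | (count (e v) V <= D)%N].
have P0 : (size V <= P)%N.
  rewrite /P -sum1_size big_seq [leqRHS]big_seq; apply: leq_sum => v vV.
  by rewrite -has_count; apply/hasP; exists v.
have hV' : (size V <= 2 * size V')%N.
  pose B := count (fun v => ~~ (count (e v) V <= D)%N) V.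
  have sz : (size V' + B)%N = size V by rewrite size_filter count_predC.
  have hB : (B * D.+1 <= P)%N.
    rewrite /B -sum1_count big_distrl /= /P big_mkcond; apply: leq_sum => v _.
    by case: ifP => // hv; rewrite mul1n ltnNge hv.
  have hD : (2 * P < D.+1 * size V)%N by rewrite -ltn_divLR.
  clearbody B D; clearbody P; move: sz hB hD P0 v0; clear.
  by move: (size V) (size V') => x x'; nia.
have uV' : uniq V' by rewrite filter_uniq.
have dV' v : v \in V' -> (count (e v) V' <= D)%N.
  move=> vV'; apply: (@leq_trans (count (e v) V)).
    by rewrite count_filter; apply: sub_count => x /= /andP[].
  by move: vV'; rewrite mem_filter => /andP[].
have [q [uq qs qi qsz]] := greedy_independent er es uV' dV'.
have qV n : n \in q -> n \in V by move=> /qs; rewrite mem_filter => /andP[].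
exists q; first split => //.
- by move=> n /qV /VP[/andP[_ nN] pn]; split=> //; exact: pnat_sums_two_squares.
- by move=> m n mq nq mn; have := qi m n mq nq mn; rewrite /e -leNgt.
split; first by move=> n /qV /VP[/andP[]].
have main : ((size V) ^ 2 <= 4 * P * size q)%N.
  have : (D * size V <= 2 * P)%N by exact: leq_divM.
  clearbody D; clearbody P; move: hV' qsz; clear.
  by move: (size V) (size V') (size q) => x x' y; nia.
have mainr : (size V)%:R ^+ 2 <= 4 * P%:R * (size q)%:R :> R.
  by rewrite -natrX -natrM -natrM ler_nat.
have b1 : 0 < C * N%:R / S by rewrite divr_gt0// mulr_gt0.
have q0 : 0 <= (size q)%:R :> R by [].
set y : R := (size q)%:R in q0 mainr *; set v : R := (size V)%:R in hV hP mainr *.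
have h1 : v ^+ 2 <= 4 * (v + 2 * (C * N%:R / S)) * y.
  by apply: le_trans mainr _; rewrite ler_wpM2r// ler_pM2l.
have h2 : a ^+ 2 <= 4 * (a + 2 * (C * N%:R / S)) * y.
  move: h1 hV a0 b1 q0; clear; move: (C * N%:R / S) => b h1 hV a0 b1 y0.
  have vb : 0 < v + 2 * b by lra.
  rewrite -(ler_pM2r vb); apply: le_trans (_ : v ^+ 2 * (a + 2 * b) <= _).
    rewrite -subr_ge0 (_ : _ - _ = (v - a) * (v * a + 2 * b * (v + a))); last by ring.
    have va0 : 0 <= v * a by apply: mulr_ge0; lra.
    have bv0 : 0 <= 2 * b * (v + a) by apply: mulr_ge0; lra.
    by apply: mulr_ge0; lra.
  by apply: le_trans (ler_wpM2r _ h1) _; [lra|rewrite le_eqVlt; apply/orP; left; apply/eqP; ring].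
pose t := N%:R / S; have t0 : 0 < t by rewrite divr_gt0.
have aE : a = c' * t by rewrite /a /t mulrA.
have bE : C * N%:R / S = C * t by rewrite /t mulrA.
have rE : rho = t^-1 by rewrite /rho /t invf_div.
have cC : 0 < c' + 2 * C by rewrite addr_gt0// mulr_gt0.
rewrite rE ler_pdivrMr ?mulr_gt0// mulrAC ler_pdivlMr//.
move: h2; rewrite aE bE.
have -> : 4 * (c' * t + 2 * (C * t)) * y = t * (4 * (c' + 2 * C) * y) by ring.
have -> : (c' * t) ^+ 2 = t * (c' ^+ 2 * t) by ring.
rewrite ler_pM2l// => h; apply: le_trans h _.
rewrite [leRHS]mulrC ler_wpM2r//; lra.
Qed.

(** * Lengths of subsets of the unit interval *)

(** Real valued, so that inequalities between lengths are linear arithmetic; it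
    is used only on subsets of the unit interval, where no infinite value is
    lost. *)
Definition len (R : realType) (A : set R) : R := fine (lebesgue_measure A).

Definition unit_set (R : realType) (A : set R) : Prop :=
  measurable A /\ A `<=` [set` `[0, 1[].

Lemma lebesgue_unit (R : realType) : lebesgue_measure ([set` `[0, 1[] : set R) = 1%E.
Proof. by rewrite lebesgue_measure_itv /= lte_fin ltr01 oppr0 adde0. Qed.

Lemma unit_setE (R : realType) (A : set R) : unit_set A -> lebesgue_measure A = (len A)%:E.
Proof.
move=> [mA A01]; rewrite /len fineK// ge0_fin_numE ?measure_ge0//.
apply: le_lt_trans (_ : (1%E < +oo)%E); last exact: ltry.
by rewrite -(lebesgue_unit R); apply: le_measure; rewrite ?inE//=; exact: measurable_itv.
Qed.

Lemma unit_setI (R : realType) (A B : set R) : unit_set A -> measurable B -> unit_set (A `&` B).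
Proof. by move=> [mA hA] mB; split; [exact: measurableI|move=> x [/hA]]. Qed.

Lemma unit_setU (R : realType) (A B : set R) : unit_set A -> unit_set B -> unit_set (A `|` B).
Proof. by move=> [mA hA] [mB hB]; split; [exact: measurableU|move=> x [/hA|/hB]]. Qed.

Lemma unit_set0 (R : realType) : unit_set (set0 : set R).
Proof. by split. Qed.

Lemma unit_set_bigU (R : realType) (I : eqType) (s : seq I) (A : I -> set R) :
  (forall i, i \in s -> unit_set (A i)) -> unit_set (\big[setU/set0]_(i <- s) A i).
Proof.
move=> h; rewrite big_seq; apply: (big_ind (@unit_set R)) => //.
  exact: unit_set0.
by move=> X Y; exact: unit_setU.
Qed.

Lemma unit_set_bigcup (R : realType) (A : (set R)^nat) (P : set nat) :
  (forall i, P i -> unit_set (A i)) -> unit_set (\bigcup_(i in P) A i).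
Proof.
move=> h; split; first by apply: bigcup_measurable => k /h[].
by move=> x [k /h[_ hA] /hA].
Qed.

Lemma len_ge0 (R : realType) (A : set R) : 0 <= len A.
Proof. by rewrite /len fine_ge0// measure_ge0. Qed.

Lemma len_le (R : realType) (A B : set R) :
  unit_set A -> unit_set B -> A `<=` B -> len A <= len B.
Proof.
move=> uA uB AB; rewrite -lee_fin -!unit_setE//.
by apply: le_measure => //; rewrite inE; [case: uA|case: uB].
Qed.

Lemma len_le1 (R : realType) (A : set R) : unit_set A -> len A <= 1.
Proof.
move=> uA; rewrite -lee_fin -unit_setE// -(lebesgue_unit R).
by apply: le_measure; rewrite ?inE; [case: uA|exact: measurable_itv|case: uA].
Qed.

Lemma len0 (R : realType) : len (set0 : set R) = 0.
Proof. by rewrite /len measure0. Qed.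

Lemma lenU (R : realType) (A B : set R) : unit_set A -> unit_set B ->
  len (A `|` B) = len A + len B - len (A `&` B).
Proof.
move=> uA uB; have [mA _] := uA; have [mB _] := uB.
apply/eqP; rewrite -eqe EFinB EFinD -!unit_setE//.
- apply/eqP; apply: measureUfinl => //; apply: (@le_lt_trans _ _ 1%E); last exact: ltry.
  by have := len_le1 uA; rewrite -lee_fin -unit_setE.
- exact: unit_setI.
- exact: unit_setU.
Qed.

Lemma len_subitv (R : realType) (A : set R) (a b : R) : a <= b -> unit_set A ->
  A `<=` [set` `[a, b]] -> len A <= b - a.
Proof.
move=> ab uA h; rewrite -lee_fin -unit_setE//.
have -> : (b - a)%:E = lebesgue_measure ([set` `[a, b]] : set R).
  by rewrite lebesgue_measure_itv /= lte_fin; case: ltgtP ab => // ->; rewrite subrr.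
by apply: le_measure => //; rewrite inE; [case: uA|exact: measurable_itv].
Qed.

Lemma len_itv (R : realType) (a b : R) : a <= b -> len ([set` `[a, b]] : set R) = b - a.
Proof.
move=> ab; rewrite /len lebesgue_measure_itv /= lte_fin.
by case: ltgtP ab => //= ->; rewrite subrr.
Qed.

Lemma len_bigU_le (R : realType) (I : eqType) (s : seq I) (A : I -> set R) :
  (forall i, i \in s -> unit_set (A i)) ->
  len (\big[setU/set0]_(i <- s) A i) <= \sum_(i <- s) len (A i).
Proof.
elim: s => [|i s IH] h; first by rewrite !big_nil len0.
have hs : forall j, j \in s -> unit_set (A j) by move=> j js; apply: h; rewrite inE js orbT.
have hi : unit_set (A i) by apply: h; rewrite mem_head.
rewrite !big_cons lenU//; last exact: unit_set_bigU.
by have := IH hs; have := len_ge0 (A i `&` \big[setU/set0]_(j <- s) A j); lra.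
Qed.

Lemma bigU_seqP (R : realType) (I : eqType) (s : seq I) (A : I -> set R) (x : R) :
  (\big[setU/set0]_(i <- s) A i) x <-> exists2 i, i \in s & A i x.
Proof.
elim: s => [|j s IH]; first by rewrite big_nil; split => // -[].
rewrite big_cons; split => [[Ajx|/IH[i si Aix]]|[i]].
- by exists j => //; rewrite mem_head.
- by exists i => //; rewrite inE si orbT.
- by rewrite inE => /predU1P[->|si] Aix; [left|right; apply/IH; exists i].
Qed.

Lemma len_bigU (R : realType) (I : eqType) (s : seq I) (A : I -> set R) :
  uniq s -> (forall i, i \in s -> unit_set (A i)) ->
  (forall i j x, i \in s -> j \in s -> i != j -> A i x -> A j x -> False) ->
  len (\big[setU/set0]_(i <- s) A i) = \sum_(i <- s) len (A i).
Proof.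
elim: s => [|i s IH] us h dis; first by rewrite !big_nil len0.
have hs : forall j, j \in s -> unit_set (A j) by move=> j js; apply: h; rewrite inE js orbT.
have hi : unit_set (A i) by apply: h; rewrite mem_head.
move: us => /= /andP[iNs us].
rewrite !big_cons lenU//; last exact: unit_set_bigU.
rewrite IH//; last first.
  by move=> a b x sa sb; apply: dis; rewrite inE ?sa ?sb orbT.
suff -> : A i `&` \big[setU/set0]_(j <- s) A j = set0 by rewrite len0 subr0.
rewrite -subset0 => x [Aix /bigU_seqP[j js Ajx]].
apply: (dis i j x) => //; rewrite ?mem_head// ?inE ?js ?orbT//.
by apply: contraNneq iNs => ->.
Qed.

(** * The limsup set and the convergence half *)

Definition circle_arc (R : realType) (x r : R) : set R :=
  [set g | 0 <= g < 1 /\ nint_dist (x + g) <= r].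

(** The integer nearest to [x + g] is one of the three integers from [Num.floor x]
    on, so an arc is a union of three traces of intervals: this gives
    both measurability and the bound on the length. *)
Lemma circle_arcE (R : realType) (x r : R) : circle_arc x r =
  \big[setU/set0]_(j <- [:: 0; 1; 2] : seq int)
    ([set` `[0, 1[] `&` [set` `[(Num.floor x + j)%:~R - x - r, (Num.floor x + j)%:~R - x + r]]).
Proof.
have fx := floor_itv x; move: (Num.floor x) fx => f /andP[f1 f2].
apply/seteqP; split => g.
  move=> [g01 hg]; have [m mE] := nint_dist_attained (x + g).
  have h2 := nint_dist_half (x + g); rewrite mE in hg h2.
  have gf : f <= m <= f + 2.
    move: h2; rewrite ler_norml => /andP[h3 h4]; move: g01 => /andP[g0 g1].
    rewrite -ltzD1 -[m <= _]ltzD1 -!(ltr_int R) !rmorphD /= in f2 *.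
    by apply/andP; split; lra.
  apply/bigU_seqP; exists (m - f).
    rewrite !inE; move: gf; clear; lia.
  rewrite addrCA subrr addr0; split; rewrite /= in_itv //=.
  by move: hg; rewrite ler_norml => /andP[h3 h4]; apply/andP; split; lra.
move=> /bigU_seqP[j _ []]; rewrite /= !in_itv /= => g01 /andP[h1 h2]; split => //.
by apply: le_trans (nint_dist_le _ (f + j)) _; rewrite ler_norml; apply/andP; split; lra.
Qed.

Lemma unit_set_arc (R : realType) (x r : R) : unit_set (circle_arc x r).
Proof.
rewrite circle_arcE; apply: unit_set_bigU => j _; apply: unit_setI; last exact: measurable_itv.
by split => //; exact: measurable_itv.
Qed.

Lemma len_arc (R : realType) (x r : R) : 0 <= r -> len (circle_arc x r) <= 6 * r.
Proof.
move=> r0; rewrite circle_arcE; have h j : unit_set ([set` `[0, 1[] `&` [set` `[(Num.floor x + j)%:~R - x - r, (Num.floor x + j)%:~R - x + r]]).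
  apply: unit_setI; last exact: measurable_itv.
  by split => //; exact: measurable_itv.
apply: le_trans (len_bigU_le (fun j _ => h j)) _.
apply: le_trans (_ : \sum_(j <- [:: 0; 1; 2] : seq int) (2 * r) <= _).
  apply: ler_sum => j _.
  apply: le_trans (@len_subitv R _ ((Num.floor x + j)%:~R - x - r) ((Num.floor x + j)%:~R - x + r) _ (h j) _) _; first lra.
    by move=> g [].
  lra.
by rewrite !big_cons big_nil; lra.
Qed.

Lemma infinite_natP (A : set nat) : infinite_set A <-> forall N : nat, exists2 n, (N <= n)%N & A n.
Proof.
split => [h N|h fA].
  apply: contrapT => hn; apply: h; apply: (@sub_finite_set _ _ `I_N) => //.
  by move=> n An /=; rewrite ltnNge; apply/negP => Nn; apply: hn; exists n.
have [N hN] : exists N, forall n, A n -> (n < N)%N.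
  move/finite_fsetP: fA => [F FE]; exists (\max_(i <- finmap.enum_fset F) i).+1 => n An.
  rewrite ltnS; apply: leq_bigmax_seq => //.
  by move: An; rewrite FE.
by have [n Nn /hN] := h N; rewrite ltnNge Nn.
Qed.

(** Empty off the sums of two squares, so that the limsup runs over all the
    integers. *)
Definition approx_arc (R : realType) (alpha : R) (psi : nat -> R) (n : nat) : set R :=
  if `[< sums_two_squares n >] then circle_arc (n%:R * alpha) (psi n) else set0.

Lemma inhom_approx_setP (R : realType) (alpha : R) (psi : nat -> R) (g : R) :
  inhom_approx_set alpha psi g <-> 0 <= g < 1 /\
  forall N : nat, exists n : nat, [/\ (N <= n)%N, sums_two_squares n & nint_dist (n%:R * alpha + g) <= psi n].
Proof.
rewrite /inhom_approx_set /=; split => -[g01 h]; split => //.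
  by move=> N; move/infinite_natP/(_ N): h => [n Nn [? ?]]; exists n.
by apply/infinite_natP => N; have [n [? ? ?]] := h N; exists n.
Qed.

Lemma inhom_approx_setE (R : realType) (alpha : R) (psi : nat -> R) :
  inhom_approx_set alpha psi = lim_sup_set (approx_arc alpha psi).
Proof.
apply/seteqP; split => g.
  move=> /inhom_approx_setP[g01 h] N _; have [n [Nn Sn hn]] := h N.
  by exists n => //; rewrite /approx_arc; case: asboolP.
move=> h; apply/inhom_approx_setP.
have h' N : exists n : nat, [/\ (N <= n)%N, sums_two_squares n & circle_arc (n%:R * alpha) (psi n) g].
  by have [n /= Nn] := h N I; rewrite /approx_arc; case: asboolP => // Sn hn; exists n.
split; first by have [n [_ _ []]] := h' 0%N.
by move=> N; have [n [? ? []]] := h' N; exists n.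
Qed.

Lemma unit_set_lim_sup (R : realType) (F : (set R)^nat) :
  (forall n, unit_set (F n)) -> unit_set (lim_sup_set F).
Proof.
move=> h; split; last by move=> x /(_ 0%N I)[n _ /(proj2 (h n))].
apply: bigcap_measurable; first by exists 0%N.
by move=> n _; apply: bigcup_measurable => k _; case: (h k).
Qed.

Lemma unit_set_approx_arc (R : realType) (alpha : R) (psi : nat -> R) n :
  unit_set (approx_arc alpha psi n).
Proof. by rewrite /approx_arc; case: ifP => _; [exact: unit_set_arc|exact: unit_set0]. Qed.

Lemma unit_set_approx (R : realType) (alpha : R) (psi : nat -> R) :
  unit_set (inhom_approx_set alpha psi).
Proof. by rewrite inhom_approx_setE; apply: unit_set_lim_sup => n; exact: unit_set_approx_arc. Qed.

Lemma borel_cantelli_unit (R : realType) (F : (set R)^nat) (u : nat -> R) (M : R) :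
  (forall n, unit_set (F n)) -> (forall n, len (F n) <= u n) ->
  (forall N, \sum_(0 <= n < N) u n <= M) -> lebesgue_measure (lim_sup_set F) = 0%E.
Proof.
move=> uF Fu uM; apply: lim_sup_set_cvg0; first by move=> n; case: (uF n).
apply: (@le_lt_trans _ _ M%:E); last exact: ltry.
apply: lime_le; first by apply: is_cvg_nneseries => n _ _; exact: measure_ge0.
near=> N; apply: (@le_trans _ _ (\sum_(0 <= n < N) u n)%:E); last by rewrite lee_fin.
rewrite -sumEFin; apply: lee_sum => n _.
by rewrite [leLHS](unit_setE (uF n)) lee_fin.
Unshelve. all: by end_near.
Qed.

Lemma esumE (R : realType) (psi : nat -> R) : (forall n, (0 < n)%N -> 0 <= psi n) ->
  (\esum_(n in sums_two_squares) (psi n)%:E =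
   \sum_(0 <= n <oo | `[< sums_two_squares n >]) (psi n)%:E)%E.
Proof.
move=> h; rewrite nneseries_esum; last first.
  by move=> n /asboolP[n0 _]; rewrite lee_fin h.
by congr (esum _ _); apply/seteqP; split => n /=; [move=> ?; apply/asboolP|move=> /asboolP].
Qed.

Lemma esum_ltyP (R : realType) (psi : nat -> R) : (forall n, (0 < n)%N -> 0 <= psi n) ->
  (\esum_(n in sums_two_squares) (psi n)%:E < +oo)%E ->
  exists M : R, forall N, \sum_(0 <= n < N | `[< sums_two_squares n >]) psi n <= M.
Proof.
move=> h hoo; have hP n : `[< sums_two_squares n >] -> (0 <= (psi n)%:E)%E.
  by move=> /asboolP[n0 _]; rewrite lee_fin h.
have h0 : (0 <= \esum_(n in sums_two_squares) (psi n)%:E)%E.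
  by apply: esum_ge0 => n [n0 _]; rewrite lee_fin h.
exists (fine (\esum_(n in sums_two_squares) (psi n)%:E)) => N.
rewrite -lee_fin fineK ?ge0_fin_numE// esumE// -sumEFin.
by apply: nneseries_lim_ge => n _; exact: hP.
Qed.

Lemma esum_infty (R : realType) (psi : nat -> R) : (forall n, (0 < n)%N -> 0 <= psi n) ->
  (forall M : R, exists N, M <= \sum_(0 <= n < N | `[< sums_two_squares n >]) psi n) ->
  (\esum_(n in sums_two_squares) (psi n)%:E = +oo)%E.
Proof.
move=> h hM; apply/eqP; rewrite -leye_eq leNgt; apply/negP => /(esum_ltyP h)[M hle].
by have [N] := hM (M + 1); have := hle N; lra.
Qed.

Lemma esum_infty_sums (R : realType) (psi : nat -> R) : (forall n, (0 < n)%N -> 0 <= psi n) ->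
  (\esum_(n in sums_two_squares) (psi n)%:E = +oo)%E ->
  forall M : R, exists N, M <= \sum_(0 <= n < N | `[< sums_two_squares n >]) psi n.
Proof.
move=> h hoo M; apply: contrapT => hn; move: hoo; rewrite esumE// => hoo.
have : (+oo <= M%:E)%E.
  rewrite -hoo; apply: lime_le.
    apply: is_cvg_nneseries => n _ /asboolP[n0 _]; rewrite lee_fin; exact: h.
  near=> N; rewrite sumEFin lee_fin leNgt; apply/negP => hlt.
  by apply: hn; exists N; exact: ltW.
by [].
Unshelve. all: by end_near.
Qed.

Lemma approx_null (R : realType) (alpha : R) (psi : nat -> R) :
  (forall n, (0 < n)%N -> 0 <= psi n) ->
  (\esum_(n in sums_two_squares) (psi n)%:E < +oo)%E ->
  lebesgue_measure (inhom_approx_set alpha psi) = 0%E.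
Proof.
move=> h /(esum_ltyP h)[M hM]; rewrite inhom_approx_setE.
apply: (@borel_cantelli_unit R _ (fun n => 6 * (if `[< sums_two_squares n >] then psi n else 0)) (6 * M)).
- by move=> n; exact: unit_set_approx_arc.
- move=> n; rewrite /approx_arc; case: asboolP => [[n0 _]|_]; last by rewrite len0 mulr0.
  by apply: len_arc; exact: h.
- by move=> N; rewrite -mulr_sumr -big_mkcond ler_pM2l.
Qed.

(** * Divergence along geometric scales and quasi-independence *)

(** The critical radius: up to constants, the reciprocal of the number of sums of
    two squares up to [N]. *)
Definition crad (R : realType) (N : nat) : R := Num.sqrt (ln N%:R) / N%:R.

Lemma crad_gt0 (R : realType) (N : nat) : (1 < N)%N -> 0 < crad R N.
Proof. by move=> N1; rewrite divr_gt0 ?sqrtr_gt0 ?ln_gt0 ?ltr1n// ltr0n; lia. Qed.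

(** Cut the divergent series along powers of [B]: a block contributes at most
    the value of [psi] at its left end times its number of sums of two squares. *)
Lemma block_divergence (R : realType) (psi : nat -> R) (B : nat) :
  nonincreasing_nonneg psi -> (16 <= B)%N ->
  (forall M : R, exists N, M <= \sum_(0 <= n < N | `[< sums_two_squares n >]) psi n) ->
  forall (J : nat) (M : R), exists K, M <= \sum_(J <= k < K) psi (B ^ k)%N / crad R (B ^ k).
Proof.
move=> [psi0 psimon] B16 hdiv.
have [C C0 hC] := ncount_sums_two_squares_le R.
have Bk k : (0 < k)%N -> (16 <= B ^ k)%N.
  move=> k0; apply: (leq_trans B16); have := @leq_pexp2l B 1 k; rewrite expn1; apply => //; lia.
have Bk0 k : (0 < B ^ k)%N by rewrite expn_gt0; apply/orP; left; lia.
have x0 k : 0 <= psi (B ^ k)%N / crad R (B ^ k).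
  by rewrite divr_ge0 ?psi0// divr_ge0// sqrtr_ge0.
have D0 : 0 < C * B%:R by rewrite mulr_gt0// ltr0n; lia.
have block k : (0 < k)%N ->
   \sum_(B ^ k <= n < B ^ k.+1 | `[< sums_two_squares n >]) psi n <=
   C * B%:R * (psi (B ^ k)%N / crad R (B ^ k)).
  move=> k0; set s := Num.sqrt (ln (B ^ k)%:R) : R.
  have s0 : 0 < s by rewrite sqrtr_gt0 ln_gt0// ltr1n; have := Bk k k0; lia.
  have p0 : 0 <= psi (B ^ k)%N by exact: psi0.
  apply: le_trans (_ : psi (B ^ k)%N * ncount R (fun n => `[< sums_two_squares n >]) (B ^ k.+1) <= _).
    rewrite /ncount mulr_sumr.
    apply: le_trans (_ : \sum_(B ^ k <= n < (B ^ k.+1).+1 | `[< sums_two_squares n >]) psi (B ^ k)%N * 1 <= _).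
      rewrite [leRHS](@big_cat_nat _ _ _ (B ^ k.+1)) ?leq_exp2l//=; [|lia].
      rewrite -[leLHS]addr0 lerD//; last by apply: sumr_ge0 => i _; rewrite mulr1.
      apply: ler_sum_nat_cond => n /andP[h1 _] _; rewrite mulr1; apply: psimon => //.
    rewrite [leRHS](@big_cat_nat _ _ _ (B ^ k)%N) ?Bk0//=; last first.
      by apply: leqW; rewrite leq_exp2l//; lia.
    by rewrite lerDr; apply: sumr_ge0 => i _; rewrite mulr1.
  have hc := hC (B ^ k.+1)%N (Bk k.+1 isT).
  have hs : s <= Num.sqrt (ln (B ^ k.+1)%:R).
    apply: ler_wsqrtr; rewrite ler_ln ?posrE ?ltr0n ?Bk0// ler_nat leq_exp2l//; lia.
  have hc2 : ncount R (fun n => `[< sums_two_squares n >]) (B ^ k.+1) * s <= C * (B ^ k.+1)%:R.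
    by apply: le_trans hc; rewrite ler_wpM2l// ncount_ge0.
  rewrite -(ler_pM2r s0) -[leLHS]mulrA; apply: le_trans (ler_wpM2l p0 hc2) _.
  rewrite /crad -/s expnS natrM le_eqVlt; apply/orP; left; apply/eqP; field.
  by rewrite pnatr_eq0 -lt0n Bk0 gt_eqF.
have upto J K : (0 < J)%N -> (J <= K)%N ->
   \sum_(0 <= n < B ^ K | `[< sums_two_squares n >]) psi n <=
   \sum_(0 <= n < B ^ J | `[< sums_two_squares n >]) psi n +
   C * B%:R * \sum_(J <= k < K) psi (B ^ k)%N / crad R (B ^ k).
  move=> J0; elim: K => [|K IH]; first by case: J J0.
  rewrite leq_eqVlt => /predU1P[<-|]; first by rewrite [X in _ * X]big_geq ?leqnn// mulr0 addr0.
  rewrite ltnS => JK; rewrite (@big_cat_nat _ _ _ (B ^ K)%N) ?leq_exp2l//=; last lia.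
  rewrite big_nat_recr//= mulrDr addrA; apply: lerD (IH JK) _.
  by apply: block; exact: leq_trans JK.
move=> J M; pose J' := J.+1.
have [N hN] := hdiv (\sum_(0 <= n < B ^ J' | `[< sums_two_squares n >]) psi n + C * B%:R * M).
pose K := maxn J' N; exists K.
have JK : (J' <= K)%N by exact: leq_maxl.
have NK : (N <= B ^ K)%N.
  apply: leq_trans (leq_maxr J' N) _; apply: ltnW; apply: ltn_expl; lia.
have := upto J' K isT JK.
have : \sum_(0 <= n < N | `[< sums_two_squares n >]) psi n <=
       \sum_(0 <= n < B ^ K | `[< sums_two_squares n >]) psi n.
  rewrite [leRHS](@big_cat_nat _ _ _ N)//= lerDl; apply: sumr_ge0 => n /asboolP[n0 _].
  exact: psi0.
move=> h1 h2; have : C * B%:R * M <= C * B%:R * \sum_(J' <= k < K) psi (B ^ k)%N / crad R (B ^ k) by lra.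
rewrite ler_pM2l// => h; apply: le_trans h _.
by rewrite [leRHS]big_ltn ?lerDr//; exact: leq_trans JK.
Qed.

Lemma len_bonferroni (R : realType) (A : (set R)^nat) (J K : nat) :
  (forall k, unit_set (A k)) ->
  \sum_(J <= k < K) (len (A k) - \sum_(J <= i < k) len (A i `&` A k)) <=
  len (\big[setU/set0]_(J <= k < K) A k).
Proof.
move=> uA; have [KJ|] := leqP K J; first by rewrite !big_geq// len0.
move=> /ltnW; elim: K => [|K IH]; first by rewrite leqn0 => /eqP ->; rewrite !big_geq// len0.
rewrite leq_eqVlt => /predU1P[->|]; first by rewrite !big_geq// len0.
rewrite ltnS => JK; rewrite !big_nat_recr//= lenU//; last by apply: unit_set_bigU => i _.
have -> : (\big[setU/set0]_(J <= i < K) A i) `&` A K = \big[setU/set0]_(J <= i < K) (A i `&` A K).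
  apply/seteqP; split => x.
    by move=> [/bigU_seqP[i iJ Aix] AKx]; apply/bigU_seqP; exists i.
  by move=> /bigU_seqP[i iJ [Aix AKx]]; split => //; apply/bigU_seqP; exists i.
have := @len_bigU_le R _ (index_iota J K) (fun i => A i `&` A K)
  (fun i _ => unit_setI (uA i) (proj1 (uA K))).
by have := IH JK; lra.
Qed.

(** Continuity from above of the measure along the tails. *)
Lemma len_lim_sup_ge (R : realType) (F : (set R)^nat) (v : R) :
  (forall n, unit_set (F n)) ->
  (forall n, exists K, v <= len (\big[setU/set0]_(n <= k < K) F k)) ->
  v <= len (lim_sup_set F).
Proof.
move=> uF h; rewrite -lee_fin -unit_setE; last exact: unit_set_lim_sup.
have uU n : unit_set (\bigcup_(k in [set k | (n <= k)%N]) F k).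
  by apply: unit_set_bigcup => i _.
have hc := @lim_sup_set_cvg _ _ R (@lebesgue_measure R) F (fun k => proj1 (uF k)).
have := hc _; rewrite [X in (X < _)%E](unit_setE (uU 0%N)) ltry => /(_ isT) {}hc.
rewrite -(cvg_lim _ hc)//; apply: lime_ge; first by apply/cvg_ex; exists (lebesgue_measure (lim_sup_set F)).
near=> n; rewrite [leRHS](unit_setE (uU n)) lee_fin.
have [K hK] := h n; apply: le_trans hK _; apply: len_le => //.
  by apply: unit_set_bigU.
by move=> x /bigU_seqP[i]; rewrite mem_index_iota => /andP[ni _] Fix; exists i.
Unshelve. all: by end_near.
Qed.

(** On a window where the masses [a k] add up to between [c / 16] and [c / 8],
    the pairwise overlaps are at most half of the total length, and the
    Bonferroni inequality leaves the union a length of at least [c / 2] times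
    [c / 16]. *)
Lemma quasi_independent (R : realType) (A : (set R)^nat) (a : nat -> R) (c : R) :
  0 < c -> (forall k, unit_set (A k)) ->
  (forall k, 0 <= a k <= c / 16) -> (forall k, c * a k <= len (A k)) ->
  (forall J k, \sum_(J <= i < k) len (A i `&` A k) <= a k * (2 * \sum_(J <= i < k) a i + c / 4)) ->
  (forall (J : nat) (M : R), exists K, M <= \sum_(J <= k < K) a k) ->
  c ^+ 2 / 32 <= len (lim_sup_set A).
Proof.
move=> c0 uA ab hA hI adiv; apply: len_lim_sup_ge => // J.
have a0 k : 0 <= a k by case/andP: (ab k).
have hex : exists K, (c / 16 <= \sum_(J <= k < K) a k).
  by have [K hK] := adiv J (c / 16); exists K.
case: (ex_minnP hex) => K hK Kmin; exists K.
apply: le_trans (len_bonferroni J K uA).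
set s := \sum_(J <= k < K) a k in hK *.
have s8 : s <= c / 8.
  have [KJ|JK] := leqP K J; first by rewrite /s big_geq//; lra.
  move: JK hK Kmin; rewrite /s; case: K {s} => // K; rewrite ltnS => JK hK Kmin.
  rewrite big_nat_recr//=; have /andP[_ aK] := ab K.
  have : \sum_(J <= k < K) a k < c / 16.
    by rewrite ltNge; apply/negP => /Kmin; rewrite ltnn.
  by lra.
apply: le_trans (_ : \sum_(J <= k < K) (a k * (c - 2 * s - c / 4)) <= _); last first.
  apply: ler_sum_nat => k /andP[Jk kK]; apply: le_trans (lerB (hA k) (hI J k)).
  have -> : c * a k - a k * (2 * \sum_(J <= i < k) a i + c / 4) = a k * (c - 2 * \sum_(J <= i < k) a i - c / 4) by ring.
  rewrite ler_wpM2l//; suff : \sum_(J <= i < k) a i <= s by lra.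
  rewrite /s [leRHS](@big_cat_nat _ _ _ k)//= ?(ltnW kK)//.
  by rewrite lerDl sumr_ge0.
by rewrite -mulr_suml -/s; nra.
Qed.

(** * A uniform lower bound for the measure of the limsup set *)

(** The gamma in [0, 1) for which [n alpha + gamma] is an integer. *)
Definition landing (R : realType) (alpha : R) (n : nat) : R :=
  - (n%:R * alpha) - (Num.floor (- (n%:R * alpha)))%:~R.

Lemma landing_itv (R : realType) (alpha : R) (n : nat) : 0 <= landing alpha n < 1.
Proof.
have /andP[h1 h2] := floor_itv (- (n%:R * alpha)).
by rewrite rmorphD /= in h2; rewrite /landing; apply/andP; split; lra.
Qed.

Lemma landing_dist (R : realType) (alpha : R) (n : nat) (g : R) :
  nint_dist (n%:R * alpha + g) <= `|g - landing alpha n|.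
Proof.
apply: le_trans (nint_dist_le _ (- Num.floor (- (n%:R * alpha)))) _.
rewrite rmorphN /= /landing le_eqVlt; apply/orP; left; apply/eqP; congr (`|_|); ring.
Qed.

Lemma landing_sep (R : realType) (alpha : R) (m n : nat) :
  nint_dist (m%:R * alpha - n%:R * alpha) <= `|landing alpha m - landing alpha n|.
Proof.
rewrite -nint_distN; apply: le_trans (nint_dist_le _ (Num.floor (- (m%:R * alpha)) - Num.floor (- (n%:R * alpha)))) _.
rewrite rmorphB /= /landing le_eqVlt; apply/orP; left; apply/eqP; congr (`|_|); ring.
Qed.

(** Half of the arc of radius [r]: the half that stays inside the unit interval,
    which keeps the segments intervals of length exactly [r]. *)
Definition segment (R : realType) (alpha r : R) (n : nat) : set R :=
  let y := landing alpha n in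
  if y < 2^-1 then [set` `[y, y + r]] else [set` `[y - r, y]].

Lemma segment_near (R : realType) (alpha r : R) (n : nat) (g : R) : 0 <= r ->
  segment alpha r n g -> `|g - landing alpha n| <= r.
Proof.
move=> r0; rewrite /segment; case: ifP => _; rewrite /= in_itv /= => /andP[h1 h2];
  by rewrite ler_norml; apply/andP; split; lra.
Qed.

Lemma segmentE (R : realType) (alpha r : R) (n : nat) :
  exists u, segment alpha r n = [set` `[u, u + r]].
Proof.
rewrite /segment; case: ifP => _; first by eexists.
by exists (landing alpha n - r); rewrite subrK.
Qed.

Lemma unit_set_segment (R : realType) (alpha r : R) (n : nat) : 0 <= r <= 4^-1 ->
  unit_set (segment alpha r n).
Proof.
move=> /andP[r0 r4]; have /andP[y0 y1] := landing_itv alpha n.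
split; first by rewrite /segment; case: ifP => _; exact: measurable_itv.
move=> g; rewrite /segment; case: ltP => h; rewrite /= !in_itv /= => /andP[h1 h2];
  by apply/andP; split; lra.
Qed.

Lemma len_segment (R : realType) (alpha r : R) (n : nat) : 0 <= r ->
  len (segment alpha r n) = r.
Proof. by move=> r0; have [u ->] := segmentE alpha r n; rewrite len_itv; lra. Qed.

Definition segments (R : realType) (alpha r : R) (q : seq nat) : set R :=
  \big[setU/set0]_(n <- q) segment alpha r n.

Lemma unit_set_segments (R : realType) (alpha r : R) (q : seq nat) : 0 <= r <= 4^-1 ->
  unit_set (segments alpha r q).
Proof. by move=> r4; apply: unit_set_bigU => n _; exact: unit_set_segment. Qed.

Lemma well_spaced_landing (R : realType) (alpha rho : R) (N : nat) (q : seq nat) :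
  well_spaced alpha N rho q -> forall m n, m \in q -> n \in q -> m != n ->
  rho <= `|landing alpha m - landing alpha n|.
Proof. by move=> [_ _ h] m n mq nq mn; apply: le_trans (h m n mq nq mn) (landing_sep _ _ _). Qed.

Lemma well_spaced_size (R : realType) (alpha rho : R) (N : nat) (q : seq nat) :
  0 < rho <= 1 -> well_spaced alpha N rho q -> (size q)%:R <= 2 / rho.
Proof.
move=> /andP[r0 r1] wq; have [uq _ _] := wq.
have := @packing R _ q (landing alpha) 0 1 rho r0 uq ler01 (fun i _ => _) (well_spaced_landing wq).
move=> h; apply: le_trans (h _) _.
  by move=> i; have /andP[h1 h2] := landing_itv alpha i; rewrite h1 ltW.
have : 1 <= 1 / rho by rewrite ler_pdivlMr// mul1r.
by rewrite subr0; lra.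
Qed.

Lemma len_segments (R : realType) (alpha rho r : R) (N : nat) (q : seq nat) :
  well_spaced alpha N rho q -> 0 <= r <= 4^-1 -> 2 * r < rho ->
  len (segments alpha r q) = (size q)%:R * r.
Proof.
move=> wq r4 rr; have r0 : 0 <= r by case/andP: r4.
have [uq _ _] := wq.
rewrite /segments len_bigU//.
- rewrite (eq_bigr (fun=> r)); first by rewrite big_const_seq count_predT iter_addr_0 mulr_natl.
  by move=> n _; rewrite len_segment.
- by move=> n _; exact: unit_set_segment.
move=> m n x mq nq mn /(segment_near r0) h1 /(segment_near r0) h2.
have := well_spaced_landing wq mq nq mn.
have : `|landing alpha m - landing alpha n| <= `|x - landing alpha n| + `|x - landing alpha m|.
  have -> : landing alpha m - landing alpha n = (x - landing alpha n) - (x - landing alpha m) by ring.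
  exact: ler_normB.
by lra.
Qed.

(** Only the segments whose landing point lies in the window enlarged by [r]
    matter, and separation bounds their number. *)
Lemma len_window_segments (R : realType) (alpha rho r u v : R) (N : nat) (q : seq nat) :
  well_spaced alpha N rho q -> 0 < rho -> 0 <= r <= 4^-1 -> 2 * r <= rho -> u <= v ->
  len ([set` `[u, v]] `&` segments alpha r q) <= ((v - u) / rho + 2) * r.
Proof.
move=> wq rho0 r4 rr uv; have r0 : 0 <= r by case/andP: r4.
have [uq _ _] := wq.
pose q' := [seq n <- q | u - r <= landing alpha n <= v + r].
have uS n : unit_set (segment alpha r n `&` [set` `[u, v]]).
  by apply: unit_setI; [exact: unit_set_segment|exact: measurable_itv].
have sz : (size q')%:R <= (v - u) / rho + 2.
  apply: le_trans (@packing R _ q' (landing alpha) (u - r) (v + r) rho rho0 _ _ _ _) _.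
  - by rewrite filter_uniq.
  - lra.
  - by move=> i; rewrite mem_filter => /andP[].
  - move=> i j; rewrite !mem_filter => /andP[_ iq] /andP[_ jq].
    exact: well_spaced_landing wq _ _ iq jq.
  have -> : v + r - (u - r) = (v - u) + 2 * r by ring.
  rewrite mulrDl; have : 2 * r / rho <= 1 by rewrite ler_pdivrMr// mul1r.
  by lra.
apply: le_trans (_ : (size q')%:R * r <= _); last by rewrite ler_wpM2r.
apply: le_trans (_ : len (\big[setU/set0]_(n <- q') (segment alpha r n `&` [set` `[u, v]])) <= _).
  apply: len_le.
  - rewrite setIC; apply: unit_setI; last exact: measurable_itv.
    exact: unit_set_segments.
  - exact: unit_set_bigU.
  move=> x [xuv /bigU_seqP[n nq xn]]; apply/bigU_seqP; exists n => //.
  rewrite mem_filter nq andbT; have := segment_near r0 xn.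
  move: xuv; rewrite /= in_itv /= ler_norml => /andP[h1 h2] /andP[h3 h4].
  by apply/andP; split; lra.
apply: le_trans (len_bigU_le _) _; first by move=> n _.
rewrite -mulr_natl mulr1 -sum1_size natr_sum mulr_suml; apply: ler_sum => n _.
rewrite mul1r -[leRHS](@len_segment R alpha r n r0).
by apply: len_le => //; exact: unit_set_segment.
Qed.

Lemma len_segmentsI (R : realType) (alpha rho r r' : R) (N : nat) (q q' : seq nat) :
  well_spaced alpha N rho q -> 0 < rho -> 0 <= r <= 4^-1 -> 2 * r <= rho -> 0 <= r' <= 4^-1 ->
  len (segments alpha r' q' `&` segments alpha r q) <= (size q')%:R * ((r' / rho + 2) * r).
Proof.
move=> wq rho0 r4 rr r4'; have r0' : 0 <= r' by case/andP: r4'.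
have uq := unit_set_segments alpha q r4.
have uS n : unit_set (segment alpha r' n `&` segments alpha r q).
  by apply: unit_setI; [exact: unit_set_segment|case: uq].
apply: le_trans (_ : len (\big[setU/set0]_(n <- q') (segment alpha r' n `&` segments alpha r q)) <= _).
  apply: len_le; first by apply: unit_setI; [exact: unit_set_segments|case: uq].
    exact: unit_set_bigU.
  by move=> x [/bigU_seqP[n nq xn] xq]; apply/bigU_seqP; exists n.
apply: le_trans (len_bigU_le _) _; first by move=> n _.
rewrite -sum1_size natr_sum mulr_suml; apply: ler_sum => n _; rewrite mul1r.
have [u ->] := segmentE alpha r' n.
have -> : r' / rho = (u + r' - u) / rho by rewrite addrC addKr.
by apply: len_window_segments wq _ _ _ _ => //; lra.
Qed.

Lemma crad_le1 (R : realType) (N : nat) : (0 < N)%N -> crad R N <= 1.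
Proof.
move=> N0; have n0 : 0 < N%:R :> R by rewrite ltr0n.
rewrite /crad ler_pdivrMr// mul1r -[leRHS]ger0_norm ?(ltW n0)// -sqrtr_sqr.
apply: ler_wsqrtr; have := @ln_sublinear R _ n0.
have : 1 <= N%:R :> R by rewrite ler1n.
by nra.
Qed.

(** The square root of [(k + 1) / k] is at most 2. *)
Lemma crad_step (R : realType) (B k : nat) : (1 < B)%N -> (0 < k)%N ->
  crad R (B ^ k.+1) <= 2 / B%:R * crad R (B ^ k).
Proof.
move=> B1 k0; have b0 : 0 < B%:R :> R by rewrite ltr0n; lia.
have bk : 0 < (B ^ k)%:R :> R by rewrite ltr0n expn_gt0; lia.
have lB : 0 <= ln B%:R :> R by apply: ln_ge0; rewrite ler1n; lia.
have lE m : ln (B ^ m)%:R = m%:R * ln B%:R :> R by rewrite natrX lnXn// mulr_natl.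
have h : Num.sqrt (ln (B ^ k.+1)%:R) <= 2 * Num.sqrt (ln (B ^ k)%:R) :> R.
  have -> : 2 * Num.sqrt (ln (B ^ k)%:R) = Num.sqrt (2 ^+ 2 * ln (B ^ k)%:R) :> R.
    by rewrite sqrtrM ?sqr_ge0// sqrtr_sqr ger0_norm.
  apply: ler_wsqrtr; rewrite !lE mulrA ler_wpM2r// -natrX -natrM ler_nat; lia.
rewrite /crad expnS natrM ler_pdivrMr ?mulr_gt0//.
have -> : 2 / B%:R * (Num.sqrt (ln (B ^ k)%:R) / (B ^ k)%:R) * (B%:R * (B ^ k)%:R) = 2 * Num.sqrt (ln (B ^ k)%:R) :> R.
  by field; rewrite !gt_eqF.
by rewrite -natrM -expnS.
Qed.

(** By [crad_step] the reciprocals grow at least geometrically, so their sum is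
    dominated by its last term, with a gain of [1 / B]. *)
Lemma sum_inv_crad (R : realType) (B J k : nat) : (4 <= B)%N -> (0 < J)%N ->
  (\sum_(J <= i < k) (crad R (B ^ i))^-1) * crad R (B ^ k) <= 4 / B%:R.
Proof.
move=> B4 J0; have b4 : 4 <= B%:R :> R by rewrite (ler_nat R 4).
have q0 : 0 <= 4 / B%:R :> R by rewrite divr_ge0.
have q1 : 4 / B%:R <= 1 :> R by rewrite ler_pdivrMr ?mul1r//; lra.
have [kJ|] := leqP k J; first by rewrite big_geq// mul0r.
move=> /ltnW; elim: k => [|k IH]; first by case: J J0.
rewrite leq_eqVlt => /predU1P[<-|]; first by rewrite big_geq ?leqnn// mul0r.
rewrite ltnS => Jk; rewrite big_nat_recr//=.
have k0 : (0 < k)%N by exact: leq_trans Jk.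
have ck : 0 < crad R (B ^ k).
  by apply: crad_gt0; apply: leq_trans (ltn_expl k (_ : 1 < B)%N); lia.
set T := \sum_(J <= i < k) _ in IH *.
have h := @crad_step R B k (leq_trans (isT : 1 < 4)%N B4) k0.
apply: le_trans (_ : (T + (crad R (B ^ k))^-1) * (2 / B%:R * crad R (B ^ k)) <= _).
  rewrite ler_wpM2l// addr_ge0 ?invr_ge0 ?(ltW ck)// sumr_ge0// => i _.
  by rewrite invr_ge0 divr_ge0// sqrtr_ge0.
have -> : (T + (crad R (B ^ k))^-1) * (2 / B%:R * crad R (B ^ k)) = 2 / B%:R * (T * crad R (B ^ k) + 1).
  by field; apply/andP; split; lra.
have := IH Jk; have : 0 <= 2 / B%:R :> R by rewrite divr_ge0.
move: (T * _) => t; have -> : 4 / B%:R = 2 / B%:R * 2 :> R by ring.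
by move=> hq ht; apply: ler_wpM2l => //; lra.
Qed.

(** Either the truncation is eventually inactive, or it contributes [kappa]
    infinitely often. *)
Lemma sum_min_div (R : realType) (x : nat -> R) (kappa : R) : 0 < kappa ->
  (forall k, 0 <= x k) -> (forall (J : nat) (M : R), exists K, M <= \sum_(J <= k < K) x k) ->
  forall (J : nat) (M : R), exists K, M <= \sum_(J <= k < K) Num.min (x k) kappa.
Proof.
move=> kp x0 xdiv J M; have m0 k : 0 <= Num.min (x k) kappa by rewrite le_min x0 ltW.
have [[J0 hJ0]|] := pselect (exists J0, forall k, (J0 <= k)%N -> x k < kappa).
  have [K hK] := xdiv (maxn J J0) M; exists K; apply: le_trans hK _.
  have -> : \sum_(maxn J J0 <= k < K) x k = \sum_(maxn J J0 <= k < K) Num.min (x k) kappa.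
    apply: eq_big_nat => k /andP[h _]; rewrite min_l// ltW// hJ0//.
    exact: leq_trans (leq_maxr _ _) h.
  have [h|h] := leqP K (maxn J J0); first by rewrite big_geq// sumr_ge0.
  rewrite [leRHS](@big_cat_nat _ _ _ (maxn J J0)) ?leq_maxl ?(ltnW h)//=.
  by rewrite lerDr sumr_ge0.
move=> hn; have hex N : exists2 k, (N <= k)%N & kappa <= x k.
  apply: contrapT => h; apply: hn; exists N => k Nk; rewrite ltNge; apply/negP => hk.
  by apply: h; exists k.
suff [K hK] : exists K, (Num.truncn (M / kappa)).+1%:R * kappa <= \sum_(J <= k < K) Num.min (x k) kappa.
  exists K; apply: le_trans hK; rewrite -ler_pdivrMr//; apply: ltW; exact: truncnS_gt.
elim: (Num.truncn _).+1 => [|m [K IH]]; first by exists J; rewrite big_geq// mul0r.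
have [k hk xk] := hex (maxn J K); exists k.+1; rewrite big_nat_recr /=; last first.
  exact: leq_trans (leq_maxl _ _) hk.
rewrite -natr1 mulrDl mul1r lerD ?(min_r xk)//; apply: le_trans IH _.
have [h|h] := leqP K J; first by rewrite [leLHS]big_geq// sumr_ge0.
rewrite [leRHS](@big_cat_nat _ _ _ K) ?(ltnW h) ?(leq_trans (leq_maxr J K) hk)//=.
by rewrite lerDl sumr_ge0.
Qed.

(** The lower bound does not depend on [psi]: this uniformity is what lets it be
    upgraded to full measure.  At scale [B ^ k] the segments have length
    [psi (B ^ k)], truncated at a small multiple of the critical radius; the base
    [B] is taken large in terms of the constant of [exists_well_spaced], so that
    the overlaps coming from the resolution of the coarser scales are negligible.
    The base is a sixteenth power because the selection is available at sixteenth
    powers. *)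
Lemma approx_positive (R : realType) (alpha : R) : badly_approximable alpha ->
  exists b : nat, (2 <= b)%N /\ exists2 v : R, 0 < v &
    forall psi : nat -> R, nonincreasing_nonneg psi ->
    (forall (J : nat) (M : R), exists K,
      M <= \sum_(J <= k < K) psi ((b ^ 16) ^ k)%N / crad R ((b ^ 16) ^ k)) ->
    v <= len (inhom_approx_set alpha psi).
Proof.
move=> /exists_well_spaced[c0 c00 [X0 hX]].
pose c := Num.min c0 1; have cp : 0 < c by rewrite lt_min c00 ltr01.
have c1 : c <= 1 by rewrite ge_min lexx orbT.
have cc0 : c <= c0 by rewrite ge_min lexx.
pose b := (Num.truncn (64 / c)).+2; pose B := (b ^ 16)%N.
have b2 : (2 <= b)%N by [].
have Bb : (b <= B)%N by rewrite /B -{1}[b]expn1 leq_exp2l.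
have bc : 64 / c <= b%:R.
  by apply: ltW; apply: lt_trans (truncnS_gt (64 / c)) _; rewrite ltr_nat.
have Bc : 16 / B%:R <= c / 4.
  have bB : b%:R <= B%:R :> R by rewrite ler_nat.
  have B0 : 0 < B%:R :> R by rewrite ltr0n; lia.
  rewrite ler_pdivrMr//; have : 64 <= b%:R * c by rewrite -ler_pdivrMr.
  have : b%:R * c <= B%:R * c by rewrite ler_wpM2r// ltW.
  by lra.
have B4 : (4 <= B)%N by apply: leq_trans (_ : (2 ^ 16 <= B)%N) => //; rewrite leq_exp2r.
clearbody b; exists b; split => //; exists (c ^+ 2 / 32); first by rewrite divr_gt0// exprn_gt0.
move=> psi [psi0 psimon]; rewrite -/B => psidiv.
(* the scales start beyond the threshold of the selection *)
pose e k := (k + X0.+1)%N; pose N k := (B ^ e k)%N; pose rho k := crad R (N k).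
have NE k : N k = ((b ^ e k) ^ 16)%N by rewrite /N /B -!expnM mulnC.
have bX k : (e k <= b ^ e k)%N by apply: ltnW; exact: ltn_expl.
have /choice[q qP] : forall k, exists q, well_spaced alpha (N k) (rho k) q /\
   (forall n, n \in q -> (b ^ e k < n)%N) /\ c <= (size q)%:R * rho k.
  move=> k; have Xk : (X0 <= b ^ e k)%N by apply: leq_trans (bX k); rewrite /e; lia.
  have [q wq [qlow qsz]] := hX _ Xk; exists q; rewrite /rho /crad NE; split => //; split => //.
  exact: le_trans cc0 qsz.
have N1 k : (1 < N k)%N by apply: leq_trans (ltn_expl (e k) (_ : 1 < B)%N) => //; rewrite /e; lia.
have rho0 k : 0 < rho k by exact: crad_gt0.
have rho1 k : rho k <= 1 by apply: crad_le1; exact: ltnW.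
have wq k := (qP k).1.
(* the normalised radius and its truncation *)
pose x k := psi (N k) / rho k; pose a k := Num.min (x k) (c / 16).
have x0 k : 0 <= x k by rewrite divr_ge0 ?(ltW (rho0 k))// psi0// ltnW.
have a0 k : 0 <= a k by rewrite le_min x0 divr_ge0// ltW.
have ac k : a k <= c / 16 by rewrite ge_min lexx orbT.
pose r k := a k * rho k.
have r0 k : 0 <= r k by rewrite mulr_ge0// ltW.
have rrho k : 2 * r k < rho k.
  have : 2 * a k < 1 by have := ac k; lra.
  by rewrite /r mulrA => h; rewrite -[ltRHS]mul1r ltr_pM2r.
have r4 k : 0 <= r k <= 4^-1.
  rewrite r0 /=; have := ac k; have := a0 k; have := rho1 k; have := rho0 k.
  by rewrite /r => *; apply: le_trans (_ : a k * 1 <= _); [rewrite ler_wpM2l|lra].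
have rpsi k : r k <= psi (N k).
  rewrite /r -ler_pdivlMr//; by rewrite ge_min lexx.
pose A k := segments alpha (r k) (q k).
have uA k : unit_set (A k) by exact: unit_set_segments.
apply: (@le_trans _ _ (len (lim_sup_set A))); last first.
  apply: len_le; [exact: unit_set_lim_sup|exact: unit_set_approx|].
  move=> g hg; apply/inhom_approx_setP.
  have hg' K : exists2 k, (K <= k)%N & A k g by have [k /= Kk Akg] := hg K I; exists k.
  split; first by have [k _ /(proj2 (uA k))] := hg' 0%N; rewrite /= in_itv.
  move=> K; have [k Kk /bigU_seqP[n nq gn]] := hg' K; exists n.
  have [[_ qS _] [qlow _]] := qP k; have [nN nS] := qS n nq; split => //.
    apply: leq_trans (ltnW (qlow n nq)); apply: leq_trans (bX k); rewrite /e; lia.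
  apply: le_trans (landing_dist _ _ _) _; apply: le_trans (segment_near (r0 k) gn) _.
  by apply: le_trans (rpsi k) _; apply: psimon => //; case: nS.
apply: (@quasi_independent R A a c) => //.
- by move=> k; rewrite a0 ac.
- move=> k; rewrite (len_segments (wq k) (r4 k) (rrho k)) /r mulrCA [leLHS]mulrC.
  by apply: ler_wpM2l => //; exact: (qP k).2.2.
- move=> J k; apply: le_trans (_ : \sum_(J <= i < k) (a k * (2 * a i + 4 * ((rho i)^-1 * rho k))) <= _).
    apply: ler_sum_nat => i _.
    apply: le_trans (len_segmentsI (q i) (wq k) (rho0 k) (r4 k) (ltW (rrho k)) (r4 i)) _.
    have := @well_spaced_size R alpha (rho i) (N i) (q i) _ (wq i).
    rewrite rho0 rho1 => /(_ isT) hs.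
    apply: le_trans (ler_wpM2r _ hs) _.
      by rewrite mulr_ge0// addr_ge0// divr_ge0 ?(ltW (rho0 k)).
    rewrite /r le_eqVlt; apply/orP; left; apply/eqP; field.
    by rewrite !gt_eqF.
  rewrite -mulr_sumr ler_wpM2l// big_split/= -!mulr_sumr lerD2l -mulr_suml.
  have := @sum_inv_crad R B (J + X0.+1)%N (e k) B4 (ltn_addl _ (ltn0Sn _)).
  rewrite big_addn /e addnK -/(e k) -/(N k) -/(rho k) => h.
  have -> : c / 4 = 4 * (c / 16) by field.
  rewrite ler_pM2l//; apply: le_trans h _.
  by lra.
apply: sum_min_div => //; first by rewrite divr_gt0.
move=> J M; have [K hK] := psidiv (J + X0.+1)%N M.
by exists (K - X0.+1)%N; rewrite big_addn in hK.
Qed.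

(** * From positive to full measure *)

Lemma measurable_affine (R : realType) (b m : R) :
  measurable_fun [set: measurableTypeR R] (fun x : measurableTypeR R => b * x - m : measurableTypeR R).
Proof.
by apply: measurable_realfun.measurable_funB => //; exact: measurable_realfun.mulrl_measurable.
Qed.

(** Uniqueness of the Lebesgue measure, applied to the image measure rescaled
    by [b]. *)
Lemma lebesgue_measure_affine (R : realType) (b m : R) (A : set R) : 0 < b -> measurable A ->
  lebesgue_measure A = (b%:E * lebesgue_measure [set x | A (b * x - m)%R])%E.
Proof.
move=> b0 mA; pose g : measurableTypeR R -> measurableTypeR R := fun x => b * x - m.
have mg : measurable_fun [set: measurableTypeR R] g by exact: measurable_affine.
pose nu : {measure set (measurableTypeR R) -> \bar R} :=
  mscale (NngNum (ltW b0)) (pushforward (@lebesgue_measure R) g).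
have -> : (b%:E * lebesgue_measure [set x | A (b * x - m)%R])%E = nu mg A by [].
apply: lebesgue_measure_unique => // _ [[u v]] _ <-.
have -> : nu mg [set` `]u, v]] = (b%:E * lebesgue_measure (g @^-1` [set` `]u, v]]))%E by [].
have -> : g @^-1` [set` `]u, v]] = [set` `]((u + m) / b), ((v + m) / b)]].
  apply/seteqP; split => x /=; rewrite !in_itv /= /g ltr_pdivrMr// ler_pdivlMr// => /andP[h1 h2];
    by apply/andP; split; lra.
rewrite !lebesgue_measure_itv /= !lte_fin ltr_pM2r ?invr_gt0// ltrD2r.
case: ifP => _; last by rewrite mule0.
by rewrite -!EFinD -EFinM; congr (_%:E); field; rewrite gt_eqF.
Qed.

(** The [B]-adic interval of level [n] containing [x]. *)
Definition adic (R : realType) (B : nat) (x : R) (n : nat) : set R :=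
  let m := Num.floor ((B ^ n)%:R * x) in
  [set` `[m%:~R / (B ^ n)%:R, (m%:~R + 1) / (B ^ n)%:R[].

Lemma adicP (R : realType) (B : nat) (x y : R) (n : nat) : (0 < B)%N ->
  adic B x n y <-> Num.floor ((B ^ n)%:R * y) = Num.floor ((B ^ n)%:R * x).
Proof.
move=> B0; have b0 : 0 < (B ^ n)%:R :> R by rewrite ltr0n expn_gt0 B0.
rewrite /adic /= in_itv /= ler_pdivrMr// ltr_pdivlMr// [y * _]mulrC; split.
  by move=> h; apply/floor_def; rewrite rmorphD.
by move=> <-; have := floor_itv ((B ^ n)%:R * y); rewrite rmorphD.
Qed.

Lemma len_adic (R : realType) (B : nat) (x : R) (n : nat) : (0 < B)%N ->
  lebesgue_measure (adic B x n) = ((B ^ n)%:R^-1)%:E.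
Proof.
move=> B0; have b0 : 0 < (B ^ n)%:R :> R by rewrite ltr0n expn_gt0 B0.
rewrite /adic lebesgue_measure_itv /= lte_fin ltr_pM2r ?invr_gt0// ltrDl ltr01.
by rewrite -EFinD; congr (_%:E); field; rewrite gt_eqF.
Qed.

Lemma adic_shrinking (R : realType) (B : nat) (x : R) : (1 < B)%N ->
  nicely_shrinking x (adic B x).
Proof.
move=> B1; have B0 : (0 < B)%N by lia.
have b0 n : 0 < (B ^ n)%:R :> R by rewrite ltr0n expn_gt0 B0.
have bi n : 0 < (B ^ n)%:R^-1 :> R by rewrite invr_gt0.
split; first by move=> n; exact: measurable_itv.
exists (2, fun n => PosNum (bi n)); split => //=.
- apply/cvgrPdist_lt => e e0; near=> n; rewrite sub0r normrN gtr0_norm//.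
  rewrite invf_plt ?posrE//.
  apply: lt_le_trans (truncnS_gt e^-1) _; rewrite ler_nat.
  apply: (@leq_trans n); last exact: ltnW (ltn_expl _ B1).
  by near: n; exists (Num.truncn e^-1).+1.
- move=> n y; have : adic B x n x by apply/adicP.
  rewrite /adic /ball /= !in_itv /= !ler_pdivrMr// !ltr_pdivlMr// => /andP[h1 h2] /andP[h3 h4].
  rewrite -[_^-1]div1r ltr_pdivlMr// -[X in _ * X]gtr0_norm// -normrM ltr_norml mulrBl.
  by apply/andP; split; lra.
- move=> n; rewrite len_adic// lebesgue_measure_ball ?(ltW (bi n))// -EFinM lee_fin.
  by rewrite mulr2n mulrDl !mul1r.
Unshelve. all: by end_near.
Qed.

(** Lebesgue density: near a density point of [V], the magnification of a small
    adic interval to the whole circle is almost filled by the image of [V]. *)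
Lemma full_of_magnifications (R : realType) (B : nat) (V W : set R) : (1 < B)%N ->
  unit_set V -> unit_set W -> 0 < len V ->
  (forall x i, V x -> W ((B ^ i)%:R * x - (Num.floor ((B ^ i)%:R * x))%:~R)) ->
  len W = 1.
Proof.
move=> B1 uV uW V0 h; have B0 : (0 < B)%N by lia.
have b0 n : 0 < (B ^ n)%:R :> R by rewrite ltr0n expn_gt0 B0.
apply/eqP; rewrite eq_le len_le1//=.
have [mV _] := uV; have [mW _] := uW.
have lV : locally_integrable [set: R] (\1_V : R -> R).
  by apply: locally_integrable_indic => //; exact: openT.
have [x Vx px] : exists2 x, V x & lebesgue_pt (\1_V : R -> R) x.
  apply: contrapT => hn; have [N [mN N0 hN]] := lebesgue_differentiation lV.
  have VN : V `<=` N by move=> x Vx; apply: hN => /= px; apply: hn; exists x.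
  have : (lebesgue_measure V <= lebesgue_measure N)%E by apply: le_measure; rewrite ?inE.
  by rewrite [X in (_ <= X)%E]N0 (unit_setE uV) lee_fin leNgt V0.
have := @nice_lebesgue_differentiation R (adic B) (fun y => adic_shrinking y B1) _ lV x px.
rewrite indicE mem_set//= => hc.
rewrite -lee_fin -(cvg_lim _ hc)//; apply: lime_le; first by apply/cvg_ex; eexists; exact: hc.
near=> n; have mA : measurable (adic B x n) by exact: measurable_itv.
rewrite integral_indic// len_adic//.
have -> : ((((B ^ n)%:R^-1 : R)%:E)^-1)%E = (B ^ n)%:R%:E.
  by rewrite inver gt_eqF ?invr_gt0// invrK.
rewrite -unit_setE// (@lebesgue_measure_affine R (B ^ n)%:R (Num.floor ((B ^ n)%:R * x))%:~R W)//.
apply: lee_wpmul2l; first by rewrite lee_fin.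
apply: le_measure; rewrite ?inE //=.
- exact: measurableI.
- have := @measurable_affine R (B ^ n)%:R (Num.floor ((B ^ n)%:R * x))%:~R measurableT W mW.
  by rewrite setTI.
- by move=> y [Vy /(adicP _ _ _ B0) <-]; exact: h.
Unshelve. all: by end_near.
Qed.

(** The function whose limsup set is carried into that of [psi] by
    multiplication by [B ^ k]. *)
Definition rescale (R : realType) (B : nat) (psi : nat -> R) (k n : nat) : R :=
  psi (B ^ k * n)%N / (B ^ k)%:R.

Lemma rescale_nonincreasing (R : realType) (B : nat) (psi : nat -> R) (k : nat) : (0 < B)%N ->
  nonincreasing_nonneg psi -> nonincreasing_nonneg (rescale B psi k).
Proof.
move=> B0 [psi0 psimon]; have Bk : (0 < B ^ k)%N by rewrite expn_gt0 B0.
split; first by move=> n n0; rewrite divr_ge0// psi0// muln_gt0 Bk.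
move=> m n m0 mn; rewrite /rescale ler_pM2r ?invr_gt0 ?ltr0n//.
by apply: psimon; rewrite ?muln_gt0 ?Bk// leq_pmul2l.
Qed.

(** Up to a constant depending on [k], a shift of the divergent series of
    [psi]. *)
Lemma rescale_divergence (R : realType) (B : nat) (psi : nat -> R) (k : nat) : (1 < B)%N ->
  nonincreasing_nonneg psi ->
  (forall (J : nat) (M : R), exists K, M <= \sum_(J <= j < K) psi (B ^ j)%N / crad R (B ^ j)) ->
  forall (J : nat) (M : R), exists K,
    M <= \sum_(J <= j < K) rescale B psi k (B ^ j)%N / crad R (B ^ j).
Proof.
move=> B1 [psi0 psimon] hdiv J M.
have B0 m : (0 < B ^ m)%N by rewrite expn_gt0; apply/orP; left; lia.
have b0 m : 0 < (B ^ m)%:R :> R by rewrite ltr0n.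
pose b : R := (B ^ k)%:R; have bp : 0 < b by exact: b0.
have term j : (0 < j)%N -> (b ^+ 2)^-1 * (psi (B ^ (j + k))%N / crad R (B ^ (j + k))) <=
    rescale B psi k (B ^ j)%N / crad R (B ^ j).
  move=> j0; have Bj : (1 < B ^ j)%N.
    by apply: leq_trans (ltn_expl j B1).
  have s0 : 0 < Num.sqrt (ln (B ^ j)%:R) :> R by rewrite sqrtr_gt0 ln_gt0// ltr1n.
  have s1 : Num.sqrt (ln (B ^ j)%:R) <= Num.sqrt (ln (B ^ (j + k))%:R) :> R.
    by apply: ler_wsqrtr; rewrite ler_ln ?posrE// ler_nat leq_exp2l// leq_addr.
  rewrite /rescale -expnD [(k + j)%N]addnC /crad -/b.
  set p := psi _; have p0 : 0 <= p by exact: psi0.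
  set s := Num.sqrt (ln (B ^ j)%:R) in s0 s1 *; set s' := Num.sqrt (ln (B ^ (j + k))%:R) in s1 *.
  have s'0 : 0 < s' by lra.
  rewrite expnD natrM -/b.
  have bj := b0 j; set y := (B ^ j)%:R in bj *.
  have -> : (b ^+ 2)^-1 * (p / (s' / (y * b))) = (p * y / b) * s'^-1 by field; rewrite !gt_eqF.
  have -> : p / b / (s / y) = (p * y / b) * s^-1 by field; rewrite !gt_eqF.
  apply: ler_wpM2l; first by rewrite divr_ge0 ?mulr_ge0// ltW.
  by rewrite lef_pV2 ?posrE.
have [K hK] := hdiv (J.+1 + k)%N (M * b ^+ 2); exists (maxn J.+1 (K - k)%N).
rewrite big_addn in hK.
have x0 i : 0 <= rescale B psi k (B ^ i)%N / crad R (B ^ i).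
  by rewrite !divr_ge0 ?psi0 ?muln_gt0 ?B0 ?sqrtr_ge0.
apply: le_trans (_ : \sum_(J.+1 <= j < K - k) rescale B psi k (B ^ j)%N / crad R (B ^ j) <= _); last first.
  have [h|h] := leqP (K - k) J.+1; first by rewrite [leLHS]big_geq// sumr_ge0.
  by rewrite [leRHS]big_ltn ?lerDr//; exact: ltnW.
apply: le_trans (_ : \sum_(J.+1 <= j < K - k) (b ^+ 2)^-1 * (psi (B ^ (j + k))%N / crad R (B ^ (j + k))) <= _); last first.
  by apply: ler_sum_nat => j /andP[Jj _]; apply: term; exact: leq_trans Jj.
by rewrite -mulr_sumr mulrC ler_pdivlMr ?exprn_gt0.
Qed.

Lemma rescale_homo (R : realType) (alpha : R) (B : nat) (psi : nat -> R) (k : nat) : (0 < B)%N ->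
  nonincreasing_nonneg psi ->
  inhom_approx_set alpha (rescale B psi k.+1) `<=` inhom_approx_set alpha (rescale B psi k).
Proof.
move=> B0 [psi0 psimon] g /inhom_approx_setP[g01 h]; apply/inhom_approx_setP; split => // N.
have [n [Nn Sn hn]] := h N; exists n; split => //; apply: le_trans hn _.
have n0 : (0 < n)%N by case: Sn.
have Bk : (0 < B ^ k)%N by rewrite expn_gt0 B0.
rewrite /rescale; apply: ler_pM.
- by rewrite psi0// muln_gt0 expn_gt0 B0.
- by rewrite invr_ge0.
- by apply: psimon; rewrite ?muln_gt0 ?Bk// leq_pmul2r// leq_pexp2l.
- by rewrite lef_pV2 ?posrE ?ltr0n ?expn_gt0 ?B0// ler_nat leq_pexp2l.
Qed.

Lemma sums_two_squares_sqr (m : nat) : (0 < m)%N -> sums_two_squares (m ^ 2)%N.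
Proof. by move=> m0; split; [rewrite expn_gt0 m0|exists m, 0%N; rewrite addn0]. Qed.

(** If [gamma] is close for [n] then [B ^ k * gamma] is close for [B ^ k * n],
    which is again a sum of two squares because [B] is a square. *)
Lemma rescale_magnify (R : realType) (alpha : R) (a : nat) (psi : nat -> R) (k : nat) (g : R) :
  (0 < a)%N -> let B := (a ^ 2)%N in
  inhom_approx_set alpha (rescale B psi k) g ->
  inhom_approx_set alpha psi ((B ^ k)%:R * g - (Num.floor ((B ^ k)%:R * g))%:~R).
Proof.
move=> a0 B /inhom_approx_setP[_ h]; apply/inhom_approx_setP.
have B0 : (0 < B ^ k)%N by rewrite !expn_gt0 a0.
have b0 : 0 < (B ^ k)%:R :> R by rewrite ltr0n.
split; first by have := floor_itv ((B ^ k)%:R * g); rewrite rmorphD /= => /andP[h1 h2]; apply/andP; split; lra.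
move=> N; have [n [Nn Sn hn]] := h N; exists (B ^ k * n)%N; split.
- by apply: leq_trans Nn _; rewrite leq_pmull.
- apply: sums_two_squaresM => //; rewrite /B -expnM mulnC expnM.
  by apply: sums_two_squares_sqr; rewrite expn_gt0 a0.
rewrite addrA -rmorphN nint_dist_addz natrM -mulrA -mulrDr.
apply: le_trans (nint_distMn _ _) _.
by rewrite mulrC -ler_pdivlMr.
Qed.

(** The rescaled limsup sets decrease and all have measure at least [v], so their
    intersection has positive measure and [full_of_magnifications] applies to
    it. *)
Lemma approx_full (R : realType) (alpha : R) (psi : nat -> R) :
  badly_approximable alpha -> nonincreasing_nonneg psi ->
  (\esum_(n in sums_two_squares) (psi n)%:E = +oo)%E ->
  lebesgue_measure (inhom_approx_set alpha psi) = 1%E.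
Proof.
move=> ba hpsi hsum; have [b [b2 [v v0 hv]]] := approx_positive ba.
have [psi0 psimon] := hpsi; pose B := (b ^ 16)%N; pose a := (b ^ 8)%N.
have a0 : (0 < a)%N by rewrite expn_gt0; apply/orP; left; lia.
have BE : B = (a ^ 2)%N by rewrite /a -expnM.
have B16 : (16 <= B)%N by apply: (@leq_trans (2 ^ 16)) => //; rewrite leq_exp2r.
have B1 : (1 < B)%N by apply: leq_trans B16.
have B0 : (0 < B)%N by apply: leq_trans B16.
have hdiv := block_divergence hpsi B16 (esum_infty_sums psi0 hsum).
have uW k := unit_set_approx alpha (rescale B psi k).
have hW k : v <= len (inhom_approx_set alpha (rescale B psi k)).
  apply: hv; first exact: rescale_nonincreasing.
  exact: rescale_divergence.
rewrite (unit_setE (unit_set_approx alpha psi)); congr (_%:E).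
pose V := \bigcap_k inhom_approx_set alpha (rescale B psi k).
have mV : measurable V.
  by apply: bigcap_measurable => [|k _]; [exists 0%N|case: (uW k)].
have uV : unit_set V by split=> // x /(_ 0%N I) /(proj2 (uW 0%N)).
apply: (@full_of_magnifications R B V) => //; first exact: unit_set_approx.
- apply: lt_le_trans v0 _.
  have hc : (lebesgue_measure \o (fun k => inhom_approx_set alpha (rescale B psi k))) k @[k --> \oo] --> lebesgue_measure V.
    apply: nonincreasing_cvg_mu => //.
    - by rewrite [X in (X < _)%E](unit_setE (uW 0%N)) ltry.
    - by move=> k; case: (uW k).
    - apply/nonincreasing_seqP => k; apply/subsetPset; exact: rescale_homo.
  rewrite -lee_fin -unit_setE// -(cvg_lim _ hc)//.
  apply: lime_ge; first by apply/cvg_ex; eexists; exact: hc.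
  by near=> k; rewrite /= (unit_setE (uW k)) lee_fin.
- move=> x i /(_ i I); rewrite BE => Wx; exact: rescale_magnify.
Unshelve. all: by end_near.
Qed.

(** * The counterexample for well approximable numbers *)

(** Writing [n = (n %/ q) q + n %% q], the point of [n] is within
    [(N / q) ||q alpha||] of that of its residue, so [q] slightly enlarged arcs
    cover all the arcs up to [N]. *)
Lemma periodic_cover (R : realType) (alpha r : R) (q N : nat) : (0 < q)%N -> 0 <= r ->
  exists U : set R, [/\ unit_set U,
    len U <= 6 * (q%:R * r + N%:R * nint_dist (q%:R * alpha)) &
    forall n, (n <= N)%N -> circle_arc (n%:R * alpha) r `<=` U].
Proof.
move=> q0 r0; have qr : 0 < q%:R :> R by rewrite ltr0n.
set d := nint_dist (q%:R * alpha); have d0 : 0 <= d by exact: nint_dist_ge0.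
pose t := r + N%:R / q%:R * d.
have t0 : 0 <= t by rewrite addr_ge0// mulr_ge0// divr_ge0.
exists (\big[setU/set0]_(b <- iota 0 q) circle_arc (b%:R * alpha) t); split.
- by apply: unit_set_bigU => b _; exact: unit_set_arc.
- apply: le_trans (len_bigU_le (fun b _ => unit_set_arc _ _)) _.
  apply: le_trans (ler_sum _ (fun b _ => len_arc (b%:R * alpha) t0)) _.
  rewrite big_const_seq count_predT size_iota iter_addr_0 -mulr_natl.
  by rewrite /t le_eqVlt; apply/orP; left; apply/eqP; field; rewrite gt_eqF.
move=> n nN g [g01 hg]; apply/bigU_seqP; exists (n %% q)%N.
  by rewrite mem_iota ltn_mod q0.
split => //.
have -> : (n %% q)%:R * alpha + g = (n%:R * alpha + g) - (n %/ q)%:R * (q%:R * alpha).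
  by rewrite {2}(divn_eq n q) natrD natrM; ring.
apply: le_trans (nint_distB _ _) _; apply: lerD => //.
apply: le_trans (nint_distMn _ _) _; rewrite ler_wpM2r//.
by apply: le_trans (natr_divn_le R n q) _; rewrite ler_pM2r ?invr_gt0// ler_nat.
Qed.

(** With [N] about [q * sqrt (ln q) / eps], the [q] arcs of [periodic_cover] have
    total length [q * crad N], of order [eps], plus [N ||q alpha||], of order [eps]
    as soon as [q ||q alpha|| sqrt (ln q)] is at most [eps ^ 2]. *)
Lemma small_cover (R : realType) (alpha : R) :
  limn_einf (fun n : nat =>
    (n%:R * nint_dist (n%:R * alpha) * Num.sqrt (ln n%:R))%:E) = 0%E ->
  forall (e s : R) (P : nat), 0 < e -> 0 < s -> exists N, [/\ (P < N)%N, crad R N <= s &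
    exists U : set R, [/\ unit_set U, len U <= e &
      forall n, (n <= N)%N -> circle_arc (n%:R * alpha) (crad R N) `<=` U]].
Proof.
move=> hinf e s P e0 s0; pose eps := Num.min (e / 24) 1.
have ep : 0 < eps by rewrite lt_min ltr01 andbT divr_gt0.
have e1 : eps <= 1 by rewrite ge_min lexx orbT.
have e24 : eps <= e / 24 by rewrite ge_min lexx.
pose K := maxn (maxn P.+1 4) (maxn (Num.truncn (2 / eps)).+1 (Num.truncn (2 / s)).+1).
have [q Kq uq] := @limn_einf_eq0 R _ (eps ^+ 2) K hinf (exprn_gt0 _ ep).
have [Pq q4 qe qs] : [/\ (P < q)%N, (4 <= q)%N, 2 / eps <= q%:R & 2 / s <= q%:R].
  have lt1 (x : R) : (Num.truncn x < q)%N -> x <= q%:R.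
    by move=> h; apply: ltW; apply: lt_le_trans (truncnS_gt x) _; rewrite ler_nat.
  by split; [|apply: leq_trans Kq|apply: lt1; apply: leq_trans Kq|apply: lt1; apply: leq_trans Kq];
    rewrite ?(leq_trans _ Kq)// /K !leq_max leqnn ?orbT.
have q0 : 0 < q%:R :> R by rewrite ltr0n; lia.
have q4r : 4 <= q%:R :> R by rewrite (ler_nat R 4).
set L := Num.sqrt (ln q%:R) in uq.
have L1 : 1 <= L.
  by rewrite -sqrtr1; apply: ler_wsqrtr; exact: ln4_ge1.
have Lq : L <= q%:R.
  rewrite -[leRHS]ger0_norm ?(ltW q0)// -sqrtr_sqr; apply: ler_wsqrtr.
  by have := @ln_sublinear R _ q0; nra.
pose x := q%:R * L / eps; have xq : q%:R <= x.
  by rewrite ler_pdivlMr//; nra.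
pose N := (Num.truncn x).+1.
have xN : x <= N%:R by apply: ltW; exact: truncnS_gt.
have N2x : N%:R <= 2 * x.
  rewrite /N -natr1; have : (Num.truncn x)%:R <= x by rewrite truncn_le; lra.
  by lra.
have qN : (q <= N)%N by rewrite -(ler_nat R); exact: le_trans xq xN.
have N0 : 0 < N%:R :> R by rewrite ltr0n.
have lN : Num.sqrt (ln N%:R) <= 2 * L.
  have -> : 2 * L = Num.sqrt (2 ^+ 2 * ln q%:R).
    by rewrite sqrtrM ?sqr_ge0// sqrtr_sqr ger0_norm.
  apply: ler_wsqrtr; have -> : 2 ^+ 2 * ln q%:R = ln (q%:R ^+ 4) :> R.
    by rewrite lnXn// -[_ *+ 4]mulr_natl -natrX.
  rewrite ler_ln ?posrE ?exprn_gt0//; apply: le_trans N2x _.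
  have -> : 2 * x = 2 / eps * (q%:R * L) by rewrite /x; field; rewrite gt_eqF.
  have -> : q%:R ^+ 4 = q%:R ^+ 2 * (q%:R * q%:R) :> R by ring.
  apply: ler_pM; rewrite ?divr_ge0 ?mulr_ge0 ?(ltW ep) ?(ltW q0)//; first lra.
    by apply: le_trans qe _; nra.
  by rewrite ler_pM2l.
have qcrad : q%:R * crad R N <= 2 * eps.
  rewrite /crad mulrA ler_pdivrMr//.
  apply: le_trans (ler_wpM2l (ltW q0) lN) _.
  apply: le_trans (ler_wpM2l _ xN); last lra.
  by rewrite /x le_eqVlt; apply/orP; left; apply/eqP; field; rewrite gt_eqF.
have c0 : 0 <= crad R N by rewrite divr_ge0 ?sqrtr_ge0.
exists N; split; first exact: leq_trans Pq qN.
  have : 2 <= q%:R * s by rewrite -ler_pdivrMr.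
  move: qcrad; rewrite -[_ <= s](ler_pM2l q0); nra.
have [U [uU lU cU]] := @periodic_cover R alpha (crad R N) q N (leq_trans (isT : 0 < 4)%N q4) c0.
exists U; split => //; apply: le_trans lU _.
set d := nint_dist _ in uq *; have d0 : 0 <= d by exact: nint_dist_ge0.
have : N%:R * d <= 2 * eps.
  apply: le_trans (ler_wpM2r d0 N2x) _.
  have -> : 2 * x * d = 2 * (q%:R * d * L) / eps by rewrite /x; field; rewrite gt_eqF.
  rewrite ler_pdivrMr//; have : q%:R * d * L <= eps ^+ 2 by exact: ltW.
  by rewrite expr2; lra.
by lra.
Qed.

(** On a block ending at [N] the critical radius carries a mass bounded below,
    even if the integers up to [P] are removed. *)
Lemma count_mass (R : realType) : exists2 c : R, 0 < c & exists N0 : nat, forall P N : nat,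
  (N0 <= N)%N -> (P <= N)%N -> crad R N * P%:R <= c ->
  c <= \sum_(P.+1 <= n < N.+1 | `[< sums_two_squares n >]) crad R N.
Proof.
have [c c0 [N0 hN]] := ncount_pnat_ge R; exists (c / 2); first by rewrite divr_gt0.
exists (maxn N0 1) => P N; rewrite geq_max => /andP[hN0 N1] PN hP.
have n0 : 0 < N%:R :> R by rewrite ltr0n.
have cr0 : 0 <= crad R N by rewrite divr_ge0 ?sqrtr_ge0.
have h1 : c <= crad R N * ncount R (pnat (residue4 1)) N.
  have := hN N hN0; rewrite -ler_pdivlMr// => h; apply: le_trans h _.
  by rewrite /crad le_eqVlt; apply/orP; left; apply/eqP; field; rewrite gt_eqF.
have h2 : ncount R (pnat (residue4 1)) N <= P%:R + \sum_(P.+1 <= n < N.+1 | `[< sums_two_squares n >]) 1.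
  rewrite /ncount (@big_cat_nat _ _ _ P.+1)//=; apply: lerD; first exact: ncount_le.
  rewrite big_mkcond [leRHS]big_mkcond; apply: ler_sum => n _.
  case: ifP => [/pnat_sums_two_squares Sn|_]; last by case: ifP.
  by case: asboolP.
have -> : \sum_(P.+1 <= n < N.+1 | `[< sums_two_squares n >]) crad R N =
   crad R N * \sum_(P.+1 <= n < N.+1 | `[< sums_two_squares n >]) 1.
  by rewrite mulr_sumr; apply: eq_bigr => n _; rewrite mulr1.
have := ler_wpM2l cr0 h2; rewrite mulrDr; lra.
Qed.

(** Blocks ending at scales [N k] given by [small_cover] with covers of length
    [2 ^ (- k)], each scale chosen after the previous one so that [psi] is
    nonincreasing and the part of the block below the previous scale is
    negligible. *)
Lemma exists_null_divergent (R : realType) (alpha : R) :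
  limn_einf (fun n : nat =>
    (n%:R * nint_dist (n%:R * alpha) * Num.sqrt (ln n%:R))%:E : \bar R) = 0%E ->
  exists psi : nat -> R, [/\ nonincreasing_nonneg psi,
    (\esum_(n in sums_two_squares) (psi n)%:E = +oo)%E &
    lebesgue_measure (inhom_approx_set alpha psi) = 0%E].
Proof.
move=> hinf; have [c c0 [N0 hmass]] := count_mass R.
pose s P := Num.min (crad R P) (c / P.+1%:R).
have /choice[f fP] : forall kP : nat * nat, exists N, (1 < kP.2)%N ->
    [/\ (maxn kP.2 N0 < N)%N, crad R N <= s kP.2 & exists U : set R,
     [/\ unit_set U, len U <= 2^-1 ^+ kP.1 & forall n, (n <= N)%N -> circle_arc (n%:R * alpha) (crad R N) `<=` U]].
  move=> [k P] /=; have [P1|_] := ltnP 1 P; last by exists 0%N.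
  have sP : 0 < s P by rewrite lt_min crad_gt0// divr_gt0.
  have ek : 0 < 2^-1 ^+ k :> R by rewrite exprn_gt0.
  by have [N hN] := small_cover hinf (maxn P N0) ek sP; exists N.
pose N := fix N k := if k is k'.+1 then f (k', N k') else 2%N.
have NS k : N k.+1 = f (k, N k) by [].
have N1 k : (1 < N k)%N.
  elim: k => // k IH; rewrite NS; have [h _ _] := fP (k, N k) IH.
  by apply: leq_trans IH _; apply: ltnW; apply: leq_ltn_trans h; rewrite leq_maxl.
have fN k := fP (k, N k) (N1 k); rewrite /= in fN.
have Nlt k : (N k < N k.+1)%N.
  by rewrite NS; have [h _ _] := fN k; apply: leq_ltn_trans h; rewrite leq_maxl.
have Nk k : (k <= N k)%N by elim: k => // k IH; exact: leq_ltn_trans IH (Nlt k).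
have Nmon j k : (j <= k)%N -> (N j <= N k)%N.
  elim: k => [|k IH]; first by rewrite leqn0 => /eqP ->.
  by rewrite leq_eqVlt => /predU1P[->//|/IH h]; exact: leq_trans h (ltnW (Nlt k)).
have cmon j k : (j <= k)%N -> crad R (N k) <= crad R (N j).
  elim: k => [|k IH]; first by rewrite leqn0 => /eqP ->.
  rewrite leq_eqVlt => /predU1P[->//|/IH]; apply: le_trans.
  by have [_ h _] := fN k; rewrite NS; apply: le_trans h _; rewrite ge_min lexx.
have /choice[idx idxP] : forall n, exists k, (n <= N k)%N /\ forall j, (n <= N j)%N -> (k <= j)%N.
  move=> n; have hex : exists k, (n <= N k)%N by exists n.
  by case: (ex_minnP hex) => k h1 h2; exists k.
pose psi n := crad R (N (idx n)).
have psi0 n : 0 <= psi n by rewrite ltW// crad_gt0.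
exists psi; split.
- split => // m n _ mn; apply: cmon; apply: (idxP m).2; exact: leq_trans mn (idxP n).1.
- apply: esum_infty => // M.
  have step k : c <= \sum_((N k).+1 <= n < (N k.+1).+1 | `[< sums_two_squares n >]) psi n.
    have [h1 h2 _] := fN k; rewrite NS.
    apply: le_trans (_ : \sum_((N k).+1 <= n < (f (k, N k)).+1 | `[< sums_two_squares n >]) crad R (f (k, N k)) <= _).
      apply: hmass.
      - by apply: ltnW; apply: leq_ltn_trans h1; rewrite leq_maxr.
      - by apply: ltnW; apply: leq_ltn_trans h1; rewrite leq_maxl.
      apply: le_trans (ler_wpM2r _ h2) _ => //.
      apply: le_trans (_ : c / (N k).+1%:R * (N k)%:R <= _).
        by rewrite ler_wpM2r// ge_min lexx orbT.
      rewrite mulrAC ler_pdivrMr// ler_wpM2l ?(ltW c0)// ler_nat; exact: leqnSn.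
    apply: ler_sum_nat_cond => n /andP[h3 h4] _; rewrite -NS; apply: cmon.
    by apply: (idxP n).2; rewrite -ltnS NS.
  have tot K : c * K%:R <= \sum_(0 <= n < (N K).+1 | `[< sums_two_squares n >]) psi n.
    elim: K => [|K IH]; first by rewrite mulr0 sumr_ge0.
    rewrite (@big_cat_nat _ _ _ (N K).+1)//=; last by rewrite ltnS ltnW.
    by rewrite -natr1 mulrDr mulr1; exact: lerD.
  exists (N (Num.truncn (M / c)).+1).+1; apply: le_trans (tot _).
  by rewrite mulrC -ler_pdivrMr//; apply: ltW; exact: truncnS_gt.
have /choice[U UP] : forall k, exists U : set R,
   [/\ unit_set U, len U <= 2^-1 ^+ k & forall n, (n <= N k.+1)%N -> circle_arc (n%:R * alpha) (crad R (N k.+1)) `<=` U].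
  by move=> k; have [_ _ h] := fN k; rewrite NS.
have h0 : lebesgue_measure (lim_sup_set U) = 0%E.
  apply: (@borel_cantelli_unit R U (fun k => 2^-1 ^+ k) 2).
  - by move=> k; case: (UP k).
  - by move=> k; case: (UP k).
  - move=> K; suff -> : \sum_(0 <= k < K) 2^-1 ^+ k = 2 - 2 * 2^-1 ^+ K :> R.
      have : 0 <= 2^-1 ^+ K :> R by rewrite exprn_ge0.
      by lra.
    elim: K => [|K IH]; first by rewrite big_geq// expr0; ring.
    by rewrite big_nat_recr//= IH exprS; field.
apply/eqP; rewrite eq_le measure_ge0 andbT -h0; apply: le_measure.
- by rewrite inE; case: (unit_set_approx alpha psi).
- by rewrite inE; case: (@unit_set_lim_sup R U (fun k => let: And3 h _ _ := UP k in h)).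
move=> g /inhom_approx_setP[g01 hg] K _.
have [n [nK Sn hn]] := hg (N K.+1).+1.
have hk : (K.+1 < idx n)%N.
  rewrite ltnNge; apply/negP => h; have := leq_trans (idxP n).1 (Nmon _ _ h).
  by rewrite leqNgt nK.
exists (idx n).-1; first by rewrite /=; lia.
have [_ _ cU] := UP (idx n).-1; have e : (idx n).-1.+1 = idx n by lia.
rewrite e in cU; apply: (cU n); [exact: (idxP n).1|by split].
Qed.

(** * The zero-one law and its failure *)

Theorem corollary3 (R : realType) :
  (forall alpha : R, badly_approximable alpha ->
     forall psi : nat -> R, nonincreasing_nonneg psi ->
       ((\esum_(n in sums_two_squares) (psi n)%:E < +oo)%E ->
          lebesgue_measure (inhom_approx_set alpha psi) = 0%E) /\
       ((\esum_(n in sums_two_squares) (psi n)%:E = +oo)%E ->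
          lebesgue_measure (inhom_approx_set alpha psi) = 1%E)) /\
  (forall alpha : R,
     limn_einf (fun n : nat =>
       (n%:R * nint_dist (n%:R * alpha) * Num.sqrt (ln n%:R))%:E : \bar R)
       = 0%E ->
     exists psi : nat -> R,
       [/\ nonincreasing_nonneg psi,
           (\esum_(n in sums_two_squares) (psi n)%:E = +oo)%E &
           lebesgue_measure (inhom_approx_set alpha psi) = 0%E]).
Proof.
split; last exact: exists_null_divergent.
move=> alpha ba psi hpsi; split.
  by apply: approx_null; case: hpsi.
exact: approx_full.
Qed.
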